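(* Let $1\le\beta<\infty$ and let $A$ be a normal operator in a complex Hilbert space $X$. Then $A$ generates a $C_0$-semigroup (of normal operators) on $X$ that is $\beta$th-order Roumieu-type Gevrey ultradifferentiable on $(0,\infty)$ if and only if there exist $b>0$ and $a\in\mathbb{R}$ such that $$\sigma(A)\subseteq\{\lambda\in\mathbb{C} : \operatorname{Re}\lambda\le a-b|\operatorname{Im}\lambda|^{1/\beta}\}.$$
   Context: Normal operators are allowed to be unbounded (densely defined, closed, $A^*A=AA^*$); $\sigma(A)$ is the spectrum. A $C_0$-semigroup $\{T(t)\}_{t\ge0}$ on $X$ is $\beta$th-order Roumieu-type Gevrey ultradifferentiable on $(0,\infty)$ if, for every $f\in X$, the orbit $g(t)=T(t)f$ is infinitely differentiable on $(0,\infty)$ and, for every compact interval $[c,d]\subset(0,\infty)$, there exist $\alpha>0$ and $K>0$ such that $\max_{c\le t\le d}\|g^{(n)}(t)\|\le K\alpha^n(n!)^\beta$ for all $n=0,1,2,\dots$. *)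

(* Defs.v *)
From HB Require Import structures.
From mathcomp Require Import all_boot all_order all_algebra sesquilinear.
From mathcomp Require Import all_classical all_reals all_analysis.
From mathcomp Require Export complex.

Set Implicit Arguments.
Unset Strict Implicit.
Unset Printing Implicit Defensive.

Import Order.TTheory GRing.Theory Num.Theory.
Import numFieldNormedType.Exports.

Local Open Scope classical_set_scope.
Local Open Scope ring_scope.
Local Open Scope complex_scope.

(* The topology of [X] is that of its norm, so a complex Hilbert space is a
   complete normed module over [R[i]] together with a positive definite
   Hermitian form inducing that norm. The form is linear in its first argument
   and conjugate linear in its second one. *)
Definition induces_norm (R : realType) (X : normedModType R[i])
    (dot : {dot X for @Num.conj R[i]}) : Prop :=
  forall x : X, dot x x = `|x| ^+ 2.

(* The values of [op_fun] outside [op_dom] are irrelevant, hence [op_eq]. *)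
Record operator (X : Type) := Operator {
  op_dom : set X;
  op_fun :> X -> X
}.

Definition op_eq (X : Type) (A B : operator X) : Prop :=
  op_dom A = op_dom B /\ (forall x, op_dom A x -> A x = B x).

Definition op_comp (X : Type) (B A : operator X) : operator X :=
  Operator [set x | op_dom A x /\ op_dom B (A x)] (fun x => B (A x)).

Definition linear_op (K : pzRingType) (X : lmodType K) (A : operator X) : Prop :=
  op_dom A 0 /\
  forall (a : K) (x y : X), op_dom A x -> op_dom A y ->
    op_dom A (a *: x + y) /\ A (a *: x + y) = a *: A x + A y.

Definition closed_op (X : topologicalType) (A : operator X) : Prop :=
  closed [set p : X * X | op_dom A p.1 /\ p.2 = A p.1].

(* When [A] is densely defined there is at most one [z] for each [y], so that
   the choice made by [xget] is forced on the domain. *)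
Definition adjoint (R : realType) (X : normedModType R[i])
    (dot : {dot X for @Num.conj R[i]}) (A : operator X) : operator X :=
  let adj y := [set z : X | forall x, op_dom A x -> dot (A x) y = dot x z] in
  Operator [set y | exists z, adj y z] (fun y => xget 0 (adj y)).

Definition normal_op (R : realType) (X : normedModType R[i])
    (dot : {dot X for @Num.conj R[i]}) (A : operator X) : Prop :=
  [/\ linear_op A, dense (op_dom A), closed_op A &
      op_eq (op_comp (adjoint dot A) A) (op_comp A (adjoint dot A))].

Definition resolvent_set (R : realType) (X : normedModType R[i])
    (A : operator X) : set R[i] :=
  [set l | exists S : {linear X -> X}, [/\ continuous S,
    forall y, op_dom A (S y) /\ l *: S y - A (S y) = y &
    forall x, op_dom A x -> S (l *: x - A x) = x]].

Definition spectrum (R : realType) (X : normedModType R[i])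
    (A : operator X) : set R[i] := ~` resolvent_set A.

(* The maps [T t] with [t < 0] are unconstrained. *)
Definition C0_semigroup (R : realType) (X : normedModType R[i])
    (T : R -> {linear X -> X}) : Prop :=
  [/\ forall t, 0 <= t -> continuous (T t),
      forall x, T 0 x = x,
      forall s t, 0 <= s -> 0 <= t -> forall x, T (s + t) x = T s (T t x) &
      forall x, T t x @[t --> 0^'+] --> x].

Definition semigroup_generator (R : realType) (X : normedModType R[i])
    (T : R -> {linear X -> X}) : operator X :=
  Operator [set x | cvg ((h^-1)%:C *: (T h x - x) @[h --> 0^'+])]
           (fun x => lim ((h^-1)%:C *: (T h x - x) @[h --> 0^'+])).

Definition generates (R : realType) (X : normedModType R[i])
    (A : operator X) (T : R -> {linear X -> X}) : Prop :=
  C0_semigroup T /\ op_eq A (semigroup_generator T).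

(* The library's [derive1] needs the target to be normed over the field of the
   real variable, whereas [X] is normed over [R[i]]. *)
Definition rdiffq (R : realType) (X : normedModType R[i])
    (g : R -> X) (t h : R) : X := (h^-1)%:C *: (g (t + h) - g t).

Definition rderivable (R : realType) (X : normedModType R[i])
    (g : R -> X) (t : R) : Prop := cvg (rdiffq g t h @[h --> 0^']).

Definition rderive (R : realType) (X : normedModType R[i])
    (g : R -> X) (t : R) : X := lim (rdiffq g t h @[h --> 0^']).

Definition rderiven (R : realType) (X : normedModType R[i])
    (n : nat) (g : R -> X) : R -> X := iter n (@rderive R X) g.

Definition smooth_on_pos (R : realType) (X : normedModType R[i])
    (g : R -> X) : Prop :=
  forall (n : nat) (t : R), 0 < t -> rderivable (rderiven n g) t.

Definition roumieu_gevrey (R : realType) (X : normedModType R[i]) (beta : R)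
    (T : R -> {linear X -> X}) : Prop :=
  forall f : X, let g := fun t => T t f in
    smooth_on_pos g /\
    forall c d : R, 0 < c -> c <= d ->
      exists alpha K : R, [/\ 0 < alpha, 0 < K &
        forall (n : nat) (t : R), c <= t <= d ->
          `|rderiven n g t| <= (K * alpha ^+ n * n`!%:R `^ beta)%:C].

(* Main.v *)
(* Sufficiency. Let S = (mu - A)^-1 for a real mu to the right of the spectrum;
   it is a bounded normal operator, and lambda in sigma(A) corresponds to
   z = 1 / (mu - lambda). Let K be the image of the region in the z-plane, with 0
   added. If f = p / q is rational without poles on K, factoring w q - p shows that
   w - f(S) is invertible for |w| > sup_K |f|; as f(S) is normal, its norm is its
   spectral radius, so that |f(S)| <= sup_K |f|. Hence f(S) makes sense for uniform limits on K of
   rational functions. On the region, Re lambda tends to -oo with |lambda|, so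
   that lambda^n exp(t lambda), t > 0, is such a limit: exp(t lambda) is the
   uniform limit of (1 - t lambda / n)^-n, and each power of lambda is a limit of
   difference quotients in t. The operators exp(t A) obtained in this way form the
   semigroup, whose derivatives are the A^n exp(t A), of norm at most
   sup |lambda^n exp(t lambda)| <= K alpha^n (n!)^beta.

   Necessity. By Baire's theorem the constants in the Gevrey bound at t = 1 can be
   chosen uniformly in f. Every spectral point of a normal operator is an
   approximate eigenvalue, and on approximate eigenvectors the n-th derivative at
   t = 1 is almost lambda^n exp(lambda); so
   |lambda|^n exp(Re lambda) <= K alpha^n (n!)^beta for all n, and the right choice
   of n yields the region. *)
From HB Require Import structures.
Require Import Defs.
From mathcomp Require Import all_boot all_order all_algebra sesquilinear.
From mathcomp Require Import all_classical all_reals all_analysis.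
From mathcomp Require Import ring lra.

Set Implicit Arguments.
Unset Strict Implicit.
Unset Printing Implicit Defensive.

Import Order.TTheory GRing.Theory Num.Theory.
Import numFieldNormedType.Exports.

Local Open Scope classical_set_scope.
Local Open Scope ring_scope.
Local Open Scope complex_scope.

Import Normc.

(** * Norms and sequences *)

(** Two obstacles shape the proof. The identity [A^* A = A A^*] says something only on the domain of
    [A^* A]. The equality of the domains of [A] and of its adjoint, and the surjectivity of [l - A]
    once it is bounded below, must be extracted from it. Both come from weak equations: the
    regularisers [(1 + A^* A / (n + 1))^-1] map into that domain and commute there with [A] and its
    adjoint, and the normal equation for [l - A] yields a preimage once its two factors are
    exchanged. The second obstacle is the norm of [f(S)]. The inequality [|N x|^2 <= |N (N x)| |x|]
    turns a bound on one high power of [N] into a bound on [N], and averages of resolvents over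
    roots of unity supply that power. Limits stay normal because the whole calculus lives in the
    bicommutant of [S] and its adjoint. The point [0] of [K] stands for infinity, where every symbol
    [l^n exp(t l)] vanishes; one Taylor estimate for these symbols serves both to construct the
    operators and to differentiate the orbits. In the converse, [n] is about
    [(|Im l| / alpha)^(1/beta) / e], the near-minimiser of [alpha^n (n!)^beta / |Im l|^n]; this is
    the origin of the exponent [1/beta]. *)

Section RealNorm.
Variables (R : realType) (X : normedModType R[i]).

(* The norm of [X] takes its values in [R[i]]. *)
Definition nr (x : X) : R := complex.Re `|x|.

Lemma nrE (x : X) : `|x| = (nr x)%:C.
Proof. by rewrite /nr RRe_real// normr_real. Qed.

Lemma nr_ge0 (x : X) : 0 <= nr x.
Proof. by rewrite -ler0c -nrE. Qed.

Lemma nr0 : nr 0 = 0.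
Proof. by rewrite /nr normr0. Qed.

Lemma nr_eq0 (x : X) : nr x = 0 -> x = 0.
Proof. by move=> x0; apply/eqP; rewrite -normr_eq0 nrE x0. Qed.

Lemma nr_gt0 (x : X) : x != 0 -> 0 < nr x.
Proof. by move=> x0; rewrite -ltcR -nrE normr_gt0. Qed.

Lemma nrD (x y : X) : nr (x + y) <= nr x + nr y.
Proof. by rewrite -lecR rmorphD /= -!nrE ler_normD. Qed.

Lemma nrN (x : X) : nr (- x) = nr x.
Proof. by rewrite /nr normrN. Qed.

Lemma nrB (x y : X) : nr (x - y) <= nr x + nr y.
Proof. by rewrite -(nrN y) nrD. Qed.

Lemma nrBC (x y : X) : nr (x - y) = nr (y - x).
Proof. by rewrite -nrN opprB. Qed.

Lemma nr_tri (y x z : X) : nr (x - z) <= nr (x - y) + nr (y - z).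
Proof. by rewrite -[x - z](subrKA y) nrD. Qed.

Lemma nr_subl (x y : X) : nr x - nr y <= nr (x - y).
Proof. by have := nrD (x - y) y; rewrite subrK; lra. Qed.

Lemma nrZ (a : R[i]) (x : X) : nr (a *: x) = normc a * nr x.
Proof. by apply: (@complexI R); rewrite rmorphM /= -!nrE normrZ. Qed.

Lemma normcR (r : R) : normc r%:C = `|r|.
Proof. by rewrite /normc /= expr0n addr0 sqrtr_sqr. Qed.

Lemma nrZR (r : R) (x : X) : nr (r%:C *: x) = `|r| * nr x.
Proof. by rewrite nrZ normcR. Qed.

Lemma normc_ge0 (z : R[i]) : 0 <= normc z.
Proof. by case: z => a b; exact: sqrtr_ge0. Qed.

End RealNorm.

Section Seq.
Variables (R : realType) (X : completeNormedModType R[i]).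

(** Epsilons and norms are real here, so that estimates are linear arithmetic over [R] instead of
    the partial order of [R[i]]. *)
Definition cvs (u : nat -> X) (l : X) :=
  forall e : R, 0 < e -> exists N, forall n, (N <= n)%N -> nr (u n - l) < e.

Lemma cvsP (u : nat -> X) (l : X) : cvs u l <-> u @ \oo --> l.
Proof.
split=> [ul|/cvgrPdist_lt ul e e0].
  apply/cvgrPdist_lt => e; rewrite ltcE => /andP[/eqP /= ie re].
  have [N HN] := ul _ re; exists N => // n /= /HN.
  by rewrite nrE nrBC ltcE /= ie eqxx.
have /ul[N _ HN] : 0 < e%:C :> R[i] by rewrite ltcR.
by exists N => n /HN /=; rewrite nrE ltcR nrBC.
Qed.

Lemma cvs_complete (u : nat -> X) :
  (forall e : R, 0 < e -> exists N, forall m n, (N <= m)%N -> (N <= n)%N ->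
    nr (u m - u n) < e) -> exists l, cvs u l.
Proof.
move=> cu; have : cvg (u @ \oo).
  apply/cauchy_cvgP/cauchy_exP => e; rewrite ltcE => /andP[/eqP /= ie re].
  have [N HN] := cu _ re; exists (u N); rewrite /fmapE -ball_normE.
  by exists N => // n /= nN; rewrite nrE ltcE /= ie eqxx HN.
by move=> /cvg_ex[l /cvsP]; exists l.
Qed.

Lemma cvs_uniq (u : nat -> X) l l' : cvs u l -> cvs u l' -> l = l'.
Proof. by move=> /cvsP ul /cvsP ul'; exact: (cvg_unique _ ul ul'). Qed.

End Seq.

(** * Inner products *)

Section InnerProduct.
Variables (R : realType) (X : normedModType R[i]).
Variables (dot : {dot X for @Num.conj R[i]}) (hdot : induces_norm dot).

(** A symmetric real bilinear form that still determines [dot] (see [dotE]); conjugation enters only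
    through [ipJ]. *)
Definition ip (x y : X) : R := complex.Re (dot x y).

Lemma ipDl x y z : ip (x + y) z = ip x z + ip y z.
Proof. by rewrite /ip linearDl raddfD. Qed.

Lemma ipDr x y z : ip z (x + y) = ip z x + ip z y.
Proof. by rewrite /ip linearDr raddfD. Qed.

Lemma ipNl x z : ip (- x) z = - ip x z.
Proof. by rewrite /ip linearNl raddfN. Qed.

Lemma ipNr x z : ip z (- x) = - ip z x.
Proof. by rewrite /ip linearNr raddfN. Qed.

Lemma ipBl x y z : ip (x - y) z = ip x z - ip y z.
Proof. by rewrite ipDl ipNl. Qed.

Lemma ipBr x y z : ip z (x - y) = ip z x - ip z y.
Proof. by rewrite ipDr ipNr. Qed.

Lemma ip0l z : ip 0 z = 0.
Proof. by rewrite /ip linear0l. Qed.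

Lemma ip0r z : ip z 0 = 0.
Proof. by rewrite /ip linear0r. Qed.

Lemma conjCE (z : R[i]) : Num.conj z = (z^*)%C.
Proof. by []. Qed.

Lemma dotZl (a : R[i]) x y : dot (a *: x) y = a * dot x y.
Proof. by rewrite linearZl_LR. Qed.

Lemma dotZr (a : R[i]) x y : dot x (a *: y) = (a^*)%C * dot x y.
Proof. by rewrite linearZr_LR /= conjCE. Qed.

Lemma dotC x y : dot x y = ((dot y x)^*)%C.
Proof. by rewrite hermC /= expr0 mul1r conjCE. Qed.

Lemma ipC x y : ip x y = ip y x.
Proof. by rewrite /ip dotC; case: (dot y x). Qed.

Lemma ipZl (r : R) x y : ip (r%:C *: x) y = r * ip x y.
Proof. by rewrite /ip dotZl; case: (dot x y) => a b /=; ring. Qed.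

Lemma ipZr (r : R) x y : ip x (r%:C *: y) = r * ip x y.
Proof. by rewrite ipC ipZl ipC. Qed.

Lemma ipJ (a : R[i]) x y : ip (a *: x) y = ip x ((a^*)%C *: y).
Proof. by rewrite /ip dotZl dotZr conjcK. Qed.

Lemma dotE x y : dot x y = ip x y +i* ip x ('i *: y).
Proof. by rewrite /ip dotZr; case: (dot x y) => a b; simpc; congr (_ +i* _); ring. Qed.

Lemma ipxx x : ip x x = nr x ^+ 2.
Proof. by rewrite /ip hdot nrE -rmorphXn. Qed.

Lemma nr_ipD x y : nr (x + y) ^+ 2 = nr x ^+ 2 + 2 * ip x y + nr y ^+ 2.
Proof. by rewrite -!ipxx ipDl !ipDr (ipC y x); ring. Qed.

Lemma nr_ipB x y : nr (x - y) ^+ 2 = nr x ^+ 2 - 2 * ip x y + nr y ^+ 2.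
Proof. by rewrite nr_ipD ipNr nrN; ring. Qed.

(** Expand the square norm of [|y| x - |x| y] and divide by [|x| |y|]. *)
Lemma ip_CS x y : ip x y <= nr x * nr y.
Proof.
have [->|y0] := eqVneq y 0; first by rewrite ip0r nr0 mulr0.
have ny := nr_gt0 y0.
have [->|x0] := eqVneq x 0; first by rewrite ip0l nr0 mul0r.
have nx := nr_gt0 x0.
have := sqr_ge0 (nr ((nr y)%:C *: x - (nr x)%:C *: y)).
rewrite nr_ipB ipZl ipZr !nrZR !ger0_norm ?nr_ge0//.
have p0 : 0 < nr x * nr y by rewrite mulr_gt0.
by move=> h; rewrite -(ler_pM2l p0); nra.
Qed.

Lemma ip_CSN x y : `|ip x y| <= nr x * nr y.
Proof. by rewrite ler_norml ip_CS lerNl -ipNl (le_trans (ip_CS _ _))// nrN. Qed.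

Lemma ip_eq0 x : (forall y, ip y x = 0) -> x = 0.
Proof. by move=> /(_ x); rewrite ipxx => /eqP; rewrite sqrf_eq0 => /eqP/nr_eq0. Qed.

Lemma ip_inj x x' : (forall y, ip y x = ip y x') -> x = x'.
Proof.
by move=> h; apply/eqP; rewrite -subr_eq0; apply/eqP/ip_eq0 => y; rewrite ipBr h subrr.
Qed.

End InnerProduct.

(** * Bounded functionals for a semidefinite form *)

Section Minimisation.
Variables (R : realType) (V : lmodType R[i]) (D : set V).
Variables (s : V -> V -> R) (phi : V -> R) (C : R).
Hypothesis D0 : D 0.
Hypothesis DD : forall x y, D x -> D y -> D (x + y).
Hypothesis DZ : forall (r : R) x, D x -> D (r%:C *: x).
Hypothesis sDl : forall x y z, D x -> D y -> D z -> s (x + y) z = s x z + s y z.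
Hypothesis sZl : forall (r : R) x y, D x -> D y -> s (r%:C *: x) y = r * s x y.
Hypothesis sC : forall x y, D x -> D y -> s x y = s y x.
Hypothesis s_ge0 : forall x, D x -> 0 <= s x x.
Hypothesis phiD : forall x y, D x -> D y -> phi (x + y) = phi x + phi y.
Hypothesis phiZ : forall (r : R) x, D x -> phi (r%:C *: x) = r * phi x.
Hypothesis phiC : forall x, D x -> phi x ^+ 2 <= C * s x x.

(* Almost minimisers of the energy [s u u - 2 phi u] almost represent [phi]. *)
Lemma almost_riesz (e : R) : 0 < e -> exists u, D u /\
  forall h, D h -> (phi h - s h u) ^+ 2 <= e * s h h.
Proof.
move=> e0.
pose J u := s u u - 2 * phi u.
have Jge u : D u -> - (`|C| + 1) <= J u.
  move=> Du; have := phiC Du; have := s_ge0 Du.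
  have : C <= `|C| by exact: ler_norm.
  have := normr_ge0 C; rewrite /J; move: (s u u) (phi u) `|C| => S F c c0 Cc S0.
  move=> FC.
  have {}FC : F ^+ 2 <= c * S by apply: le_trans FC _; rewrite ler_wpM2r.
  (* [(S + c + 1)^2 = (S - c - 1)^2 + 4 S (c + 1)], while [F^2 <= c S]. *)
  have : (2 * F) ^+ 2 <= (S + (c + 1)) ^+ 2.
    by have := sqr_ge0 (S - (c + 1)); lra.
  have -> : - (c + 1) <= S - 2 * F = (2 * F <= S + (c + 1)) by apply/idP/idP; lra.
  by apply: contraTT; rewrite -!ltNge => ?; rewrite ltr_pXn2r// nnegrE; lra.
pose E := [set J u | u in D].
have iE : has_inf E.
  split; first by exists (J 0), 0.
  by exists (- (`|C| + 1)) => _ [u Du <-]; exact: Jge.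
have [_ [u Du <-] Ju] := inf_adherent e0 iE.
exists u; split=> // h Dh.
have Jle v : D v -> J u - e <= J v.
  move=> Dv; have : inf E <= J v by apply: ge_inf; [case: iE | exists v].
  lra.
(* Almost minimality of [u] against the competitor [u + t h]. *)
have key (t : R) : 0 <= t ^+ 2 * s h h - 2 * t * (phi h - s h u) + e.
  have := Jle _ (DD Du (DZ t Dh)); rewrite /J.
  have Dth := DZ t Dh; have DD1 := DD Du Dth.
  rewrite sDl// (sC Du DD1) (sC Dth DD1) !sDl// !sZl// (sC Du Dth) sZl// (sC Dh Dth) sZl//.
  rewrite phiD// phiZ//; lra.
(* If [s h h = 0], the polynomial is affine in [t] and its slope must vanish: the [t] chosen below
   would give the value [-1]. Otherwise its minimum, at [t = (phi h - s h u) / s h h], gives the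
   claim. *)
have [sh0|sh0] := eqVneq (s h h) 0.
  rewrite sh0 mulr0; set c := phi h - s h u in key *.
  have [->|c0] := eqVneq c 0; first by rewrite expr0n.
  have := key ((e + 1) / (2 * c)); rewrite sh0 mulr0 add0r.
  have -> : 2 * ((e + 1) / (2 * c)) * c = e + 1 by field.
  lra.
have {}sh0 : 0 < s h h by rewrite lt_def sh0 s_ge0.
have := key ((phi h - s h u) / s h h); set c := phi h - s h u.
have -> : (c / s h h) ^+ 2 * s h h - 2 * (c / s h h) * c + e = e - c ^+ 2 / s h h.
  by field; rewrite gt_eqF.
by rewrite subr_ge0 ler_pdivrMr.
Qed.

End Minimisation.

(** * Limiting arguments over the reals *)

Section RealAux.
Variable R : realType.
Implicit Types e c M : R.

Lemma inv_small e : 0 < e -> exists N, forall n, (N <= n)%N -> n.+1%:R^-1 < e.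
Proof.
move=> e0; exists (Num.truncn e^-1) => n Nn.
rewrite -ltf_pV2 ?(posrE, invr_gt0)// invrK (lt_le_trans (truncnS_gt _))//.
by rewrite ler_nat ltnS.
Qed.

Lemma le_eps c c' M : (forall e, 0 < e -> c <= c' + e * M) -> c <= c'.
Proof.
move=> h; rewrite leNgt; apply/negP => cc.
have M1 : 0 < `|M| + 1 by rewrite ltr_wpDl.
have d0 : 0 < (c - c') / 2 / (`|M| + 1) by rewrite divr_gt0// divr_gt0//; lra.
have /h := d0; set d := _ / (_ + 1) in d0 *.
have : d * M <= d * (`|M| + 1) by rewrite ler_pM2l// (le_trans (ler_norm _))// lerDl.
rewrite {2}/d divfK ?gt_eqF//; lra.
Qed.

Lemma eq0_eps c M : (forall e, 0 < e -> `|c| <= e * M) -> c = 0.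
Proof.
move=> h; apply/eqP; rewrite -normr_eq0; apply/eqP/le_anti; rewrite normr_ge0 andbT.
by apply: (@le_eps _ _ M) => e /h; rewrite add0r.
Qed.

Lemma lt_of_sqr c e : 0 < e -> c ^+ 2 < e ^+ 2 -> c < e.
Proof. by move=> e0 h; rewrite ltNge; apply/negP => ec; nra. Qed.

Lemma le_of_sqr c e : 0 <= e -> c ^+ 2 <= e ^+ 2 -> c <= e.
Proof. by move=> e0 h; rewrite leNgt; apply/negP => ec; nra. Qed.

End RealAux.

(** * Closed linear operators *)

Section ClosedOperators.
Variables (R : realType) (X : completeNormedModType R[i]).
Implicit Types (A B : operator X).

Definition seq_closed A := forall (u : nat -> X) l m, (forall n, op_dom A (u n)) ->
  cvs u l -> cvs (fun n => A (u n)) m -> op_dom A l /\ A l = m.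

Lemma closed_op_seq A : closed_op A -> seq_closed A.
Proof.
move=> cA u l m Du /cvsP ul /cvsP um.
have : [set p : X * X | op_dom A p.1 /\ p.2 = A p.1] (l, m).
  apply: (@closed_cvg _ _ \oo _ (fun n => (u n, A (u n)))) => //.
  by near=> n => /=; split.
  exact: cvg_pair.
by move=> [/= ? ->].
Unshelve. all: by end_near. Qed.

Section Linear.
Variables (A : operator X) (lA : linear_op A).

Lemma linop0 : op_dom A 0 /\ A 0 = 0.
Proof.
have [D0 h] := lA; split=> //.
by have [_] := h (-1) 0 0 D0 D0; rewrite !scaleN1r addNr => ->; rewrite addNr.
Qed.

Lemma linopZ a x : op_dom A x -> op_dom A (a *: x) /\ A (a *: x) = a *: A x.
Proof.
move=> Dx; have [D0 A0] := linop0.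
by have [_ /(_ a x 0 Dx D0)] := lA; rewrite A0 !addr0.
Qed.

Lemma linopD x y : op_dom A x -> op_dom A y ->
  op_dom A (x + y) /\ A (x + y) = A x + A y.
Proof. by move=> Dx Dy; have [_ /(_ 1 x y Dx Dy)] := lA; rewrite !scale1r. Qed.

Lemma linopB x y : op_dom A x -> op_dom A y ->
  op_dom A (x - y) /\ A (x - y) = A x - A y.
Proof.
move=> Dx Dy; have [Dy' Ay] := linopZ (-1) Dy.
by have [] := linopD Dx Dy'; rewrite Ay !scaleN1r.
Qed.

End Linear.

Definition shift_op (l : R[i]) A := Operator (op_dom A) (fun x => l *: x - A x).

Lemma linop_shift l A : linear_op A -> linear_op (shift_op l A).
Proof.
move=> lA; have [D0 h] := lA; split=> //= a x y Dx Dy.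
have [Dxy ->] := h a x y Dx Dy; split=> //.
by rewrite scalerBr scalerDr opprD !scalerA mulrC addrACA.
Qed.

Lemma cvsD (u v : nat -> X) l m : cvs u l -> cvs v m -> cvs (fun n => u n + v n) (l + m).
Proof. by move=> /cvsP ul /cvsP vm; apply/cvsP; exact: cvgD. Qed.

Lemma cvsZ (u : nat -> X) l (a : R[i]) : cvs u l -> cvs (fun n => a *: u n) (a *: l).
Proof. by move=> /cvsP ul; apply/cvsP; exact: cvgZl_tmp. Qed.

Lemma cvsB (u v : nat -> X) l m : cvs u l -> cvs v m -> cvs (fun n => u n - v n) (l - m).
Proof. by move=> /cvsP ul /cvsP vm; apply/cvsP; exact: cvgB. Qed.

Lemma cvs_nr (u v : nat -> X) l m : cvs u l -> cvs v m ->
  (forall n, nr (u n) = nr (v n)) -> nr l = nr m.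
Proof.
move=> ul vm uv; apply/eqP; rewrite -subr_eq0; apply/eqP; apply: (@eq0_eps _ _ 2) => e e0.
have [N1 H1] := ul e e0; have [N2 H2] := vm e e0; pose n := maxn N1 N2.
have /H1 h1 : (N1 <= n)%N by rewrite leq_maxl.
have /H2 h2 : (N2 <= n)%N by rewrite leq_maxr.
have := nr_subl (u n) l; have := nr_subl (v n) m.
have := nr_subl l (u n); have := nr_subl m (v n).
rewrite (nrBC l) (nrBC m) uv ler_norml; lra.
Qed.

Lemma cvs_cauchy (u : nat -> X) l : cvs u l -> forall e : R, 0 < e ->
  exists N, forall m n, (N <= m)%N -> (N <= n)%N -> nr (u m - u n) < e.
Proof.
move=> ul e e0; have e2 : 0 < e / 2 by rewrite divr_gt0.
have [N HN] := ul _ e2; exists N => m n /HN hm /HN hn.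
by have := nr_tri l (u m) (u n); rewrite (nrBC l); lra.
Qed.

Lemma seq_closed_shift l A : seq_closed A -> seq_closed (shift_op l A).
Proof.
move=> cA u x m /= Du ux um.
have [|Dx Ax] := cA u x (l *: x - m) Du ux.
  have := cvsB (cvsZ l ux) um.
  by under [X in cvs X]funext do rewrite opprB addrC subrK.
by split=> //; rewrite Ax opprB addrC subrK.
Qed.

End ClosedOperators.

(** * Weak equations and Riesz representation *)

Section WeakSolutions.
Variables (R : realType) (X : completeNormedModType R[i]).
Variables (dot : {dot X for @Num.conj R[i]}) (hdot : induces_norm dot).
Local Notation ip := (ip dot).

(* Used with [B = 0] (Riesz representation), with [B = A] (solvability of
   [(al + A^* A) u = y]) and with [al = 0], [B = l - A] (surjectivity of [l - A]). *)
Lemma weak_solution (B : operator X) (al C0 C : R) (phi : X -> R) :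
  linear_op B -> seq_closed B -> 0 <= al -> 0 <= C0 ->
  (forall x, op_dom B x -> nr x ^+ 2 <= C0 * (al * nr x ^+ 2 + nr (B x) ^+ 2)) ->
  (forall x y, op_dom B x -> op_dom B y -> phi (x + y) = phi x + phi y) ->
  (forall (r : R) x, op_dom B x -> phi (r%:C *: x) = r * phi x) ->
  (forall x, op_dom B x -> phi x ^+ 2 <= C * (al * nr x ^+ 2 + nr (B x) ^+ 2)) ->
  exists u, op_dom B u /\
    forall h, op_dom B h -> phi h = al * ip h u + ip (B h) (B u).
Proof.
move=> lB cB al0 C00 coer phiD phiZ phiC.
pose s x y := al * ip x y + ip (B x) (B y).
have sxx x : s x x = al * nr x ^+ 2 + nr (B x) ^+ 2 by rewrite /s !ipxx.
have s0 x : 0 <= s x x.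
  by rewrite sxx; exact: (addr_ge0 (mulr_ge0 al0 (sqr_ge0 _)) (sqr_ge0 _)).
have sDl x y z : op_dom B x -> op_dom B y -> s (x + y) z = s x z + s y z.
  by move=> Dx Dy; rewrite /s (linopD lB Dx Dy).2 !ipDl; ring.
have sZl r x z : op_dom B x -> s (r%:C *: x) z = r * s x z.
  by move=> Dx; rewrite /s (linopZ lB _ Dx).2 !ipZl; ring.
have sC x y : s x y = s y x by rewrite /s ipC [ip (B x) _]ipC.
have ar e : 0 < e -> exists u, op_dom B u /\
    forall h, op_dom B h -> (phi h - s h u) ^+ 2 <= e * s h h.
  move=> e0; apply: (@almost_riesz _ _ _ _ _ C) => //.
  - exact: (linop0 lB).1.
  - by move=> x y Dx Dy; exact: (linopD lB Dx Dy).1.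
  - by move=> r x Dx; exact: (linopZ lB _ Dx).1.
  - by move=> x y z Dx Dy _; exact: sDl.
  - by move=> r x y Dx _; exact: sZl.
  - by move=> x Dx; rewrite sxx phiC.
have /choice[u hu] (n : nat) := ar n.+1%:R^-1 (ltac:(by rewrite invr_gt0)).
have Du n : op_dom B (u n) by have [] := hu n.
have phiu n h : op_dom B h -> (phi h - s h (u n)) ^+ 2 <= n.+1%:R^-1 * s h h.
  by move=> Dh; have [_] := hu n; exact.
have sBr x y z : op_dom B x -> op_dom B y -> op_dom B z ->
    s z (x - y) = s z x - s z y.
  move=> Dx Dy Dz; rewrite /s (linopB lB Dx Dy).2 !ipBr; ring.
(* Both almost representations are tested on [d = u m - u n]; since [s d d] is the difference of the
   two defects, its square is at most [2 (em + en)] times itself. *)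
have cau e : 0 < e -> exists N, forall m n, (N <= m)%N -> (N <= n)%N ->
    s (u m - u n) (u m - u n) < e.
  move=> e0; have e4 : 0 < e / 4 by rewrite divr_gt0.
  have [N HN] := inv_small e4; exists N => m n Nm Nn.
  have Dd := (linopB lB (Du m) (Du n)).1.
  have := phiu m _ Dd; have := phiu n _ Dd; have := s0 (u m - u n).
  have := sBr _ _ _ (Du m) (Du n) Dd.
  set d := u m - u n; have := HN _ Nm; have := HN _ Nn.
  move: (s d d) (s d (u m)) (s d (u n)) (phi d) m.+1%:R^-1 n.+1%:R^-1.
  move=> q sm sn p em en emn enn qE q0 hn hm.
  have [q00|q0'] := eqVneq q 0; first by rewrite q00.
  have {q0'} qp : 0 < q by rewrite lt_def q0' q0.
  have : q ^+ 2 <= 2 * (em + en) * q.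
    have -> : q = (p - sn) - (p - sm) by rewrite qE; ring.
    have := sqr_ge0 ((p - sn) + (p - sm)); rewrite qE in hn hm.
    nra.
  rewrite expr2 ler_pM2r//; lra.
have snr e : 0 < e -> exists N, forall m n, (N <= m)%N -> (N <= n)%N ->
    nr (u m - u n) < e /\ nr (B (u m) - B (u n)) < e.
  (* For a difference [d], coercivity gives [|d|^2 <= C0 s d d], and [|B d|^2 <= s d d]; the
     denominator [C0 + 1] serves both. *)
  move=> e0; have d0 : 0 < e ^+ 2 / (C0 + 1).
    by rewrite divr_gt0 ?exprn_gt0//; lra.
  have [N HN] := cau _ d0; exists N => m n Nm Nn.
  have Dd := (linopB lB (Du m) (Du n)).1.
  have := HN m n Nm Nn; rewrite sxx -(linopB lB (Du m) (Du n)).2.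
  have := coer _ Dd; move: (nr (u m - _)) (nr (B (u m - _))) => a b.
  rewrite ltr_pdivlMr; last lra.
  move=> h1 h2; have := mulr_ge0 al0 (sqr_ge0 a) => h3.
  have := sqr_ge0 b => h4.
  by split; apply: lt_of_sqr => //; nra.
have [|l ul] := @cvs_complete _ _ u.
  by move=> e /snr[N HN]; exists N => m n Nm Nn; have [] := HN m n Nm Nn.
have [|m Bm] := @cvs_complete _ _ (fun n => B (u n)).
  by move=> e /snr[N HN]; exists N => m n Nm Nn; have [] := HN m n Nm Nn.
have [Dl Bl] := cB u l m Du ul Bm.
exists l; split=> // h Dh; apply/eqP; rewrite -subr_eq0; apply/eqP.
apply: (@eq0_eps _ _ (1 + al * nr h + nr (B h))) => e e0.
have [N1 H1] := ul e e0; have [N2 H2] := Bm e e0.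
have q1 : 0 < s h h + 1 by rewrite ltr_wpDl.
have [N3 H3] := @inv_small _ (e ^+ 2 / (s h h + 1)) (ltac:(by rewrite divr_gt0// exprn_gt0)).
pose n := maxn N1 (maxn N2 N3).
have /H1 h1 : (N1 <= n)%N by rewrite leq_maxl.
have /H2 h2 : (N2 <= n)%N by rewrite /n (leq_trans (leq_maxl N2 N3))// leq_maxr.
have /H3 : (N3 <= n)%N by rewrite /n (leq_trans (leq_maxr N2 N3))// leq_maxr.
rewrite ltr_pdivlMr// => h3.
have h4 : `|phi h - s h (u n)| <= e.
  apply: le_of_sqr; first exact: ltW.
  rewrite real_normK ?num_real// (le_trans (phiu n h Dh))// (le_trans _ (ltW h3))//.
  by rewrite ler_pM2l ?invr_gt0// lerDl.
rewrite Bl; have -> : phi h - (al * ip h l + ip (B h) m) =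
  (phi h - s h (u n)) + (al * ip h (u n - l) + ip (B h) (B (u n) - m)).
  by rewrite /s !ipBr; ring.
apply: (le_trans (ler_normD _ _)); rewrite -addrA mulrDr mulr1 lerD//.
apply: (le_trans (ler_normD _ _)); rewrite mulrDr lerD//.
  rewrite normrM (ger0_norm al0) mulrCA ler_wpM2l// (le_trans (ip_CSN hdot _ _))//.
  by rewrite mulrC ler_wpM2r ?nr_ge0// ltW.
by rewrite (le_trans (ip_CSN hdot _ _))// mulrC ler_wpM2r ?nr_ge0// ltW.
Qed.

Lemma riesz (phi : X -> R) (C : R) :
  (forall x y, phi (x + y) = phi x + phi y) ->
  (forall (r : R) x, phi (r%:C *: x) = r * phi x) ->
  (forall x, phi x ^+ 2 <= C * nr x ^+ 2) ->
  exists z, forall x, phi x = ip x z.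
Proof.
move=> phiD phiZ phiC.
have [||||||||u [_ hu]] := @weak_solution (Operator setT (fun=> 0)) 1 1 C phi => //=.
- by split=> //= a x y _ _; split; rewrite // scaler0 addr0.
- move=> u l m _ _ um; split=> //; apply: (cvs_uniq _ um) => e e0.
  by exists 0%N => n _ /=; rewrite subrr nr0.
- by move=> x _; rewrite nr0 !mul1r expr0n addr0.
- by move=> x _; rewrite nr0 !mul1r expr0n addr0.
by exists u => x; rewrite hu//= ip0l addr0 mul1r.
Qed.

End WeakSolutions.

(** * Normal operators *)

Lemma dense_nr (R : realType) (X : normedModType R[i]) (D : set X) : dense D ->
  forall (x : X) (e : R), 0 < e -> exists y, D y /\ nr (y - x) < e.
Proof.
move=> dD x e e0; have e0' : 0 < e%:C :> R[i] by rewrite ltcR.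
have [||y [xy Dy]] := dD (ball x e%:C).
- by exists x; exact: ballxx.
- exact: ball_open.
exists y; split=> //; move: xy.
by rewrite -ball_normE /ball_ /= nrE nrBC ltcR.
Qed.

(** * Bounded operators and their adjoints *)

Section BoundedOperators.
Variables (R : realType) (X : completeNormedModType R[i]).
Variables (dot : {dot X for @Num.conj R[i]}) (hdot : induces_norm dot).
Local Notation ip := (ip dot).

Definition bop (N : X -> X) := linear N /\ exists M : R, forall x, nr (N x) <= M * nr x.

Definition mklin (N : X -> X) (hN : linear N) : {linear X -> X} :=
  HB.pack N (GRing.isLinear.Build _ _ _ _ _ hN).

Section Linearity.
Variables (N : X -> X) (lN : linear N).

Lemma lin0 : N 0 = 0. Proof. exact: (linear0 (mklin lN)). Qed.
Lemma linD x y : N (x + y) = N x + N y. Proof. exact: (linearD (mklin lN)). Qed.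
Lemma linB x y : N (x - y) = N x - N y. Proof. exact: (linearB (mklin lN)). Qed.
Lemma linN x : N (- x) = - N x. Proof. exact: (linearN (mklin lN)). Qed.
Lemma linZ a x : N (a *: x) = a *: N x. Proof. exact: (linearZ_LR (mklin lN)). Qed.

End Linearity.

Lemma bop_pos N : bop N -> exists M : R, 0 < M /\ forall x, nr (N x) <= M * nr x.
Proof.
move=> [_ [M hM]]; exists (`|M| + 1); split=> [|x].
  by rewrite ltr_wpDl.
rewrite (le_trans (hM x))// ler_wpM2r ?nr_ge0// (le_trans (ler_norm M))//; lra.
Qed.

Lemma bop_cont (S : {linear X -> X}) : continuous S <-> bop S.
Proof.
split=> [cS|[_ [M hM]]].
  split; first by move=> a x y; rewrite linearP.
  have /linear_boundedP/pinfty_ex_gt0[r r0 hr] : bounded_near S (nbhs (0 : X)).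
    by apply: continuous_linear_bounded; exact: cS.
  exists (complex.Re r) => x; rewrite -lecR rmorphM /= -!nrE RRe_real ?gtr0_real//.
apply: bounded_linear_continuous; apply/linear_boundedP.
exists M%:C; split; first by rewrite complex_real.
move=> r Mr x; rewrite !nrE; apply: (@le_trans _ _ (M%:C * (nr x)%:C)).
  by rewrite -rmorphM lecR.
by rewrite ler_wpM2r ?ler0c ?nr_ge0// ltW.
Qed.

Lemma bop_cvs N u l : bop N -> cvs u l -> cvs (fun n => N (u n)) (N l).
Proof.
move=> bN ul e e0; have [M [M0 hM]] := bop_pos bN.
have [K HK] := ul (e / M) (ltac:(by rewrite divr_gt0)).
exists K => n /HK; rewrite ltr_pdivlMr// mulrC; apply: le_lt_trans.
by rewrite -(linB bN.1).
Qed.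

Lemma bop_id : bop id.
Proof. by split=> //; exists 1 => x; rewrite mul1r. Qed.

Lemma bop_comp N L : bop N -> bop L -> bop (N \o L).
Proof.
move=> bN bL; split=> [a x y /=|]; first by rewrite bL.1 bN.1.
have [M [M0 hM]] := bop_pos bN; have [K [K0 hK]] := bop_pos bL.
by exists (M * K) => x /=; rewrite (le_trans (hM _))// -mulrA ler_wpM2l// ltW.
Qed.

Lemma bop_add N L : bop N -> bop L -> bop (fun x => N x + L x).
Proof.
move=> bN bL; split=> [a x y /=|].
  by rewrite bL.1 bN.1 scalerDr addrACA.
have [M [M0 hM]] := bop_pos bN; have [K [K0 hK]] := bop_pos bL.
by exists (M + K) => x; rewrite (le_trans (nrD _ _))// mulrDl lerD.
Qed.

Lemma bop_scale a N : bop N -> bop (fun x => a *: N x).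
Proof.
move=> bN; split=> [c x y /=|].
  by rewrite bN.1 scalerDr !scalerA mulrC.
have [M [M0 hM]] := bop_pos bN.
by exists (normc a * M) => x; rewrite nrZ -mulrA ler_wpM2l ?normc_ge0.
Qed.

(** Real parts suffice for a linear [N]: replacing [x] by ['i *: x] recovers the imaginary part. *)
Definition is_adj (N N' : X -> X) := forall x y, ip (N x) y = ip x (N' y).

Lemma is_adj_sym N N' : is_adj N N' -> is_adj N' N.
Proof. by move=> h x y; rewrite ipC -h ipC. Qed.

Lemma adj_exists N : bop N -> exists N', bop N' /\ is_adj N N'.
Proof.
move=> bN; have [M [M0 hM]] := bop_pos bN.
have /choice[N' hN'] y : exists z, forall x, ip (N x) y = ip x z.
  apply: (@riesz _ _ _ hdot _ ((M * nr y) ^+ 2)).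
  - by move=> x x'; rewrite (linD bN.1) ipDl.
  - by move=> r x; rewrite (linZ bN.1) ipZl.
  - move=> x; have := ip_CSN hdot (N x) y; have := hM x.
    have := nr_ge0 x; have := nr_ge0 y; have := nr_ge0 (N x).
    rewrite -[ip _ _ ^+ 2]real_normK ?num_real// -exprMn => n1 n2 n3 n4 n5.
    have M0' := ltW M0; rewrite ler_pXn2r ?nnegrE ?mulr_ge0//.
    by rewrite (le_trans n5)// mulrAC ler_wpM2r.
have aN : is_adj N N' by move=> x y; exact: hN'.
exists N'; split=> //; split=> [a x y|].
  apply: (ip_inj hdot) => h; rewrite ipDr -!aN ipDr.
  by congr (_ + _); rewrite -[a]conjcK -!ipJ -(linZ bN.1) aN.
exists M => y; have [->|y0] := eqVneq (nr (N' y)) 0.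
  by rewrite mulr_ge0 ?nr_ge0// ltW.
have {}y0 : 0 < nr (N' y) by rewrite lt_def y0 nr_ge0.
(* [|N' y|^2 = ip (N (N' y)) y <= M |N' y| |y|]. *)
rewrite -(ler_pM2l y0) -expr2 -(ipxx hdot) -aN (le_trans (ip_CS hdot _ _))//.
by rewrite mulrCA mulrA ler_wpM2r ?nr_ge0.
Qed.

End BoundedOperators.

(** * Unbounded normal operators and their resolvents *)

Section NormalOperators.
Variables (R : realType) (X : completeNormedModType R[i]).
Variables (dot : {dot X for @Num.conj R[i]}) (hdot : induces_norm dot).
Local Notation ip := (ip dot).
Variable A : operator X.
Local Notation D := (op_dom A).
Local Notation A' := (adjoint dot A).
Local Notation D' := (op_dom A').

Section Adjoint.
Hypotheses (lA : linear_op A) (dA : dense D).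

(** Testing real parts is enough because [D] is stable under complex multiples. The value is forced:
    two candidates agree against the dense set [D]. *)
Lemma adjoint_in y z : (forall x, D x -> ip (A x) y = ip x z) -> D' y /\ A' y = z.
Proof.
move=> h.
have hd x : D x -> dot (A x) y = dot x z.
  move=> Dx; rewrite !dotE h//; congr (_ +i* _).
  rewrite -[X in X *: y]conjcK -[X in X *: z]conjcK -!ipJ -(linopZ lA _ Dx).2 h//.
  exact: (linopZ lA _ Dx).1.
split; first by exists z.
apply: xget_unique => // z' hz'.
apply: (ip_inj hdot) => x; apply/eqP; rewrite -subr_eq0 -ipBr; apply/eqP.
have hD v : D v -> ip v (z' - z) = 0.
  by move=> Dv; rewrite ipBr /ip -hz'// -hd// subrr.
apply: (@eq0_eps _ _ (nr (z' - z))) => e e0.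
have [v [Dv vx]] := dense_nr dA x e0.
have -> : ip x (z' - z) = ip (x - v) (z' - z) by rewrite ipBl (hD v)// subr0.
by rewrite (le_trans (ip_CSN hdot _ _))// ler_wpM2r ?nr_ge0// nrBC ltW.
Qed.

Lemma adjoint_out x y : D x -> D' y -> ip (A x) y = ip x (A' y).
Proof.
move=> Dx [z hz]; rewrite /= /ip.
have := @xgetI _ 0 [set z : X | forall x, D x -> dot (A x) y = dot x z] z hz.
by move=> /= ->.
Qed.

Lemma adjoint_linear : linear_op A'.
Proof.
split.
  by have [] // := @adjoint_in 0 0; move=> x _; rewrite !ip0r.
move=> a x y Dx Dy; apply: adjoint_in => h Dh.
rewrite !ipDr -(adjoint_out Dh Dy); congr (_ + _).
rewrite -[a]conjcK -!ipJ -(linopZ lA _ Dh).2 (adjoint_out _ Dx)//.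
exact: (linopZ lA _ Dh).1.
Qed.

Lemma adjoint_closed : seq_closed A'.
Proof.
move=> u l m Du ul um; apply: adjoint_in => h Dh; apply/eqP; rewrite -subr_eq0; apply/eqP.
apply: (@eq0_eps _ _ (nr (A h) + nr h)) => e e0.
have [N1 H1] := ul e e0; have [N2 H2] := um e e0; pose n := maxn N1 N2.
have /H1/ltW h1 : (N1 <= n)%N by rewrite leq_maxl.
have /H2/ltW h2 : (N2 <= n)%N by rewrite leq_maxr.
have -> : ip (A h) l - ip h m = - ip (A h) (u n - l) + ip h (A' (u n) - m).
  by rewrite !ipBr (adjoint_out Dh (Du n)); ring.
rewrite (le_trans (ler_normD _ _))// normrN mulrDr lerD//.
  by rewrite (le_trans (ip_CSN hdot _ _))// mulrC ler_wpM2r ?nr_ge0.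
by rewrite (le_trans (ip_CSN hdot _ _))// mulrC ler_wpM2r ?nr_ge0.
Qed.

End Adjoint.

Hypothesis nA : normal_op dot A.
Let lA : linear_op A. Proof. by case: nA. Qed.
Let dA : dense D. Proof. by case: nA. Qed.
Let cA : seq_closed A. Proof. by case: nA => _ _ /closed_op_seq. Qed.
Let lA' := adjoint_linear lA dA.
Let cA' := adjoint_closed lA dA.

(** The domain of [A^* A], which by normality is also that of [A A^*] (see [D2P]); only there does
    the hypothesis speak directly. *)
Definition D2 x := D x /\ D' (A x).

Lemma D2P x : D2 x <-> D' x /\ D (A' x).
Proof.
have [_ _ _ [/= /(congr1 (fun S : set X => S x)) /= + _]] := nA.
by rewrite /D2 => ->.
Qed.

Lemma D2_comm x : D2 x -> A' (A x) = A (A' x).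
Proof. by have [_ _ _ [_ +]] := nA; exact. Qed.

Lemma normal_eqD2 x : D2 x -> nr (A x) = nr (A' x).
Proof.
move=> h; have [Dx DAx] := h; have [D'x DA'x] := (D2P x).1 h.
apply/eqP; rewrite -(@eqrXn2 _ 2) ?nr_ge0// -!(ipxx hdot).
by rewrite (adjoint_out Dx DAx) (D2_comm h) ipC (adjoint_out DA'x D'x).
Qed.

Lemma D2B x y : D2 x -> D2 y -> D2 (x - y).
Proof.
move=> [Dx DAx] [Dy DAy]; have [Dxy Axy] := linopB lA Dx Dy.
by split; rewrite // Axy; exact: (linopB lA' DAx DAy).1.
Qed.

(* Von Neumann: [al + A^* A] is onto. *)
Lemma core_solve (al : R) x : 0 < al ->
  exists u, D2 u /\ al%:C *: (x - u) = A' (A u).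
Proof.
move=> al0.
have [||||||u [Du hu]] := @weak_solution _ _ _ hdot A al al^-1 (al * nr x ^+ 2)
   (fun h => al * ip h x) lA cA => //.
- exact: ltW.
- by rewrite invr_ge0 ltW.
- move=> h Dh; rewrite mulrDr mulKf ?gt_eqF// lerDl.
  by rewrite mulr_ge0 ?sqr_ge0// invr_ge0 ltW.
- by move=> y z _ _; rewrite ipDl mulrDr.
- by move=> r y _; rewrite ipZl mulrCA.
- move=> h Dh; rewrite mulrDr; apply: ler_wpDr.
    by rewrite mulr_ge0 ?sqr_ge0// mulr_ge0 ?sqr_ge0// ltW.
  have := ip_CSN hdot h x; rewrite exprMn -[ip h x ^+ 2]real_normK ?num_real// => hCS.
  have : `|ip h x| ^+ 2 <= (nr h * nr x) ^+ 2.
    by rewrite ler_pXn2r// nnegrE mulr_ge0 ?nr_ge0.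
  have := sqr_ge0 al; nra.
(* The weak equation reads [ip (A h) (A u) = al * ip h (x - u)] for all [h] in [D], which is
   membership of [A u] in the domain of the adjoint. *)
have [|D'A A'A] := adjoint_in lA dA (y := A u) (z := al%:C *: (x - u)).
  by move=> h Dh; rewrite ipZr ipBr mulrBr hu// addrC addKr.
by exists u.
Qed.

(** Pairing the equation with [u] gives [ip u (x - u) >= 0], hence [|u|^2 <= ip u x]. *)
Lemma core_contr (al : R) x u : 0 < al -> D2 u -> al%:C *: (x - u) = A' (A u) ->
  nr u <= nr x.
Proof.
move=> al0 [Du DAu] E; have : 0 <= ip u (A' (A u)).
  by rewrite -(adjoint_out Du DAu) (ipxx hdot) sqr_ge0.
rewrite -E ipZr ipBr (ipxx hdot) pmulr_rge0// subr_ge0 => h.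
have := ip_CS hdot u x; have := nr_ge0 u; have := nr_ge0 x => a b c.
by rewrite leNgt; apply/negP => d; nra.
Qed.

Lemma core_uniq (al : R) x u u' : 0 < al -> D2 u -> D2 u' ->
  al%:C *: (x - u) = A' (A u) -> al%:C *: (x - u') = A' (A u') -> u = u'.
Proof.
move=> al0 h h' E E'; have [Du DAu] := h; have [Du' DAu'] := h'.
apply/eqP; rewrite -subr_eq0; apply/eqP/nr_eq0/le_anti; rewrite nr_ge0 andbT.
rewrite -[leRHS](nr0 X); apply: (core_contr al0); first exact: D2B.
rewrite (linopB lA Du Du').2 (linopB lA' DAu DAu').2 -E -E' -scalerBr.
by congr (_ *: _); rewrite sub0r !opprB [RHS]addrC addrA subrK.
Qed.

Let solE (p : nat * X) : exists u, D2 u /\ (p.1.+1%:R)%:C *: (p.2 - u) = A' (A u).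
Proof. by apply: core_solve; rewrite ltr0n. Qed.

(** [U n] is [(1 + A^* A / (n + 1))^-1], a contraction with values in [D2] that approximates the
    identity. *)
Let U n x := projT1 (cid (solE (n, x))).
Let UD n x : D2 (U n x). Proof. by rewrite /U; case: cid => u []. Qed.
Let UE n x : (n.+1%:R)%:C *: (x - U n x) = A' (A (U n x)).
Proof. by rewrite /U; case: cid => u []. Qed.
Let Uuniq n x u : D2 u -> (n.+1%:R)%:C *: (x - u) = A' (A u) -> u = U n x.
Proof.
by move=> Du E; exact: (@core_uniq n.+1%:R x).
Qed.

Let UB n x y : nr (U n x - U n y) <= nr (x - y).
Proof.
have [Du DAu] := UD n x; have [Dv DAv] := UD n y.
apply: (@core_contr n.+1%:R); rewrite ?ltr0n//; first exact: D2B.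
rewrite (linopB lA Du Dv).2 (linopB lA' DAu DAv).2 -!UE -scalerBr.
by congr (_ *: _); rewrite !opprD !opprK addrACA.
Qed.

Let U_cvsD x : D x -> cvs (U^~ x) x.
Proof.
move=> Dx e e0.
have d0 : 0 < e ^+ 2 / (nr (A x) ^+ 2 + 1).
  by rewrite divr_gt0 ?exprn_gt0// ltr_wpDl// sqr_ge0.
have [N HN] := inv_small d0; exists N => n Nn.
have [Du DAu] := UD n x; apply: lt_of_sqr => //.
have [Dxu Axu] := linopB lA Dx Du.
(* With [u = U n x], the left side is [ip (x - u) (A' (A u)) = ip (A x) (A u) - |A u|^2]. *)
have E : n.+1%:R * nr (x - U n x) ^+ 2 <= nr (A x) ^+ 2.
  rewrite -(ipxx hdot) -ipZr UE -(adjoint_out Dxu DAu) Axu ipBl (ipxx hdot).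
  have := ip_CS hdot (A x) (A (U n x)).
  by have := sqr_ge0 (nr (A x) - nr (A (U n x))); have := sqr_ge0 (nr (A x)); nra.
have n0 : 0 < n.+1%:R :> R by rewrite ltr0n.
rewrite nrBC -(ltr_pM2l n0) (le_lt_trans E)//.
have := HN n Nn; rewrite ltr_pdivlMr; last by rewrite ltr_wpDl// sqr_ge0.
rewrite mulrC ltr_pdivrMr// mulrC => h; lra.
Qed.

Let U_cvs x : cvs (U^~ x) x.
Proof.
move=> e e0; have e3 : 0 < e / 3 by rewrite divr_gt0.
have [y [Dy yx]] := dense_nr dA x e3.
have [N HN] := U_cvsD Dy e3; exists N => n /HN h.
have := nr_tri (U n y) (U n x) x; have := nr_tri y (U n y) x; have := UB n x y.
rewrite (nrBC x y); lra.
Qed.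

(** With [u = U n x], apply [A] to [(n + 1) (x - u) = A' (A u)] and exchange the outer [A] with
    [A']: then [A u] solves the equation that defines [U n (A x)], and the solution is unique. *)
Let U_A n x : D x -> A (U n x) = U n (A x).
Proof.
move=> Dx; have h := UD n x; have [Du DAu] := h; have [D'u DA'u] := (D2P _).1 h.
have [Dxu Axu] := linopB lA Dx Du.
have [DE AE] := linopZ lA (n.+1%:R)%:C Dxu; rewrite UE in DE AE.
have hw : D2 (A (U n x)) by apply/D2P.
by apply: Uuniq => //; rewrite (D2_comm hw) AE Axu.
Qed.

Let U_A' n x : D' x -> A' (U n x) = U n (A' x).
Proof.
move=> Dx; have h := UD n x; have [Du DAu] := h; have [D'u DA'u] := (D2P _).1 h.
have [Dxu Axu] := linopB lA' Dx D'u.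
have [DE AE] := linopZ lA' (n.+1%:R)%:C Dxu; rewrite UE (D2_comm h) in DE AE.
by apply: Uuniq => //; rewrite AE Axu.
Qed.

Let U_nr n m x : nr (A' (U n x) - A' (U m x)) = nr (A (U n x) - A (U m x)).
Proof.
have h := UD n x; have [Du DAu] := h; have [D'u _] := (D2P _).1 h.
have g := UD m x; have [Dv DAv] := g; have [D'v _] := (D2P _).1 g.
by rewrite -(linopB lA Du Dv).2 -(linopB lA' D'u D'v).2 (normal_eqD2 (D2B h g)).
Qed.

(* On [D2] the norms of [A x] and [A^* x] agree, and the approximations [U n x] in
   [D2] converge to [x] in both graph norms since [A U_n = U_n A]. *)
Lemma normal_dom x : (D x <-> D' x) /\ (D x -> nr (A x) = nr (A' x)).
Proof.
have uA : D x -> cvs (fun n => A (U n x)) (A x).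
  by move=> Dx; have := U_cvs (A x); under [X in cvs X _]funext do rewrite -(U_A _ Dx).
have uA' : D' x -> cvs (fun n => A' (U n x)) (A' x).
  by move=> Dx; have := U_cvs (A' x); under [X in cvs X _]funext do rewrite -(U_A' _ Dx).
have DD' : D x -> D' x.
  move=> Dx; have [|l hl] := @cvs_complete _ _ (fun n => A' (U n x)).
    move=> e /(cvs_cauchy (uA Dx))[N HN]; exists N => m n Nm Nn.
    by rewrite U_nr HN.
  by have [] := cA' (fun n => ((D2P _).1 (UD n x)).1) (U_cvs x) hl.
split.
  split=> // Dx; have [|l hl] := @cvs_complete _ _ (fun n => A (U n x)).
    move=> e /(cvs_cauchy (uA' Dx))[N HN]; exists N => m n Nm Nn.
    by rewrite -U_nr HN.
  by have [] := cA (fun n => (UD n x).1) (U_cvs x) hl.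
move=> Dx; apply: (cvs_nr (uA Dx) (uA' (DD' Dx))) => n.
exact/normal_eqD2/UD.
Qed.

(** The lower bound makes the form [ip ((l - A) h) ((l - A) u)] coercive, so the normal equation for
    [l - A] with right side [y] has a weak solution [u]. Exchanging the two commuting factors, the
    adjoint of [l - A] applied to [u] is a preimage of [y]. *)
Lemma bounded_below_onto (l : R[i]) (d : R) : 0 < d ->
  (forall x, D x -> d * nr x <= nr (l *: x - A x)) ->
  forall y, exists x, D x /\ l *: x - A x = y.
Proof.
move=> d0 hd y; pose B := shift_op l A.
have lB : linear_op B by exact: linop_shift.
have C0 : 0 <= d ^- 2 by rewrite invr_ge0 sqr_ge0.
have coer x : D x -> nr x ^+ 2 <= d ^- 2 * (0 * nr x ^+ 2 + nr (B x) ^+ 2).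
  move=> Dx; rewrite mul0r add0r ler_pdivlMl ?exprn_gt0// -exprMn.
  by rewrite ler_pXn2r ?nnegrE ?mulr_ge0 ?nr_ge0 ?hd// ltW.
have [|||u [Du hu]] := @weak_solution _ _ _ hdot B 0 (d ^- 2) (nr y ^+ 2 * d ^- 2)
   (ip^~ y) lB (seq_closed_shift cA) (lexx _) C0 coer.
- by move=> ? ? _ _; rewrite ipDl.
- by move=> ? ? _; rewrite ipZl.
- move=> x Dx; rewrite -mulrA; apply: (@le_trans _ _ (nr y ^+ 2 * nr x ^+ 2)).
    rewrite -exprMn -[leLHS]real_normK ?num_real// ler_pXn2r ?nnegrE ?mulr_ge0 ?nr_ge0//.
    by rewrite mulrC ip_CSN.
  by rewrite ler_wpM2l ?sqr_ge0 ?coer.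
have [v vE] : exists v, v = l *: u - A u by exists (l *: u - A u).
(* The weak equation puts [v = (l - A) u] in the domain of the adjoint, with
   [conj l *: v - A' v = y]. *)
have [|D'v A'v] := adjoint_in lA dA (y := v) (z := (l^*)%C *: v - y).
  move=> h Dh; rewrite ipBr -ipJ (hu h Dh) mul0r add0r /= -vE ipBl; ring.
have D'u : D' u by apply/(normal_dom u).1.
have Du2 : D2 u.
  split=> //; have -> : A u = l *: u - v by rewrite vE opprB addrC subrK.
  exact: (linopB lA' (linopZ lA' _ D'u).1 D'v).1.
have [_ DA'u] := (D2P u).1 Du2.
have [Dlu Alu] := linopZ lA (l^*)%C Du.
exists ((l^*)%C *: u - A' u); split; first exact: (linopB lA Dlu DA'u).1.
rewrite (linopB lA Dlu DA'u).2 Alu -(D2_comm Du2).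
have E : A' v = l *: A' u - A' (A u).
  have [? <-] := linopZ lA' l D'u.
  by rewrite vE (linopB lA' _ Du2.2).2.
have -> : y = (l^*)%C *: v - A' v by rewrite A'v opprB addrC subrK.
by rewrite E vE !scalerBr !scalerA mulrC !opprB addrACA [RHS]addrACA [- _ - _]addrC.
Qed.

(** Its contrapositive produces the approximate eigenvectors at a spectral point. *)
Lemma bounded_below_resolvent (l : R[i]) (d : R) : 0 < d ->
  (forall x, D x -> d * nr x <= nr (l *: x - A x)) -> resolvent_set A l.
Proof.
move=> d0 hd; have /choice[S hS] := bounded_below_onto d0 hd.
have inj x : D x -> S (l *: x - A x) = x.
  move=> Dx; have [Ds Es] := hS (l *: x - A x).
  have [Dd Ed] := linopB lA Ds Dx.
  apply/eqP; rewrite -subr_eq0; apply/eqP/nr_eq0/le_anti; rewrite nr_ge0 andbT.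
  rewrite -(pmulr_rle0 _ d0) (le_trans (hd _ Dd))//.
  have -> : l *: (S (l *: x - A x) - x) - A (S (l *: x - A x) - x) =
      (l *: S (l *: x - A x) - A (S (l *: x - A x))) - (l *: x - A x).
    by rewrite Ed scalerBr !opprB addrACA [RHS]addrACA [- _ - _]addrC.
  by rewrite Es subrr nr0.
have lS : linear S.
  move=> a x y; have [Dx Ex] := hS x; have [Dy Ey] := hS y.
  have [Dxy Exy] := lA.2 a _ _ Dx Dy.
  rewrite -[RHS]inj// Exy; congr S.
  rewrite -{1}Ex -{1}Ey !scalerBr scalerDr opprD !scalerA mulrC addrACA //.
exists (mklin lS); split=> //; apply/bop_cont; split=> //.
exists d^-1 => y; have [Dy Ey] := hS y.
by rewrite ler_pdivlMl// -{2}Ey hd.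
Qed.

(** [S'] turns out to be the inverse of [conj mu - A']. For [x = S (S' y)] the commuting factors
    [mu - A] and [conj mu - A'] may be undone in either order, and so may their inverses. *)
Lemma resolvent_normal (mu : R[i]) (S S' : X -> X) : linear S ->
  (forall y, D (S y) /\ mu *: S y - A (S y) = y) ->
  (forall x, D x -> S (mu *: x - A x) = x) ->
  is_adj dot S S' -> forall y, S (S' y) = S' (S y).
Proof.
move=> lS S1 S2 aS y.
have S'1 z : D' (S' z) /\ (mu^*)%C *: S' z - A' (S' z) = z.
  have [x Dx|? ->] := adjoint_in lA dA (y := S' z) (z := (mu^*)%C *: S' z - z).
    rewrite ipBr -ipJ -!aS; have /(congr1 (ip^~ z)) := S2 x Dx.
    by rewrite (linB lS) ipBl => <-; ring.
  by split=> //; rewrite opprB addrC subrK.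
have S'2 x : D' x -> S' ((mu^*)%C *: x - A' x) = x.
  move=> Dx; apply: (ip_inj hdot) => h; have [Dh Eh] := S1 h.
  by rewrite -aS ipBr -ipJ -(adjoint_out Dh Dx) -ipBl Eh.
have [x xE] : exists x, x = S (S' y) by exists (S (S' y)).
have [Dx Ex] := S1 (S' y); rewrite -xE in Dx Ex *.
have [D'y E'y] := S'1 y.
have D'x : D' x by apply/(normal_dom x).1.
have Dx2 : D2 x.
  split=> //; have -> : A x = mu *: x - S' y by rewrite -Ex opprB addrC subrK.
  exact: (linopB lA' (linopZ lA' _ D'x).1 D'y).1.
have [_ DA'x] := (D2P x).1 Dx2.
have [Dmx Amx] := linopZ lA (mu^*)%C Dx.
have [Dv Av] := linopB lA Dmx DA'x.
rewrite -(S'2 x D'x); congr S'; rewrite -[LHS]S2//; congr S.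
rewrite Av Amx -(D2_comm Dx2) -[RHS]E'y -Ex.
rewrite (linopB lA' (linopZ lA' _ D'x).1 Dx2.2).2 (linopZ lA' _ D'x).2.
by rewrite !scalerBr !scalerA mulrC !opprB addrACA [RHS]addrACA [- _ - _]addrC.
Qed.

End NormalOperators.

(** * The spectral radius of a bounded normal operator *)

Lemma normc_le_ReIm (R : realType) (z : R[i]) : normc z <= `|complex.Re z| + `|complex.Im z|.
Proof.
case: z => a b /=; apply: le_of_sqr; first by rewrite addr_ge0.
rewrite sqr_sqrtr ?addr_ge0 ?sqr_ge0// sqrrD !real_normK ?num_real//.
by rewrite -addrA lerD2l lerDr mulrn_wge0// mulr_ge0.
Qed.

Lemma ReIm_le_normc (R : realType) (z : R[i]) :
  `|complex.Re z| <= normc z /\ `|complex.Im z| <= normc z.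
Proof.
case: z => a b /=; split; (apply: le_of_sqr; first exact: sqrtr_ge0);
  by rewrite sqr_sqrtr ?addr_ge0 ?sqr_ge0// real_normK ?num_real// ?lerDl ?lerDr sqr_ge0.
Qed.

(** Compactness of the disc: locally valid constants can be replaced by a common one, because
    enlarging a constant is harmless. The covering argument runs on the square around the disc. *)
Lemma disc_uniform (R : realType) (c : R) (P : R -> R[i] -> Prop) :
  (forall b b' u, b <= b' -> P b u -> P b' u) ->
  (forall u, normc u <= c -> exists b d : R, 0 < d /\
     forall u', normc (u' - u) < d -> normc u' <= c -> P b u') ->
  exists b, forall u, normc u <= c -> P b u.
Proof.
move=> mono loc.
pose A := `[- c, c]%classic `*` `[- c, c]%classic : set (R * R).
have cA : compact A by apply: compact_setX; exact: segment_compact.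
have /compact_near_coveringP/(_ R (pinfty_nbhs R)
  (fun b p => normc (p.1 +i* p.2) <= c -> P b (p.1 +i* p.2)) _) := cA.
case=> [[x y] _|M [_ hM]].
  have [b [d [d0 hd]]] : exists b d : R, 0 < d /\ forall u',
      normc (u' - (x +i* y)) < d -> normc u' <= c -> P b u'.
    (* A point of the square outside the disc has a neighbourhood missing the disc, so any constant
       will do there. *)
    have [xc|cx] := leP (normc (x +i* y)) c; first exact: loc.
    exists 0, (normc (x +i* y) - c); split=> [|u' hu uc]; first by rewrite subr_gt0.
    have := le_normcD (x +i* y - u' : R[i]) u'; rewrite subrK -opprB normcN; lra.
  exists (ball (x, y) (d / 2), [set b' | b <= b']) => /=.
    split; first by apply: nbhsx_ballx; rewrite divr_gt0.
    by exists b; split; [exact: num_real | move=> ? /ltW].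
  move=> [[x' y'] b'] /= [[bx by'] bb'] uc; apply: mono bb' _; apply: hd => //.
  apply: (le_lt_trans (normc_le_ReIm _)) => /=.
  move: bx by'; rewrite /= /ball /= => bx by'.
  by rewrite (distrC x' x) (distrC y' y); lra.
exists (M + 1) => u uc; case: u uc => x y uc.
have /= [hx hy] := ReIm_le_normc (x +i* y).
apply: (hM (M + 1) (ltac:(by rewrite ltrDl)) (x, y)) => //.
split; rewrite /= in_itv /= -ler_norml.
  exact: le_trans hx uc.
exact: le_trans hy uc.
Qed.

Section SpectralRadius.
Variables (R : realType) (X : completeNormedModType R[i]).
Variables (N : X -> X) (lN : linear N).

Lemma iter_linear m : linear (iter m N).
Proof. by elim: m => // m IH a x y; rewrite !iterS IH lN. Qed.

Lemma iter_bound (r : R) m x : 0 <= r -> (forall x, nr (N x) <= r * nr x) ->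
  nr (iter m N x) <= r ^+ m * nr x.
Proof.
move=> r0 hr; elim: m => [|m IH]; first by rewrite expr0 mul1r.
by rewrite iterS (le_trans (hr _))// exprS -mulrA ler_wpM2l.
Qed.

Hypothesis paranormal : forall x, nr (N x) ^+ 2 <= nr (N (N x)) * nr x.

(** By paranormality the ratios [|N^(k+1) x| / |N^k x|] never fall below the first one,
    [|N x| / |x|]. Thus a bound on a single power of [N] bounds [N] itself. *)
Lemma nr_iter_ge m x : nr (N x) ^+ m * nr x <= nr (iter m N x) * nr x ^+ m.
Proof.
have step k : nr (N x) * nr (iter k N x) <= nr (iter k.+1 N x) * nr x.
  elim: k => [|k IH] //.
  have := paranormal (iter k N x); rewrite iterS in IH.
  rewrite !iterS; set y := iter k N x in IH *.
  have := nr_ge0 y; have := nr_ge0 x; have := nr_ge0 (N x); have := nr_ge0 (N y).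
  have := nr_ge0 (N (N y)); move: IH; move: (nr (N x)) (nr (N y)) (nr (N (N y))) (nr x) (nr y) => a c d e b.
  move=> h1 d0 c0 a0 e0 b0 h2.
  have [bE|bn] := eqVneq b 0.
    have -> : c = 0 by apply/eqP; rewrite -sqrf_eq0; apply/eqP/le_anti; rewrite sqr_ge0 andbT; nra.
    by rewrite mulr0 mulr_ge0.
  have {}bn : 0 < b by rewrite lt_def bn.
  rewrite -(ler_pM2l bn); nra.
elim: m => [|m IH]; first by rewrite !expr0 mul1r mulr1.
rewrite exprS -mulrA; apply: (@le_trans _ _ (nr (N x) * (nr (iter m N x) * nr x ^+ m))).
  by rewrite ler_wpM2l ?nr_ge0.
by rewrite mulrA exprS mulrA ler_wpM2r ?exprn_ge0 ?nr_ge0.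
Qed.

Lemma root_of_m1 k : exists z : R[i], z ^+ (2 ^ k) = -1 /\ normc z = 1.
Proof.
have [z zE] : exists z : R[i], z ^+ (2 ^ k) = -1.
  elim: k => [|k [z zE]]; first by exists (-1); rewrite expr1.
  by exists (sqrtc z); rewrite expnS exprM sqr_sqrtc.
exists z; split=> //; apply/eqP.
have : normc z ^+ (2 ^ k) = 1.
  transitivity (normc (z ^+ (2 ^ k))).
    elim: (2 ^ k)%N => [|m IH]; first by rewrite !expr0 normc1.
    by rewrite !exprS normcM IH.
  by rewrite zE normcN normc1.
by move/eqP; rewrite pexpr_eq1 ?expn_gt0// ?normc_ge0.
Qed.

(* Rickart's argument: averaging the resolvent over the [2^k]-th roots of unity,
   one duplication at a time, shows that [(1 - u^m N^m)^-1] varies little with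
   [|u|], uniformly in [m]; so it stays close to [1] slightly beyond the radius
   [1 / r] at which the powers of [u N] stop converging to [0]. *)
Lemma doubling (c B q t : R) :
  (forall u : R[i], normc u <= c -> forall y, exists x, x - u *: N x = y) ->
  (forall u : R[i], normc u <= c -> forall x, nr x <= B * nr (x - u *: N x)) ->
  (forall u : R[i], normc u <= c -> forall x x' y, x - u *: N x = y ->
     x' - (t%:C * u) *: N x' = y -> nr (x - x') <= q * nr y) ->
  forall k (u : R[i]), normc u <= c -> let m := (2 ^ k)%N in
  [/\ (forall y, exists x, x - u ^+ m *: iter m N x = y),
      (forall x, nr x <= B * nr (x - u ^+ m *: iter m N x)) &
      (forall x x' y, x - u ^+ m *: iter m N x = y ->
     x' - (t%:C * u) ^+ m *: iter m N x' = y -> nr (x - x') <= q * nr y)].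
Proof.
move=> hS hF hE; elim=> [|k IH] u uc m.
  by rewrite /m expn0 /= !expr1; split=> [|x|]; [exact: hS|exact: hF|exact: hE].
have [z [zE z1]] := root_of_m1 k.
pose n := (2 ^ k)%N; have mE : m = (n + n)%N by rewrite /m expnS mul2n addnn.
have [S1 F1 E1] := IH u uc.
have zuc : normc (z * u) <= c by rewrite normcM z1 mul1r.
have [S2 F2 E2] := IH (z * u) zuc.
have zun : (z * u) ^+ n = - u ^+ n by rewrite exprMn zE mulN1r.
have ztun : (t%:C * (z * u)) ^+ n = - (t%:C * u) ^+ n.
  by rewrite mulrCA exprMn zE mulN1r.
(* [1 - P^2 N^(2n)] is the product of [1 - P N^n] and [1 + P N^n]. The induction hypothesis at [u]
   controls the first factor, and at [z u] the second, as [z^n = -1]. *)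
have fact (v : R[i]) x : let P := v ^+ n in let Nn := iter n N in
    x - v ^+ m *: iter m N x = (x + P *: Nn x) - P *: Nn (x + P *: Nn x) /\
    x - v ^+ m *: iter m N x = (x - P *: Nn x) + P *: Nn (x - P *: Nn x).
  move=> P Nn; have lNn : linear Nn := iter_linear n.
  rewrite mE iterD exprD -/Nn -/P (linD lNn) (linB lNn) !(linZ lNn) scalerDr scalerBr !scalerA.
  by split; [rewrite opprD addrA addrK | rewrite addrA subrK].
(* The partial fraction [1 / (1 - w^2) = (1 / (1 - w) + 1 / (1 + w)) / 2]: being an average, it
   preserves the constants [B] and [q] at each doubling. *)
have half (x : X) P (Nn : X -> X) : x = (2^-1 : R)%:C *: ((x + P *: Nn x) + (x - P *: Nn x)).
  have h2 : (2^-1 : R)%:C * 2 = 1 :> R[i].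
    by rewrite -(rmorph_nat (real_complex R)) -rmorphM mulVf ?pnatr_eq0.
  have -> : (x + P *: Nn x) + (x - P *: Nn x) = (2 : R[i]) *: x.
    by rewrite addrACA subrr addr0 scaler_nat mulr2n.
  by rewrite scalerA h2 scale1r.
have nrh (x y : X) : nr ((2^-1 : R)%:C *: (x + y)) <= (nr x + nr y) / 2.
  by rewrite nrZR ger0_norm ?invr_ge0// mulrC ler_wpM2r ?invr_ge0// nrD.
split.
- move=> y; have [x1 h1] := S2 y; have [x h] := S1 x1; exists x.
  rewrite (fact u x).2 h -h1 zun scaleNr opprK //.
- move=> x; have := nrh (x + u ^+ n *: iter n N x) (x - u ^+ n *: iter n N x).
  rewrite -half; have [f1 f2] := fact u x.
  have := F1 (x + u ^+ n *: iter n N x); rewrite -f1.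
  have := F2 (x - u ^+ n *: iter n N x); rewrite zun scaleNr opprK -f2; lra.
- move=> x x' y hx hx'; have [f1 f2] := fact u x; have [f1' f2'] := fact (t%:C * u) x'.
  have := E1 _ _ y (etrans (esym f1) hx) (etrans (esym f1') hx').
  have := E2 (x - u ^+ n *: iter n N x) (x' - (t%:C * u) ^+ n *: iter n N x') y.
  rewrite zun ztun !scaleNr !opprK => /(_ (etrans (esym f2) hx) (etrans (esym f2') hx')).
  have := nrh ((x + u ^+ n *: iter n N x) - (x' + (t%:C * u) ^+ n *: iter n N x'))
    ((x - u ^+ n *: iter n N x) - (x' - (t%:C * u) ^+ n *: iter n N x')).
  rewrite addrACA -opprD scalerBr -!half; lra.
Qed.

(** If the least bound [r0] of [N] exceeded [M], then [1 - u N] would be invertible, with uniform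
    bounds, for [|u|] slightly beyond [1 / r0]. There [doubling] bounds some power [N^m] by
    [(r0 - eta)^m], and [nr_iter_ge] passes this on to [N], contradicting minimality. *)
Lemma spectral_radius (M r : R) : 0 <= M ->
  (forall x, nr (N x) <= r * nr x) ->
  (forall u : R[i], normc u * M < 1 ->
    (forall y, exists x, x - u *: N x = y) /\
    (exists d : R, 0 < d /\ forall x, d * nr x <= nr (x - u *: N x))) ->
  forall x, nr (N x) <= M * nr x.
Proof.
move=> M0 hr0 hu.
pose E := [set a : R | 0 <= a /\ forall x, nr (N x) <= a * nr x].
have E0 : E !=set0.
  exists `|r|; split=> // x; rewrite (le_trans (hr0 x))// ler_wpM2r ?nr_ge0//.
  exact: ler_norm.
have hE : has_inf E by split=> //; exists 0 => a [].
set r0 := inf E.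
have r00 : 0 <= r0 by apply: lb_le_inf => // a [].
have Er0 x : nr (N x) <= r0 * nr x.
  apply: (@le_eps _ _ _ (nr x)) => e e0.
  have [a [a0 ha] ar] := inf_adherent e0 hE.
  by rewrite -mulrDl (le_trans (ha x))// ler_wpM2r ?nr_ge0// ltW.
suff rM : r0 <= M by move=> x; rewrite (le_trans (Er0 x))// ler_wpM2r ?nr_ge0.
rewrite leNgt; apply/negP => Mr.
have r0p : 0 < r0 by exact: le_lt_trans Mr.
pose s := (M + r0) / 2; have Ms : M < s by rewrite /s; lra.
have sr : s < r0 by rewrite /s; lra.
have s0 : 0 < s by exact: le_lt_trans Ms.
have uM (u : R[i]) : normc u <= s^-1 -> normc u * M < 1.
  move=> us; apply: (@le_lt_trans _ _ (s^-1 * M)); first by rewrite ler_wpM2r.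
  by rewrite mulrC ltr_pdivrMr// mul1r.
have [B0 hB0] : exists b : R, forall u : R[i], normc u <= s^-1 ->
    0 < b /\ forall x, nr x <= b * nr (x - u *: N x).
  apply: disc_uniform => [b b' u bb' [b0 h]|u us].
    split=> [|x]; first exact: lt_le_trans bb'.
    by rewrite (le_trans (h x))// ler_wpM2r ?nr_ge0.
  have [_ [d [d0 hd]]] := hu u (uM u us).
  (* Moving [u] by less than [d / (2 r0)] changes [u N x] by at most [d |x| / 2], half of the lower
     bound. *)
  exists (2 / d), (d / (2 * r0)); split=> [|u' uu' us']; first by rewrite divr_gt0// mulr_gt0.
  split=> [|x]; first by rewrite divr_gt0.
  rewrite mulrC mulrA ler_pdivlMr//.
  have := hd x; have -> : x - u *: N x = (x - u' *: N x) + (u' - u) *: N x.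
    by rewrite scalerBl addrA subrK.
  move=> h; have := nrD (x - u' *: N x) ((u' - u) *: N x).
  have : nr ((u' - u) *: N x) <= d / (2 * r0) * (r0 * nr x).
    by rewrite nrZ; apply: ler_pM => //; [exact: normc_ge0|exact: nr_ge0|exact: ltW].
  have -> : d / (2 * r0) * (r0 * nr x) = d * nr x / 2 by field; rewrite gt_eqF.
  lra.
have c0 : normc (0 : R[i]) <= s^-1 by rewrite normc0 invr_ge0 ltW.
have Bp : 0 < B0 by have [] := hB0 0 c0.
have hB u : normc u <= s^-1 -> forall x, nr x <= B0 * nr (x - u *: N x).
  by move=> /hB0[].
(* The first entry keeps [w = 1 / (r0 - eta)] within the disc of radius [1 / s]. The other two give
   [B0^2 (w - w') r0 <= 1/4], where [w' = 1 / (r0 + eta)] lies on the convergent side of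
   [1 / r0]. *)
pose eta := Num.min (r0 - s) (Num.min (r0 / 2) (r0 / (16 * B0 ^+ 2))).
have eta0 : 0 < eta.
  by rewrite /eta !lt_min subr_gt0 sr !divr_gt0// mulr_gt0// exprn_gt0.
have [eta1 eta2 eta3] : [/\ eta <= r0 - s, eta <= r0 / 2 & eta <= r0 / (16 * B0 ^+ 2)].
  by split; rewrite /eta !ge_min lexx ?orbT.
pose w := (r0 - eta)^-1; pose w' := (r0 + eta)^-1; pose t := w' / w.
have w0 : 0 < w by rewrite invr_gt0; lra.
have w'0 : 0 < w' by rewrite invr_gt0; lra.
have tw : t * w = w' by rewrite /t divfK// gt_eqF.
have ww' : w' <= w by rewrite lef_pV2 ?posrE; lra.
have ws : w <= s^-1 by rewrite lef_pV2 ?posrE; lra.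
have t0 : 0 <= t by rewrite divr_ge0 ?ltW.
have q4 : B0 * (B0 * ((w - w') * r0)) <= 4^-1.
  have -> : w - w' = 2 * eta / (r0 ^+ 2 - eta ^+ 2).
    have a1 : r0 - eta != 0 by apply: lt0r_neq0; lra.
    have a2 : r0 + eta != 0 by apply: lt0r_neq0; lra.
    by rewrite subr_sqr /w /w'; field; rewrite a1 a2.
  have p : 0 < r0 ^+ 2 - eta ^+ 2 by nra.
  have -> : B0 * (B0 * (2 * eta / (r0 ^+ 2 - eta ^+ 2) * r0)) =
    (2 * (B0 ^+ 2 * eta) * r0) / (r0 ^+ 2 - eta ^+ 2) by field; rewrite gt_eqF.
  rewrite ler_pdivrMr//.
  move: eta3; rewrite ler_pdivlMr; last by rewrite mulr_gt0// exprn_gt0.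
  by move=> h; nra.
have tnc (u : R[i]) : normc u <= w -> normc (t%:C * u) <= s^-1.
  move=> uw; rewrite normcM normcR ger0_norm//.
  apply: (@le_trans _ _ (t * w)); first by rewrite ler_wpM2l.
  by rewrite tw (le_trans ww').
have dbl := @doubling w B0 4^-1 t _ _ _.
have {}dbl := dbl (fun u uw => (hu u (uM u (le_trans uw ws))).1) (fun u uw => hB u (le_trans uw ws)) _.
have {}dbl : forall k (u : R[i]), normc u <= w -> let m := (2 ^ k)%N in
  [/\ (forall y, exists x, x - u ^+ m *: iter m N x = y),
      (forall x, nr x <= B0 * nr (x - u ^+ m *: iter m N x)) &
      (forall x x' y, x - u ^+ m *: iter m N x = y ->
     x' - (t%:C * u) ^+ m *: iter m N x' = y -> nr (x - x') <= 4^-1 * nr y)].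
  (* Resolvent identity: [1 - u N] maps [x - x'] to [(1 - t) u N x'], of norm at most
     [(w - w') r0 B0 |y|]. *)
  apply: dbl => u uw x x' y hx hx'.
  have uw' := le_trans uw ws.
  rewrite (le_trans (hB u uw' (x - x')))//.
  have -> : x - x' - u *: N (x - x') = (u - t%:C * u) *: N x'.
    have e : x = u *: N x + y by rewrite -hx addrC subrK.
    have e' : x' = y + (t%:C * u) *: N x' by rewrite -hx' subrK.
    rewrite (linB lN) scalerBr scalerBl [X in X - _ - _]e [X in _ - X - _]e'.
    by rewrite addrKA [X in X - _]addrC addrKA opprK addrC.
  have h' := hB _ (tnc u uw) x'; rewrite hx' in h'.
  rewrite nrZ.
  have -> : normc (u - t%:C * u) = (1 - t) * normc u.
    have -> : u - t%:C * u = (1 - t)%:C * u by rewrite rmorphB /= mulrBl mul1r.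
    by rewrite normcM normcR ger0_norm// subr_ge0 ler_pdivrMr// mul1r.
  apply: (@le_trans _ _ (B0 * ((w - w') * (r0 * (B0 * nr y))))).
    have t1 : 0 <= 1 - t by rewrite subr_ge0 ler_pdivrMr// mul1r.
    apply: ler_wpM2l; first exact: ltW.
    apply: ler_pM; [by rewrite mulr_ge0 ?normc_ge0|exact: nr_ge0| |].
      by rewrite -tw -{1}[w]mul1r -mulrBl ler_wpM2l.
    by rewrite (le_trans (Er0 x'))// ler_wpM2l.
  by have := nr_ge0 y; nra.
(* [w' r0 < 1], so high powers of [w' N] are negligible. *)
have [k hk] : exists k : nat, (w' * r0) ^+ (2 ^ k)%N * B0 <= 4^-1.
  have ct : (w' * r0) ^+ n @[n --> \oo] --> (0 : R).
    apply: cvg_expr; rewrite ger0_norm ?mulr_ge0 ?ltW//.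
    by rewrite mulrC ltr_pdivrMr ?mul1r; lra.
  have /cvgrPdist_lt/(_ ((4 * B0)^-1)) := ct.
  case; first by rewrite invr_gt0 mulr_gt0.
  move=> n _ hn; exists n; have /hn : (n <= 2 ^ n)%N by exact/ltnW/ltn_expl.
  rewrite sub0r normrN ger0_norm; last by rewrite exprn_ge0 ?mulr_ge0 // ltW.
  by move=> /ltW; rewrite invfM ler_pdivlMr.
have wnc : normc w%:C <= w by rewrite normcR ger0_norm// ltW.
have [_ _ h3] := dbl k w%:C wnc.
have w'nc : normc w'%:C <= w by rewrite normcR ger0_norm// ltW.
have [h1 h2 _] := dbl k w'%:C w'nc.
set m := (2 ^ k)%N in hk h1 h2 h3.
(* With [y = x - w^m N^m x], the vector [x'] is within [|y| / 4] of [y] because [(w' N)^m] is small,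
   and within [|y| / 4] of [x] by [doubling]. Hence [|x - y| <= |y| / 2], so that [|y| <= 2 |x|] and
   [|x - y| <= |x|]. *)
have key x : w ^+ m * nr (iter m N x) <= nr x.
  set y := x - (w%:C) ^+ m *: iter m N x.
  have [x' hx'] := h1 y.
  have d1 := h3 x x' y erefl.
  rewrite -rmorphM /= tw in d1; have {}d1 := d1 hx'.
  have d2 : nr (x' - y) <= 4^-1 * nr y.
    have -> : x' - y = (w'%:C) ^+ m *: iter m N x' by rewrite -hx' opprB addrC subrK.
    rewrite nrZ -rmorphXn normcR ger0_norm; last by rewrite exprn_ge0// ltW.
    have := iter_bound m x' r00 Er0; have := h2 x'; rewrite hx' => g1 g2.
    apply: (@le_trans _ _ (w' ^+ m * (r0 ^+ m * (B0 * nr y)))).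
      apply: ler_wpM2l; first by rewrite exprn_ge0// ltW.
      by rewrite (le_trans g2)// ler_wpM2l// exprn_ge0.
    by rewrite !mulrA -exprMn ler_wpM2r ?nr_ge0.
  have d3 := nr_tri x' x y; have := nr_subl y x; rewrite (nrBC y x).
  have -> : w ^+ m * nr (iter m N x) = nr (x - y).
    by rewrite /y opprB addrC subrK nrZ -rmorphXn normcR ger0_norm// exprn_ge0// ltW.
  lra.
have m0 : (0 < m)%N by rewrite expn_gt0.
have : E (r0 - eta).
  split=> [|x]; first lra.
  have [->|x0] := eqVneq x 0; first by rewrite (lin0 lN) nr0 mulr0.
  have nx := nr_gt0 x0.
  rewrite -(@ler_pXn2r _ m)// ?nnegrE ?mulr_ge0 ?nr_ge0//; last lra.
  rewrite -(ler_pM2r nx) (le_trans (nr_iter_ge m x))//.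
  rewrite exprMn -mulrA [_ * nr x]mulrC mulrA ler_wpM2r ?exprn_ge0 ?nr_ge0//.
  have := key x; rewrite /w exprVn ler_pdivrMl// exprn_gt0; lra.
by move=> /(ge_inf hE.2); rewrite -/r0; lra.
Qed.

End SpectralRadius.

(** * Functional calculus *)

Section FunctionalCalculus.
Variables (R : realType) (X : completeNormedModType R[i]).
Variables (dot : {dot X for @Num.conj R[i]}) (hdot : induces_norm dot).
Local Notation ip := (ip dot).
Local Notation is_adj := (is_adj dot).
Variables (S S' : X -> X).
Hypotheses (bS : bop S) (bS' : bop S') (aS : is_adj S S').
Hypothesis nS : forall x, S (S' x) = S' (S x).

Definition commutes (M N : X -> X) := forall x, M (N x) = N (M x).

(* The bicommutant of [{S, S'}]: commutative, stable under adjoints, inverses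
   and strong limits, hence made of normal operators. *)
Definition bicomm (N : X -> X) := bop N /\
  forall M, bop M -> commutes M S -> commutes M S' -> commutes M N.

Lemma bicomm_id : bicomm id.
Proof. by split; [exact: bop_id|]. Qed.

Lemma bicomm_S : bicomm S.
Proof. by split. Qed.

Lemma bicomm_comp N L : bicomm N -> bicomm L -> bicomm (N \o L).
Proof.
move=> [bN hN] [bL hL]; split; first exact: bop_comp.
by move=> M bM MS MS' x /=; rewrite hN// hL.
Qed.

Lemma bicomm_add N L : bicomm N -> bicomm L -> bicomm (fun x => N x + L x).
Proof.
move=> [bN hN] [bL hL]; split; first exact: bop_add.
by move=> M bM MS MS' x /=; rewrite (linD bM.1) hN// hL.
Qed.

Lemma bicomm_scale a N : bicomm N -> bicomm (fun x => a *: N x).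
Proof.
move=> [bN hN]; split; first exact: bop_scale.
by move=> M bM MS MS' x /=; rewrite (linZ bM.1) hN.
Qed.

Lemma bicomm_inv N V : bicomm N -> bop V -> cancel N V -> cancel V N -> bicomm V.
Proof.
move=> [bN hN] bV NV VN; split=> // M bM MS MS' x.
by rewrite -{2}[x]VN hN// NV.
Qed.

Lemma bicomm_lim (u : nat -> X -> X) N : bop N ->
  (forall x, cvs (fun n => u n x) (N x)) -> (forall n, bicomm (u n)) -> bicomm N.
Proof.
move=> bN uN cu; split=> // M bM MS MS' x.
apply: (cvs_uniq (bop_cvs bM (uN x))).
have := uN (M x); congr (cvs _ _); apply/funext => n.
by have [_ ->] := cu n.
Qed.

(** Normality puts [S] and [S'] in the commutant of [{S, S'}], so [N] commutes with both; then [L],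
    being in the bicommutant, commutes with [N]. *)
Lemma bicomm_comm N L : bicomm N -> bicomm L -> commutes N L.
Proof.
move=> [bN hN] [bL hL]; apply: (hL N bN) => x; apply/esym.
- exact: hN.
- apply: hN => // y; exact/esym/nS.
Qed.

(** If [M] commutes with [S] and [S'], then so does its adjoint, since [S] and [S'] are adjoint to
    each other. Hence [N] commutes with the adjoint of [M], and taking adjoints once more [N']
    commutes with [M]. *)
Lemma bicomm_adj N N' : bicomm N -> bop N' -> is_adj N N' -> bicomm N'.
Proof.
move=> [bN hN] bN' aN; split=> // M bM MS MS' y.
have [M' [bM' aM]] := adj_exists hdot bM.
have c1 : commutes M' S.
  move=> z; apply: (ip_inj hdot) => x.
  by rewrite -aM -(is_adj_sym aS) -MS' aM (is_adj_sym aS).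
have c2 : commutes M' S'.
  move=> z; apply: (ip_inj hdot) => x.
  by rewrite -aM -aS -MS aM aS.
apply: (ip_inj hdot) => x.
by rewrite -(is_adj_sym aM) -aN -(hN M')// (is_adj_sym aM) aN.
Qed.

Lemma bicomm_normal N : bicomm N ->
  exists N', [/\ bop N', is_adj N N' & commutes N N'].
Proof.
move=> cN; have [N' [bN' aN]] := adj_exists hdot cN.1.
by exists N'; split=> //; apply: bicomm_comm => //; exact: bicomm_adj aN.
Qed.

Lemma nr_adj N N' : is_adj N N' -> commutes N N' -> forall x, nr (N' x) = nr (N x).
Proof.
move=> aN cN x; apply/eqP; rewrite -(@eqrXn2 _ 2) ?nr_ge0// -!(ipxx hdot).
by rewrite -aN cN (is_adj_sym aN).
Qed.

Lemma bicomm_paranormal N : bicomm N -> forall x, nr (N x) ^+ 2 <= nr (N (N x)) * nr x.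
Proof.
move=> /bicomm_normal[N' [_ aN cN]] x; rewrite -(ipxx hdot) -(is_adj_sym aN).
by rewrite (le_trans (ip_CS hdot _ _))// (nr_adj aN cN).
Qed.

(** Horner's scheme for [p(S) x], run on the list of coefficients. *)
Definition peval (p : {poly R[i]}) (x : X) : X :=
  foldr (fun c y => c *: x + S y) 0 p.

Lemma peval0 x : peval 0 x = 0.
Proof. by rewrite /peval polyseq0. Qed.

Lemma pevalXD p c x : peval (p * 'X + c%:P) x = c *: x + S (peval p x).
Proof.
rewrite -cons_poly_def /peval polyseq_cons; case: ifP => // /negbFE/nilP ->.
rewrite polyseqC /= (lin0 bS.1) addr0; case: eqP => [->|] /=; rewrite ?scale0r//.
by rewrite (lin0 bS.1) addr0.
Qed.

Lemma pevalC c x : peval c%:P x = c *: x.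
Proof. by rewrite -[c%:P]add0r -(mul0r 'X) pevalXD peval0 (lin0 bS.1) addr0. Qed.

Lemma pevalMX p x : peval (p * 'X) x = S (peval p x).
Proof. by rewrite -[_ * 'X]addr0 -(polyC0) pevalXD scale0r add0r. Qed.

Lemma pevalX x : peval 'X x = S x.
Proof. by rewrite -['X]mul1r pevalMX -polyC1 pevalC scale1r. Qed.

Lemma pevalD p q x : peval (p + q) x = peval p x + peval q x.
Proof.
elim/poly_ind: p q => [|p c IH] q; first by rewrite add0r peval0 add0r.
have [q' [d ->]] : exists q' d, q = q' * 'X + d%:P.
  by elim/poly_ind: q => [|q d _]; [exists 0, 0; rewrite mul0r addr0 | exists q, d].
rewrite addrACA -mulrDl -polyCD !pevalXD IH (linD bS.1) scalerDl addrACA //.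
Qed.

Lemma pevalZ c p x : peval (c *: p) x = c *: peval p x.
Proof.
elim/poly_ind: p => [|p d IH]; first by rewrite scaler0 peval0 scaler0.
rewrite -mul_polyC mulrDr mulrA -polyCM !pevalXD mul_polyC IH.
by rewrite scalerDr scalerA (linZ bS.1).
Qed.

Lemma pevalM p q x : peval (p * q) x = peval p (peval q x).
Proof.
elim/poly_ind: p => [|p c IH]; first by rewrite mul0r !peval0.
by rewrite mulrDl mulrAC mul_polyC pevalD pevalMX pevalZ IH pevalXD addrC.
Qed.

Lemma bicomm_peval p : bicomm (peval p).
Proof.
elim/poly_ind: p => [|p c IH].
  have -> : peval 0 = fun x => 0 *: (id x : X).
    by apply/funext => x; rewrite peval0 scale0r.
  exact: bicomm_scale bicomm_id.
have -> : peval (p * 'X + c%:P) = fun x => c *: (id x : X) + (S \o peval p) x.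
  by apply/funext => x; rewrite pevalXD.
apply: bicomm_add; first exact: bicomm_scale bicomm_id.
exact: bicomm_comp bicomm_S IH.
Qed.

Lemma pevalB p q x : peval (p - q) x = peval p x - peval q x.
Proof. by rewrite pevalD -scaleN1r pevalZ scaleN1r. Qed.

Variable K : set R[i].
Hypothesis K0 : K 0.
Hypothesis resS : forall z, ~ K z -> exists V, [/\ bop V,
  cancel (fun x => z *: x - S x) V & cancel V (fun x => z *: x - S x)].

Definition noroot (q : {poly R[i]}) := forall z, K z -> q.[z] != 0.

Lemma peval_inv q : noroot q ->
  exists V, [/\ bicomm V, cancel (peval q) V & cancel V (peval q)].
Proof.
move=> hq; have [r rE] := closed_field_poly_normal q.
(* [K] contains [0], which excludes the zero polynomial. *)
have c0 : lead_coef q != 0.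
  by rewrite lead_coef_eq0; apply/eqP => q0; have := hq _ K0; rewrite q0 horner0 eqxx.
have hr z : z \in r -> ~ K z.
  move=> zr /hq; rewrite rE hornerZ mulf_eq0 negb_or c0 /=.
  by rewrite -rootE root_prod_XsubC zr.
suff [V [bV V1 V2]] : exists V, [/\ bop V, cancel (peval q) V & cancel V (peval q)].
  by exists V; split=> //; apply: bicomm_inv V1 V2 => //; exact: bicomm_peval.
rewrite rE; move: (lead_coef q) c0 hr => c c0 {rE}.
elim: r => [|z r IH] hr.
  exists (fun x => c^-1 *: id x); split; first exact: bop_scale (bop_id X).
    by move=> x; rewrite big_nil pevalZ -polyC1 pevalC scale1r scalerA mulVf// scale1r.
  by move=> x; rewrite big_nil pevalZ -polyC1 pevalC scale1r scalerA mulfV// scale1r.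
have [|V [bV V1 V2]] := IH; first by move=> y yr; apply: hr; rewrite inE yr orbT.
have [|W [bW W1 W2]] := resS (z := z); first by apply: hr; rewrite inE eqxx.
have E x : peval (c *: \prod_(y <- z :: r) ('X - y%:P)) x =
    - (z *: peval (c *: \prod_(y <- r) ('X - y%:P)) x - S (peval (c *: \prod_(y <- r) ('X - y%:P)) x)).
  by rewrite big_cons scalerAr pevalM pevalB pevalX pevalC opprB.
(* [W] inverts [z - S], while the factor ['X - z] evaluates to its opposite; hence the sign. *)
exists (fun x => V (- 1 *: W x)); split.
- exact: bop_comp bV (bop_scale _ bW).
- by move=> x; rewrite E (linN bW.1) W1 scaleN1r opprK V1.
- move=> x; rewrite E V2 scaleN1r (linN bS.1) scalerN -opprD opprK W2 //.
Qed.

Lemma peval_le p q (M : R) : noroot q -> 0 <= M ->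
  (forall z, K z -> normc p.[z] <= M * normc q.[z]) ->
  forall x, nr (peval p x) <= M * nr (peval q x).
Proof.
move=> hq M0 hpq x; have [V [cV V1 V2]] := peval_inv hq.
pose N := peval p \o V.
have cN : bicomm N by apply: bicomm_comp => //; exact: bicomm_peval.
have [r [r0 hr]] := bop_pos cN.1.
rewrite -{1}[x]V1; apply: (@spectral_radius _ _ N cN.1.1 (bicomm_paranormal cN) M r M0 hr).
(* [1 - u N] is [(q - u p)(S)] composed with [V]. A root [z] of [q - u p] in [K] would give
   [|q(z)| <= |u| M |q(z)| < |q(z)|]. *)
move=> u uM; have hG : noroot (q - u *: p).
  move=> z Kz; rewrite hornerD hornerN hornerZ subr_eq0; apply/eqP => E.
  have := hpq z Kz; have := congr1 (@normc R) E; rewrite normcM => E' h.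
  have : 0 < normc q.[z].
    by rewrite lt_def normc_ge0 andbT; apply: contra (hq z Kz) => /eqP/eq0_normc->.
  by have := normc_ge0 u; nra.
have [W [cW W1 W2]] := peval_inv hG.
have E y : y - u *: N y = peval (q - u *: p) (V y).
  by rewrite pevalB pevalZ V2.
split=> [y|]; first by exists (peval q (W y)); rewrite E V1 W2.
have [c [cp hc]] := bop_pos (bop_comp (bicomm_peval q).1 cW.1).
exists c^-1; split; first by rewrite invr_gt0.
move=> y; rewrite ler_pdivrMl// (le_trans _ (hc _))//= E W1 V2//.
Qed.

(* [N] is [f(S)]: fractions [p / q] approximate [f] on [K] while [p(S) q(S)^-1]
   approximates [N] in norm, both conditions being multiplied by [q]. *)
Definition fcalc (f : R[i] -> R[i]) (N : X -> X) :=
  [/\ bicomm N, exists M : R, forall z, K z -> normc (f z) <= M &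
    forall e : R, 0 < e -> exists p q, [/\ noroot q,
      forall z, K z -> normc (f z * q.[z] - p.[z]) <= e * normc q.[z] &
      forall x, nr (N (peval q x) - peval p x) <= e * nr (peval q x)]].

Lemma fcalc_ext f g N : (forall z, K z -> f z = g z) -> fcalc f N -> fcalc g N.
Proof.
move=> fg [cN [M hM] h]; split=> //.
  by exists M => z Kz; rewrite -fg ?hM.
move=> e /h[p [q [h1 h2 h3]]]; exists p, q; split=> // z Kz.
by rewrite -fg// h2.
Qed.

(** The approximating fractions are bounded by [M + e] on [K], so [peval_le] applies to them, and
    every [x] is of the form [q(S) (V x)]. *)
Lemma fcalc_le f N (M : R) : fcalc f N -> 0 <= M ->
  (forall z, K z -> normc (f z) <= M) -> forall x, nr (N x) <= M * nr x.
Proof.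
move=> [cN _ h] M0 hM x; apply: (@le_eps _ _ _ (2 * nr x)) => e e0.
have [p [q [hq hpq hN]]] := h e e0.
have [V [_ _ V2]] := peval_inv hq.
have pq z : K z -> normc p.[z] <= (M + e) * normc q.[z].
  move=> Kz; have := le_normcD (f z * q.[z]) (- (f z * q.[z] - p.[z]) : R[i]).
  rewrite opprB addrC subrK normcM -opprB normcN.
  have := hpq z Kz; have := hM z Kz; have := normc_ge0 q.[z]; nra.
have Me : 0 <= M + e by rewrite addr_ge0// ltW.
have := peval_le hq Me pq (V x); have := hN (V x); rewrite V2.
have := nr_subl (N x) (peval p (V x)); lra.
Qed.

Lemma fcalc_add f N g L : fcalc f N -> fcalc g L ->
  fcalc (fun z => f z + g z) (fun x => N x + L x).
Proof.
move=> [cN [Mf hf] hN] [cL [Mg hg] hL]; split; first exact: bicomm_add.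
  exists (Mf + Mg) => z Kz; rewrite (le_trans (le_normcD _ _))// lerD ?hf ?hg//.
move=> e e0; have e2 : 0 < e / 2 by rewrite divr_gt0.
have [p [q [hq pq Npq]]] := hN _ e2; have [p' [q' [hq' pq' Lpq]]] := hL _ e2.
exists (p * q' + p' * q), (q * q'); split=> [z Kz|z Kz|x].
- by rewrite hornerM mulf_neq0 ?hq ?hq'.
- rewrite hornerD !hornerM.
  have -> : (f z + g z) * (q.[z] * q'.[z]) - (p.[z] * q'.[z] + p'.[z] * q.[z]) =
    (f z * q.[z] - p.[z]) * q'.[z] + (g z * q'.[z] - p'.[z]) * q.[z] by ring.
  rewrite (le_trans (le_normcD _ _))// !normcM.
  have := pq z Kz; have := pq' z Kz; have := normc_ge0 q.[z]; have := normc_ge0 q'.[z].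
  nra.
- have E : peval q' (peval q x) = peval q (peval q' x) by rewrite -!pevalM mulrC.
  rewrite pevalD !pevalM opprD addrACA (le_trans (nrD _ _))//.
  have := Npq (peval q' x); have := Lpq (peval q x); rewrite E; lra.
Qed.

Lemma fcalc_scale a f N : fcalc f N -> fcalc (fun z => a * f z) (fun x => a *: N x).
Proof.
move=> [cN [M hM] hN]; split; first exact: bicomm_scale.
  by exists (normc a * M) => z Kz; rewrite normcM ler_wpM2l ?normc_ge0 ?hM.
move=> e e0; have a1 : 0 < normc a + 1 by rewrite ltr_wpDl ?normc_ge0.
have d0 : 0 < e / (normc a + 1) by rewrite divr_gt0.
have de : normc a * (e / (normc a + 1)) <= e.
  by rewrite mulrCA ger_pMr// ler_pdivrMr// mul1r lerDl.
have [p [q [hq pq Npq]]] := hN _ d0.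
exists (a *: p), q; split=> // [z Kz|x].
  rewrite hornerZ -mulrA -mulrBr normcM.
  apply: (@le_trans _ _ (normc a * (e / (normc a + 1) * normc q.[z]))).
    by rewrite ler_wpM2l ?normc_ge0 ?pq.
  by rewrite mulrA ler_wpM2r ?normc_ge0.
rewrite pevalZ -scalerBr nrZ.
apply: (@le_trans _ _ (normc a * (e / (normc a + 1) * nr (peval q x)))).
  by rewrite ler_wpM2l ?normc_ge0.
by rewrite mulrA ler_wpM2r ?nr_ge0.
Qed.

Lemma fcalc_sub f N g L : fcalc f N -> fcalc g L ->
  fcalc (fun z => f z - g z) (fun x => N x - L x).
Proof.
move=> hf /(fcalc_scale (-1)) hg; have h := fcalc_add hf hg.
have -> : (fun x => N x - L x) = (fun x => N x + (-1) *: L x).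
  by apply/funext => x; rewrite scaleN1r.
by apply: fcalc_ext h => z _; rewrite mulN1r.
Qed.

Lemma fcalc_uniq f N L : fcalc f N -> fcalc f L -> forall x, N x = L x.
Proof.
move=> hN hL x; apply/eqP; rewrite -subr_eq0; apply/eqP/nr_eq0/le_anti.
rewrite nr_ge0 andbT -[leRHS](mul0r (nr x)).
by apply: (fcalc_le (fcalc_sub hN hL)) => // z _; rewrite subrr normc0.
Qed.

Lemma fcalc_mul f N g L : fcalc f N -> fcalc g L ->
  fcalc (fun z => f z * g z) (N \o L).
Proof.
move=> hfN hgL; have [cN [Mf0 hf0] hN] := hfN; have [cL [Mg0 hg0] hL] := hgL.
have {hf0} [Mf [Mf0' hf]] : exists M : R, 0 <= M /\ forall z, K z -> normc (f z) <= M.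
  by exists `|Mf0|; split=> // z /hf0 h; rewrite (le_trans h)// ler_norm.
have {hg0} [Mg [Mg0' hg]] : exists M : R, 0 <= M /\ forall z, K z -> normc (g z) <= M.
  by exists `|Mg0|; split=> // z /hg0 h; rewrite (le_trans h)// ler_norm.
split; first exact: bicomm_comp.
  exists (Mf * Mg) => z Kz; rewrite normcM ler_pM ?normc_ge0 ?hf ?hg//.
(* The error of a product splits as [(f - p/q) g + (p/q) (g - p'/q')], at most [d Mg + (Mf + d) d];
   as [d <= 1], this is at most [d M]. *)
move=> e e0; pose M := Mf + Mg + 1; have M0 : 0 < M by rewrite /M; lra.
pose d := Num.min 1 (e / M); have d0 : 0 < d by rewrite lt_min ltr01 divr_gt0.
have d1 : d <= 1 by rewrite /d ge_min lexx.
have de : d * M <= e by rewrite -ler_pdivlMr// /d ge_min lexx orbT.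
have {}de : d * Mg + (Mf + d) * d <= e by rewrite /M in de; nra.
have [p [q [hq pq Npq]]] := hN _ d0; have [p' [q' [hq' pq' Lpq]]] := hL _ d0.
exists (p * p'), (q * q'); split=> [z Kz|z Kz|x].
- by rewrite hornerM mulf_neq0 ?hq ?hq'.
- rewrite !hornerM.
  have -> : f z * g z * (q.[z] * q'.[z]) - p.[z] * p'.[z] =
    (f z * q.[z] - p.[z]) * (g z * q'.[z]) + p.[z] * (g z * q'.[z] - p'.[z]) by ring.
  rewrite (le_trans (le_normcD _ _))// !normcM.
  have hp : normc p.[z] <= (Mf + d) * normc q.[z].
    have := le_normcD (f z * q.[z]) (- (f z * q.[z] - p.[z]) : R[i]).
    rewrite opprB addrC subrK normcM -opprB normcN.
    have := pq z Kz; have := hf z Kz; have := normc_ge0 q.[z]; nra.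
  have n1 := normc_ge0 q.[z]; have n2 := normc_ge0 q'.[z].
  have b1 : normc (f z * q.[z] - p.[z]) * (normc (g z) * normc q'.[z]) <=
      d * normc q.[z] * (Mg * normc q'.[z]).
    by rewrite ler_pM ?mulr_ge0 ?normc_ge0 ?pq// ler_wpM2r// hg.
  have b2 : normc p.[z] * normc (g z * q'.[z] - p'.[z]) <=
      (Mf + d) * normc q.[z] * (d * normc q'.[z]).
    by rewrite ler_pM ?normc_ge0 ?pq'.
  have n3 := mulr_ge0 n1 n2; nra.
- have qL y : peval q (L y) = L (peval q y) by apply: bicomm_comm => //; exact: bicomm_peval.
  have qq' y : peval q (peval q' y) = peval q' (peval q y) by rewrite -!pevalM mulrC.
  have qp' y : peval q (peval p' y) = peval p' (peval q y) by rewrite -!pevalM mulrC.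
  have Mfd : 0 <= Mf + d by rewrite addr_ge0// ltW.
  have hp y : nr (peval p y) <= (Mf + d) * nr (peval q y).
    apply: peval_le => // z Kz.
    have := le_normcD (f z * q.[z]) (- (f z * q.[z] - p.[z]) : R[i]).
    rewrite opprB addrC subrK normcM -opprB normcN.
    have := pq z Kz; have := hf z Kz; have := normc_ge0 q.[z]; nra.
  rewrite !pevalM /= -qL.
  have h1 := Npq (L (peval q' x)).
  have h2 := hp (L (peval q' x) - peval p' x).
  rewrite (linB (bicomm_peval p).1.1) (linB (bicomm_peval q).1.1) qL qq' qp' in h2.
  have h3 := Lpq (peval q x).
  rewrite qL in h1 *; have h4 := fcalc_le hgL Mg0' hg (peval q (peval q' x)).
  have h5 := nr_tri (peval p (L (peval q' x))) (N (L (peval q (peval q' x)))) (peval p (peval p' x)).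
  rewrite -qq' in h2 h3.
  have := nr_ge0 (peval q (peval q' x)).
  move: h1 h2 h3 h4 h5.
  move: (nr (N _ - _)) (nr (_ - peval p (peval p' x))) (nr (L _ - _)) => a1 a2 a3.
  move: (nr _) (nr _) (nr _) => a4 a5 a6; nra.
Qed.

(** By [fcalc_le], functions that are close on [K] have operators close in norm; the operators of
    the approximants are therefore Cauchy, and their limit stays in the bicommutant. *)
Lemma fcalc_lim f : (forall e : R, 0 < e -> exists g L, fcalc g L /\
    forall z, K z -> normc (f z - g z) <= e) -> exists N, fcalc f N.
Proof.
move=> h.
have hn (n : nat) : exists gL : (R[i] -> R[i]) * (X -> X), fcalc gL.1 gL.2 /\
    forall z, K z -> normc (f z - gL.1 z) <= n.+1%:R^-1.
  have [|g [L hgL]] := h n.+1%:R^-1; first by rewrite invr_gt0.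
  by exists (g, L).
have {hn} /choice[gL hgL] := hn.
pose g n := (gL n).1; pose L n := (gL n).2.
have fg n : fcalc (g n) (L n) by have [] := hgL n.
have gf n z : K z -> normc (f z - g n z) <= n.+1%:R^-1 by have [_] := hgL n; exact.
have LL m n x : nr (L m x - L n x) <= (m.+1%:R^-1 + n.+1%:R^-1) * nr x.
  apply: (fcalc_le (fcalc_sub (fg m) (fg n))) => [|z Kz].
    by rewrite addr_ge0// invr_ge0.
  have -> : g m z - g n z = (f z - g n z) - (f z - g m z) by ring.
  by rewrite (le_trans (le_normcD _ _))// normcN addrC lerD ?gf.
have /choice[N hN] x : exists l, cvs (fun n => L n x) l.
  apply: cvs_complete => e e0.
  have nx : 0 < 2 * (nr x + 1) by rewrite mulr_gt0// ltr_wpDl ?nr_ge0.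
  have [|k hk] := @inv_small _ (e / (2 * (nr x + 1))); first by rewrite divr_gt0.
  exists k => m n /hk hm /hk hn; rewrite (le_lt_trans (LL m n x))//.
  move: hm hn; rewrite !ltr_pdivlMr//.
  have := nr_ge0 x; have : 0 < m.+1%:R^-1 :> R by rewrite invr_gt0.
  have : 0 < n.+1%:R^-1 :> R by rewrite invr_gt0.
  by move: (m.+1%:R^-1) (n.+1%:R^-1) (nr x) => a b c; lra.
have NL n x : nr (N x - L n x) <= 2 * n.+1%:R^-1 * nr x.
  apply: (@le_eps _ _ _ 1) => e e0; have [k hk] := hN x e e0.
  have /hk h1 : (k <= maxn k n)%N by rewrite leq_maxl.
  have h2 := LL (maxn k n) n x; have h3 := nr_tri (L (maxn k n) x) (N x) (L n x).
  have h4 : (maxn k n).+1%:R^-1 <= n.+1%:R^-1 :> R.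
    by rewrite lef_pV2 ?posrE// ler_nat ltnS leq_maxr.
  rewrite nrBC in h1; have := nr_ge0 x.
  by move: h2 h4; move: (_.+1%:R^-1) (n.+1%:R^-1) => a b *; nra.
have bL n : bop (L n) by have [[]] := fg n.
have bN : bop N.
  split=> [a x y|].
    apply: (cvs_uniq (hN _)).
    have := cvsD (cvsZ a (hN x)) (hN y); congr (cvs _ _); apply/funext => n.
    by rewrite (bL n).1.
  have [M [M0 hM]] := bop_pos (bL 0%N).
  exists (M + 2) => x; have := hM x; have := NL 0%N x; have := nr_subl (N x) (L 0%N x).
  rewrite invr1; lra.
have cN : bicomm N by apply: (bicomm_lim bN hN) => n; have [] := fg n.
exists N; split=> //.
  have [_ [M hM] _] := fg 0%N; exists (M + 1) => z Kz.
  have := le_normcD (f z - g 0%N z : R[i]) (g 0%N z); rewrite subrK => h1.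
  by rewrite (le_trans h1)// addrC lerD ?hM// (le_trans (gf 0%N z Kz))// invr1.
move=> e e0; have e4 : 0 < e / 4 by rewrite divr_gt0.
have [n hn] := inv_small e4; have {}hn := hn n (leqnn n).
have [_ _ hg] := fg n; have [p [q [hq pq Lpq]]] := hg _ e4.
exists p, q; split=> // [z Kz|x].
  have -> : f z * q.[z] - p.[z] = (f z - g n z) * q.[z] + (g n z * q.[z] - p.[z]) by ring.
  rewrite (le_trans (le_normcD _ _))// normcM.
  have := gf n z Kz; have := pq z Kz; have := normc_ge0 q.[z].
  by move: hn; move: (n.+1%:R^-1) => a *; nra.
have := nr_tri (L n (peval q x)) (N (peval q x)) (peval p x).
have := NL n (peval q x); have := Lpq x; have := nr_ge0 (peval q x).
by move: hn; move: (n.+1%:R^-1) => a *; nra.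
Qed.

Lemma fcalc_rat (p q : {poly R[i]}) (M : R) : noroot q ->
  (forall z, K z -> normc (p.[z] / q.[z]) <= M) ->
  exists N, fcalc (fun z => p.[z] / q.[z]) N.
Proof.
move=> hq hM; have [V [cV V1 V2]] := peval_inv hq.
exists (peval p \o V); split.
- by apply: bicomm_comp => //; exact: bicomm_peval.
- by exists M.
move=> e e0; exists p, q; split=> // [z Kz|x].
  by rewrite divfK ?hq// subrr normc0 mulr_ge0 ?normc_ge0// ltW.
by rewrite /= V1 subrr nr0 mulr_ge0 ?nr_ge0// ltW.
Qed.

Lemma fcalc_one : fcalc (fun=> 1) id.
Proof.
split; [exact: bicomm_id|by exists 1 => z _; rewrite normc1|].
move=> e e0; exists 1, 1; split=> [z Kz|z Kz|x].
- by rewrite hornerE oner_eq0.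
- by rewrite !hornerE ?mul1r subrr normc0 mulr_ge0 ?normc_ge0// ltW.
- by rewrite subrr nr0 mulr_ge0 ?nr_ge0// ltW.
Qed.

Lemma fcalc_S (M : R) : (forall z, K z -> normc z <= M) -> fcalc id S.
Proof.
move=> hM; split; [exact: bicomm_S|by exists M|].
move=> e e0; exists 'X, 1; split=> [z Kz|z Kz|x].
- by rewrite hornerE oner_eq0.
- by rewrite !hornerE ?mulr1 subrr normc0 mulr_ge0 ?normc_ge0// ltW.
- by rewrite pevalX -polyC1 pevalC scale1r subrr nr0 mulr_ge0 ?nr_ge0// ltW.
Qed.

End FunctionalCalculus.

(** * Scalar estimates *)

Section ComplexExponential.
Variable R : realType.

Lemma sin_le (y : R) : `|sin y| <= `|y|.
Proof.
wlog y0 : y / 0 <= y.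
  move=> h; have [/h//|/ltW y0] := leP 0 y.
  by rewrite -normrN -sinN -(normrN y); apply: h; rewrite oppr_ge0.
have [c _] := @MVT_segment R sin cos 0 y y0 (fun x _ => is_derive_sin x)
  (continuous_subspaceT (@continuous_sin R)).
by rewrite sin0 !subr0 => ->; rewrite normrM ler_piMl ?normr_ge0 ?cos_max.
Qed.

Lemma cos_ge (y : R) : `|cos y - 1| <= y ^+ 2 / 2.
Proof.
have -> : cos y = 1 - 2 * sin (y / 2) ^+ 2.
  rewrite {1}[y](_ : _ = (y / 2) *+ 2); last by rewrite mulr2n; field.
  by rewrite cos_mulr2n cos2sin2 mulr2n; ring.
rewrite addrAC subrr add0r normrN normrM normrX ger0_norm//.
have := sin_le (y / 2); rewrite normrM [`|2^-1|]ger0_norm// => h.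
have := normr_ge0 (sin (y / 2)); rewrite -[y ^+ 2]real_normK ?num_real//.
nra.
Qed.

Lemma sin_approx (y : R) : `|y| <= 1 -> `|sin y - y| <= y ^+ 2.
Proof.
wlog y0 : y / 0 <= y.
  move=> h; have [/h//|/ltW y0] := leP 0 y => y1.
  rewrite -normrN opprB addrC -sinN -{1}(opprK y) [X in `|X|](_ : _ = sin (- y) - (- y)); last by rewrite opprK addrC.
  by rewrite -sqrrN; apply: h; rewrite ?oppr_ge0// normrN.
rewrite ger0_norm// => y1.
have dsub (x : R) : is_derive x 1 (fun u : R => sin u - u) (cos x - 1).
  by apply: is_deriveB.
have csub : continuous (fun u : R => sin u - u).
  by move=> x; apply: cvgB; [exact: continuous_sin|exact: cvg_id].
have [c] := @MVT_segment R _ _ 0 y y0 (fun x _ => dsub x) (continuous_subspaceT csub).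
rewrite in_itv /= sin0 !subr0 => /andP[c0 cy] ->.
rewrite normrM (ger0_norm y0); have := cos_ge c; nra.
Qed.

(** Both sides come from [1 + x <= exp x]; used at [- x] it gives [exp x <= 1 / (1 - x)]. *)
Lemma expR_approx (x : R) : `|x| <= 2^-1 -> `|expR x - 1 - x| <= 2 * x ^+ 2.
Proof.
rewrite ler_norml => /andP[x1 x2].
have h1 := expR_ge1Dx x; have := expR_ge1Dx (- x); rewrite expRN => h2.
have p : 0 < 1 - x by lra.
have h3 : expR x <= (1 - x)^-1.
  by rewrite -[expR x]invrK lef_pV2 ?posrE// ?invr_gt0 ?expR_gt0.
rewrite ger0_norm; last lra.
have h4 : (1 - x)^-1 - 1 - x = x ^+ 2 / (1 - x) by field; rewrite gt_eqF.
have : x ^+ 2 / (1 - x) <= 2 * x ^+ 2.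
  by rewrite ler_pdivrMr//; have := sqr_ge0 x; nra.
lra.
Qed.

Definition cexp (w : R[i]) : R[i] :=
  (expR (complex.Re w))%:C * (cos (complex.Im w) +i* sin (complex.Im w)).

Lemma cexp0 : cexp 0 = 1.
Proof. by rewrite /cexp /= expR0 cos0 sin0 mul1r. Qed.

Lemma cexpD v w : cexp (v + w) = cexp v * cexp w.
Proof.
case: v => a b; case: w => c d; rewrite /cexp /= expRD cosD sinD.
by apply/eqP; rewrite eq_complex /=; apply/andP; split; apply/eqP; ring.
Qed.

Lemma normc_cexp w : normc (cexp w) = expR (complex.Re w).
Proof.
rewrite /cexp normcM normcR ger0_norm ?expR_ge0//=.
by rewrite cos2Dsin2 sqrtr1 mulr1.
Qed.

Lemma cexpMn (n : nat) w : cexp (n%:R * w) = cexp w ^+ n.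
Proof.
elim: n => [|n IH]; first by rewrite mul0r cexp0.
by rewrite -natr1 mulrDl mul1r cexpD IH exprSr.
Qed.

Lemma cexp_approx w : normc w <= 2^-1 -> normc (cexp w - 1 - w) <= 8 * normc w ^+ 2.
Proof.
have [] := ReIm_le_normc w; case: w => x y; rewrite [complex.Re _]/= [complex.Im _]/=.
set r := normc _ => xr yr r2.
have x2 : `|x| <= 2^-1 by exact: le_trans xr r2.
have y2 : `|y| <= 2^-1 by exact: le_trans yr r2.
have e1 := expR_approx x2; have c1 := cos_ge y.
have s1 : `|sin y - y| <= y ^+ 2 by apply: sin_approx; lra.
have eR : complex.Re (cexp (x +i* y) - 1 - x +i* y) = expR x * cos y - 1 - x.
  by rewrite /cexp /=; ring.
have eI : complex.Im (cexp (x +i* y) - 1 - x +i* y) = expR x * sin y - y.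
  by rewrite /cexp /=; ring.
apply: (le_trans (normc_le_ReIm _)); rewrite eR eI.
have xx : x ^+ 2 = `|x| ^+ 2 by rewrite real_normK ?num_real.
have yy : y ^+ 2 = `|y| ^+ 2 by rewrite real_normK ?num_real.
have nx := normr_ge0 x; have ny := normr_ge0 y.
have eb : `|expR x - 1| <= 2 * `|x|.
  have := ler_normD (expR x - 1 - x) x; rewrite subrK; nra.
have eb2 : expR x <= 2 by have := ler_norm (expR x - 1); lra.
have e0 := expR_ge0 x.
have -> : expR x * cos y - 1 - x = (expR x - 1 - x) + expR x * (cos y - 1) by ring.
have -> : expR x * sin y - y = (expR x - 1) * sin y + (sin y - y) by ring.
have h1 := ler_normD (expR x - 1 - x) (expR x * (cos y - 1)).
have h2 := ler_normD ((expR x - 1) * sin y) (sin y - y).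
rewrite normrM (ger0_norm e0) in h1; rewrite normrM in h2.
have h3 := sin_le y.
have h4 : expR x * `|cos y - 1| <= y ^+ 2.
  by have := normr_ge0 (cos y - 1); nra.
have h5 : `|expR x - 1| * `|sin y| <= 2 * `|x| * `|y| by rewrite ler_pM.
have h6 : `|x| * `|y| <= r ^+ 2 by rewrite expr2 ler_pM.
have h7 : x ^+ 2 <= r ^+ 2 by rewrite xx ler_pXn2r ?nnegrE ?normc_ge0.
have h8 : y ^+ 2 <= r ^+ 2 by rewrite yy ler_pXn2r ?nnegrE ?normc_ge0.
have := sqr_ge0 r; lra.
Qed.

(** For [|w| > 1/2] the triangle inequality suffices, as then [1 < 4 |w|^2]. The last factor makes
    the estimate global, and bounded where [Re w] is bounded above. *)
Lemma cexp_taylor w :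
  normc (cexp w - 1 - w) <= 8 * normc w ^+ 2 * (1 + expR (complex.Re w)).
Proof.
have e0 := expR_ge0 (complex.Re w); have n0 := normc_ge0 w.
have [h|h] := leP (normc w) 2^-1.
  apply: (le_trans (cexp_approx h)); rewrite ler_peMr//; last lra.
  by rewrite mulr_ge0// sqr_ge0.
have := le_normcD (cexp w - 1 : R[i]) (- w); have := le_normcD (cexp w : R[i]) (- 1).
rewrite !normcN normc1 normc_cexp.
set e := expR _ in e0 *; set r := normc w in n0 h *.
have r1 : r <= 2 * r ^+ 2 by nra.
have r2 : 4^-1 <= r ^+ 2 by nra.
have := mulr_ge0 e0 (sqr_ge0 r); nra.
Qed.

Lemma cexp_lip w : normc (cexp w - 1) <= 5 * normc w * (1 + expR (complex.Re w)).
Proof.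
have e0 := expR_ge0 (complex.Re w); have n0 := normc_ge0 w.
have [h|h] := leP (normc w) 2^-1.
  have := cexp_approx h; have := le_normcD (cexp w - 1 - w : R[i]) w; rewrite subrK.
  set e := expR _ in e0 *; set r := normc w in n0 h *; nra.
have := le_normcD (cexp w : R[i]) (- 1); rewrite normcN normc1 normc_cexp.
set e := expR _ in e0 *; set r := normc w in n0 h *; nra.
Qed.

Lemma sub_expr_le (u v : R[i]) (m : R) (n : nat) : normc u <= m -> normc v <= m ->
  normc (u ^+ n.+1 - v ^+ n.+1) <= n.+1%:R * m ^+ n * normc (u - v).
Proof.
move=> um vm; have m0 : 0 <= m by exact: le_trans (normc_ge0 u) um.
have nX (z : R[i]) k : normc (z ^+ k) = normc z ^+ k.
  by elim: k => [|k IH]; rewrite ?expr0 ?normc1// !exprS normcM IH.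
elim: n => [|n IH]; first by rewrite !expr1 expr0 !mul1r.
have -> : u ^+ n.+2 - v ^+ n.+2 = (u - v) * u ^+ n.+1 + v * (u ^+ n.+1 - v ^+ n.+1).
  by rewrite ![_ ^+ n.+2]exprS; ring.
rewrite (le_trans (le_normcD _ _))// !normcM nX.
have h1 : normc (u - v) * normc u ^+ n.+1 <= normc (u - v) * m ^+ n.+1.
  by rewrite ler_wpM2l ?normc_ge0// ler_pXn2r ?nnegrE ?normc_ge0.
have h2 : normc v * normc (u ^+ n.+1 - v ^+ n.+1) <= m * (n.+1%:R * m ^+ n * normc (u - v)).
  by rewrite ler_pM ?normc_ge0.
rewrite -[n.+2%:R]natr1 exprS in h1 *.
move: h1 h2; rewrite !exprS.
move: (n.+1%:R) (m ^+ n) (normc (u - v)) => *; lra.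
Qed.

End ComplexExponential.

(** * Estimates on the spectral region *)

Section Region.
Variables (R : realType) (a b beta : R).

Definition region (l : R[i]) :=
  complex.Re l <= a - b * `|complex.Im l| `^ beta^-1.

Lemma region_Re l : 0 < b -> region l -> complex.Re l <= a.
Proof.
move=> b0 h; by apply: (le_trans h); rewrite gerBl mulr_ge0 ?powR_ge0// ltW.
Qed.

(** In [region_norm], [a + 1] accounts for the real part and the power of [1 / b] for the imaginary
    part. *)
Definition region_cst : R := a + 1 + b^-1 `^ beta.

Lemma region_cst_gt0 : 0 <= a -> 0 < region_cst.
Proof. by move=> a0; rewrite ltr_wpDr ?powR_ge0// ltr_wpDl. Qed.

(** With [v = a - Re l], the region is [|Im l| <= (v / b)^beta]. Thus [|l|] grows at most like a
    power of [v], which the decay of [exp (t Re l)] beats. *)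
Lemma region_norm (a0 : 0 <= a) (b0 : 0 < b) (beta1 : 1 <= beta) l : region l ->
  normc l <= region_cst * (1 + (a - complex.Re l)) `^ beta.
Proof.
have beta0 : 0 < beta by lra.
have rc0 := region_cst_gt0 a0.
move=> h; have xa := region_Re b0 h; move: h; rewrite /region.
set x := complex.Re l in xa *; set y := complex.Im l => h.
apply: (le_trans (normc_le_ReIm l)); rewrite -/x -/y.
set v := a - x; have v0 : 0 <= v by rewrite subr_ge0.
have v1 : 1 + v <= (1 + v) `^ beta by apply: le1r_powR => //; rewrite lerDl.
have y1 : `|y| <= (v / b) `^ beta.
  have -> : `|y| = (`|y| `^ beta^-1) `^ beta by rewrite -powRrM mulVf ?gt_eqF// powRr1.
  apply: ge0_ler_powR; rewrite ?nnegrE ?powR_ge0 ?divr_ge0// ?(ltW beta0)// ?(ltW b0)//.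
  by rewrite ler_pdivlMr// mulrC /v; lra.
have y2 : (v / b) `^ beta <= b^-1 `^ beta * (1 + v) `^ beta.
  rewrite powRM// ?invr_ge0 ?(ltW b0)// mulrC ler_wpM2l ?powR_ge0//.
  by apply: ge0_ler_powR; rewrite ?nnegrE ?(ltW beta0)//; lra.
have x1 : `|x| <= (a + 1) * (1 + v).
  have -> : x = a - v by rewrite /v opprB addrC subrK.
  by rewrite ler_norml; apply/andP; split; nra.
rewrite /region_cst mulrDl lerD//; last exact: le_trans y2.
by rewrite (le_trans x1)// ler_wpM2l// addr_ge0.
Qed.

Lemma expR_geX (x : R) n : 0 <= x -> x ^+ n <= n`!%:R * expR x.
Proof.
case: n => [|n] x0; first by rewrite expr0 fact0 mul1r -expR0 ler_expR.
have := expR_ge1Dxn n x0; rewrite -ler_pdivrMl ?ltr0n ?fact_gt0// mulrC; lra.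
Qed.

Lemma powR_X (x r : R) n : 0 <= x -> (x ^+ n) `^ r = (x `^ r) ^+ n.
Proof. by move=> x0; rewrite -(powR_mulrn n x0) -(powR_mulrn n (powR_ge0 x r)) powRAC. Qed.

Lemma region_gevrey (a0 : 0 <= a) (b0 : 0 < b) (beta1 : 1 <= beta) (c d : R) : 0 < c -> c <= d -> exists al K : R,
  [/\ 0 < al, 0 < K & forall n s l, c <= s <= d -> region l ->
    normc l ^+ n * expR (s * complex.Re l) <= K * al ^+ n * n`!%:R `^ beta].
Proof.
have beta0 : 0 < beta by lra.
have rc0 := region_cst_gt0 a0.
move=> c0 cd; pose q := c / beta; have q0 : 0 < q by rewrite divr_gt0.
(* Raising [(1 + v)^n <= n! q^-n exp (q (1 + v))] to the power [beta] produces [exp (c (1 + v))],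
   since [q beta = c]. Multiplied by [exp (s (a - v))] with [c <= s <= d], it is at most
   [exp (c + d a)]. *)
exists (region_cst * q^-1 `^ beta), (expR (c + d * a)); split.
- by rewrite mulr_gt0 // powR_gt0// invr_gt0.
- exact: expR_gt0.
move=> n s l /andP[cs sd] hl; have xa := region_Re b0 hl.
set v := a - complex.Re l; have v0 : 0 <= v by rewrite subr_ge0.
have w0 : 0 <= 1 + v by rewrite addr_ge0.
have h1 : normc l ^+ n <= region_cst ^+ n * ((1 + v) ^+ n) `^ beta.
  rewrite powR_X// -exprMn lerXn2r ?nnegrE ?normc_ge0 ?mulr_ge0 ?powR_ge0 ?(ltW rc0)//.
  exact: region_norm.
have h2 : ((1 + v) ^+ n) `^ beta <= n`!%:R `^ beta * (q^-1 `^ beta) ^+ n * expR (c * (1 + v)).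
  have -> : c * (1 + v) = q * (1 + v) * beta by rewrite /q; field; rewrite gt_eqF.
  rewrite expRM -powR_X ?invr_ge0 ?(ltW q0)// -powRM ?exprn_ge0 ?invr_ge0 ?(ltW q0)//.
  rewrite -powRM ?mulr_ge0 ?exprn_ge0 ?invr_ge0 ?(ltW q0)// ?expR_ge0//.
  have E : (1 + v) ^+ n = q^-1 ^+ n * (q * (1 + v)) ^+ n.
    by rewrite -exprMn mulrA mulVf ?mul1r// gt_eqF.
  apply: ge0_ler_powR; rewrite ?nnegrE ?exprn_ge0 ?mulr_ge0 ?exprn_ge0 ?invr_ge0 ?expR_ge0 ?(ltW q0) ?(ltW beta0)//.
  rewrite E -mulrA mulrCA ler_wpM2l ?exprn_ge0 ?invr_ge0 ?(ltW q0)//.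
  by rewrite expR_geX// mulr_ge0 ?(ltW q0).
have h3 : expR (c * (1 + v)) * expR (s * complex.Re l) <= expR (c + d * a).
  rewrite -expRD ler_expR.
  have -> : complex.Re l = a - v by rewrite /v opprB addrC subrK.
  have sc0 : 0 <= s - c by rewrite subr_ge0.
  have ds0 : 0 <= d - s by rewrite subr_ge0.
  by have := mulr_ge0 sc0 v0; have := mulr_ge0 ds0 a0; lra.
apply: (@le_trans _ _ (region_cst ^+ n * (n`!%:R `^ beta * (q^-1 `^ beta) ^+ n) *
  (expR (c * (1 + v)) * expR (s * complex.Re l)))).
  rewrite [leRHS]mulrA ler_wpM2r ?expR_ge0// (le_trans h1)// -mulrA.
  by rewrite ler_wpM2l// exprn_ge0// ltW.
rewrite exprMn [leRHS](_ : _ = region_cst ^+ n * (n`!%:R `^ beta * (q^-1 `^ beta) ^+ n) * expR (c + d * a)); last by ring.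
by rewrite ler_wpM2l// !mulr_ge0 ?exprn_ge0 ?powR_ge0// ltW.
Qed.

Lemma bernoulli_le (y : R) n : 0 <= y -> 1 + n%:R * y <= (1 + y) ^+ n.
Proof.
move=> y0; elim: n => [|n IH]; first by rewrite mul0r addr0.
rewrite exprS -natr1; have : 0 <= n%:R * y by rewrite mulr_ge0.
nra.
Qed.

Lemma norm_one_sub (l : R[i]) (c : R) : 0 <= c -> complex.Re l <= a -> c * a <= 2^-1 ->
  1 - c * complex.Re l <= normc (1 - c%:C * l) /\ 2^-1 <= normc (1 - c%:C * l).
Proof.
move=> c0 la ca; have : 1 - c * complex.Re l <= normc (1 - c%:C * l).
  have [h _] := ReIm_le_normc (1 - c%:C * l); apply: le_trans h.
  apply: (le_trans _ (ler_norm _)); case: l la => x y /= _.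
  by rewrite mul0r subr0.
by have : c * complex.Re l <= c * a; [rewrite ler_wpM2l | split; lra].
Qed.

(** For [Re l <= - V] both terms are at most [e / 2]. The rest of the region is bounded, and there
    the two terms are compared as [(n + 1)]-st powers of nearby numbers. *)
Lemma region_approx (a0 : 0 <= a) (b0 : 0 < b) (beta1 : 1 <= beta) (t e : R) : 0 < t -> 0 < e -> exists n : nat,
  t / n.+1%:R * a <= 2^-1 /\ forall l, region l ->
    normc (cexp (t%:C * l) - (1 - (t / n.+1%:R)%:C * l)^-1 ^+ n.+1) <= e.
Proof.
have beta0 : 0 < beta by lra.
have rc0 := region_cst_gt0 a0.
(* Chosen so that [t V = 2 / e], whence [1 / (1 + t V) <= e / 2]. *)
move=> t0 e0; pose V := 2 / (e * t); have V0 : 0 < V by rewrite divr_gt0// mulr_gt0.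
pose L := region_cst * (1 + a + V) `^ beta.
have L0 : 0 <= L by rewrite mulr_ge0 ?powR_ge0// ltW.
pose M := 26 * (t * L) ^+ 2 * expR (2 * t * a).
have M0 : 0 <= M by rewrite mulr_ge0 ?expR_ge0// mulr_ge0// sqr_ge0.
(* With [c = t i], the entries ensure in turn that the final error [i M] is at most [e], that
   [c L <= 1/2] as [cexp_approx] requires, and that [c a <= 1/2], which keeps [1 - c l] away from
   [0]. *)
pose d := Num.min (e / (M + 1)) (Num.min (2^-1 / (t * L + 1)) (2^-1 / (t * a + 1))).
have tL : 0 <= t * L by rewrite mulr_ge0// ltW.
have ta : 0 <= t * a by rewrite mulr_ge0// ltW.
have d0 : 0 < d by rewrite /d !lt_min !divr_gt0//; lra.
have [N hN] := inv_small d0; have {hN} := hN N (leqnn N).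
set i := N.+1%:R^-1; have i0 : 0 < i by rewrite invr_gt0.
rewrite /d !lt_min => /andP[hM /andP[hL ha]].
have {}hM : i * M <= e by move: hM; rewrite ltr_pdivlMr; [nra|lra].
have {}hL : t * i * L <= 2^-1 by move: hL; rewrite ltr_pdivlMr; [nra|lra].
have {}ha : t * i * a <= 2^-1 by move: ha; rewrite ltr_pdivlMr; [nra|lra].
exists N; rewrite -/i; split=> // l hl; have xa := region_Re b0 hl.
set c := t * i in hL ha *; have c0 : 0 < c by rewrite mulr_gt0.
have cN : c * N.+1%:R = t by rewrite /c /i mulfVK.
have [n1 n2] := norm_one_sub (ltW c0) xa ha.
have nX (z : R[i]) k : normc (z ^+ k) = normc z ^+ k.
  by elim: k => [|k IH]; rewrite ?expr0 ?normc1// !exprS normcM IH.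
have [xV|xV] := leP (complex.Re l) (- V).
  have h1 : (1 + t * V)^-1 <= e / 2.
    rewrite -[e / 2]invrK lef_pV2 ?posrE ?invr_gt0 ?divr_gt0//; last first.
      by rewrite addr_gt0// mulr_gt0.
    have -> : t * V = (e / 2)^-1 by rewrite /V; field; rewrite ?gt_eqF//.
    by rewrite lerDr.
  apply: (le_trans (le_normcD _ _)); rewrite normcN normc_cexp nX normcV.
  have -> : complex.Re (t%:C * l) = t * complex.Re l.
    by case: (l) => x y /=; rewrite mul0r subr0.
  have h2 : expR (t * complex.Re l) <= e / 2.
    apply: (le_trans _ h1); rewrite -[expR _]invrK -expRN.
    rewrite lef_pV2 ?posrE ?expR_gt0//; last by rewrite addr_gt0// mulr_gt0.
    apply: (le_trans (expR_ge1Dx _)); rewrite ler_expR -mulrN ler_wpM2l ?(ltW t0)//; lra.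
  have h3 : (normc (1 - c%:C * l))^-1 ^+ N.+1 <= e / 2.
    apply: (le_trans _ h1); rewrite exprVn lef_pV2 ?posrE.
    - apply: (@le_trans _ _ ((1 + c * V) ^+ N.+1)).
        have cV : 0 <= c * V by rewrite mulr_ge0 ?ltW.
        by have := bernoulli_le N.+1 cV; rewrite mulrCA mulrA cN.
      rewrite ler_pXn2r ?nnegrE ?normc_ge0//; last nra.
      by apply: (le_trans _ n1); nra.
    - by rewrite exprn_gt0//; lra.
    - by rewrite addr_gt0// mulr_gt0.
  lra.
have lL : normc l <= L.
  apply: (le_trans (region_norm a0 b0 beta1 hl)); rewrite ler_wpM2l ?(ltW rc0)//.
  by apply: ge0_ler_powR; rewrite ?nnegrE ?(ltW beta0)//; lra.
have -> : t%:C * l = N.+1%:R * (c%:C * l).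
  by rewrite mulrA; congr (_ * _); rewrite -{1}cN rmorphM /= rmorph_nat mulrC.
rewrite cexpMn; set u := cexp _; set w := c%:C * l in n1 n2 *; set v := (1 - w)^-1.
have wE : complex.Re w = c * complex.Re l.
  by rewrite /w; case: (l) => x y /=; rewrite mul0r subr0.
have nw : normc w <= c * L by rewrite normcM normcR ger0_norm ?(ltW c0)// ler_wpM2l ?(ltW c0).
(* A common bound for both bases, using [1 / (1 - c a) <= 1 + 2 c a]; its [N]-th power stays below
   [exp (2 t a)]. *)
pose m := expR (2 * c * a).
have ca0 : 0 <= c * a by rewrite mulr_ge0// ltW.
have um : normc u <= m.
  by rewrite normc_cexp ler_expR wE; nra.
have v2 : normc v <= 2.
  by rewrite normcV -[2]invrK lef_pV2 ?posrE ?invr_gt0//; lra.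
have vm : normc v <= m.
  apply: (@le_trans _ _ (1 + 2 * c * a)); last exact: expR_ge1Dx.
  rewrite normcV -[1 + 2 * c * a]invrK lef_pV2 ?posrE ?invr_gt0; [|lra|lra].
  apply: (le_trans _ n1); apply: (@le_trans _ _ (1 - c * a)); last by nra.
  rewrite -[_^-1]mul1r ler_pdivrMr; nra.
have nw0 := normc_ge0 w.
(* [26 = 2 * (8 * 3/2 + 1)], from [|v| <= 2], the Taylor constant [8], [|1 - w| <= 3/2], and the
   term [w^2]. *)
have uv : normc (u - v) <= 26 * (c * L) ^+ 2.
  have w1 : 1 - w != 0 by apply/eqP => E; move: n2; rewrite E normc0; lra.
  have -> : u - v = v * ((u - 1 - w) * (1 - w) - w ^+ 2) by rewrite /v; field.
  have w2 : normc w <= 2^-1 by exact: le_trans hL.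
  have h1 := cexp_approx w2; rewrite -/u in h1.
  have h2 : normc (1 - w) <= 2.
    by have := le_normcD (1 : R[i]) (- w); rewrite normcN normc1; lra.
  have h3 : normc ((u - 1 - w) * (1 - w) - w ^+ 2) <= 13 * normc w ^+ 2.
    have h4 : normc (1 - w) <= 3 / 2.
      by have := le_normcD (1 : R[i]) (- w); rewrite normcN normc1; lra.
    apply: (le_trans (le_normcD _ _)); rewrite normcN normcM nX.
    have : normc (u - 1 - w) * normc (1 - w) <= 8 * normc w ^+ 2 * (3 / 2).
      by rewrite ler_pM ?normc_ge0.
    lra.
  rewrite normcM; have : normc v * normc ((u - 1 - w) * (1 - w) - w ^+ 2) <= 2 * (13 * normc w ^+ 2).
    by rewrite ler_pM ?normc_ge0.
  have cL0 := le_trans nw0 nw.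
  have : normc w ^+ 2 <= (c * L) ^+ 2 by rewrite lerXn2r.
  lra.
apply: (le_trans (sub_expr_le N um vm)).
have m1 : m ^+ N <= expR (2 * t * a).
  rewrite /m -expRM_natl ler_expR.
  have : N%:R <= N.+1%:R :> R by rewrite ler_nat.
  move: cN; move: (N%:R) (N.+1%:R) => x y <- xy; nra.
apply: (le_trans _ hM).
apply: (@le_trans _ _ (N.+1%:R * expR (2 * t * a) * (26 * (c * L) ^+ 2))).
  by rewrite ler_pM ?normc_ge0// ?mulr_ge0 ?exprn_ge0 ?expR_ge0// ler_wpM2l.
have -> : c = t * i by [].
rewrite le_eqVlt; apply/orP; left; apply/eqP.
rewrite /M /i; field; by rewrite addrC natr1 pnatr_eq0.
Qed.

End Region.

Lemma fact_leX n : (n`! <= n ^ n)%N.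
Proof.
elim: n => // n IH; rewrite factS expnS leq_mul2l /= (leq_trans IH)//.
by case: n {IH} => // n; rewrite leq_exp2r.
Qed.

(** Take [n] to be the integer part of [u / e], where [u = (|Im l| / al)^(1/beta)]. As
    [n! e^n <= (n e)^n <= u^n], the hypothesis for this [n] becomes [exp (n beta + Re l) <= K]. *)
Lemma gevrey_region (R : realType) (beta al K : R) : 1 <= beta -> 0 < al -> 0 < K ->
  exists b a : R, 0 < b /\ forall l : R[i],
    (forall n, normc l ^+ n * expR (complex.Re l) <= K * al ^+ n * n`!%:R `^ beta) ->
    complex.Re l <= a - b * `|complex.Im l| `^ beta^-1.
Proof.
move=> beta1 al0 K0; have beta0 : 0 < beta by lra.
pose E : R := expR 1; have E0 : 0 < E by exact: expR_gt0.
exists (beta / E * al^-1 `^ beta^-1), (ln K + beta); split.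
  by rewrite mulr_gt0 ?divr_gt0// powR_gt0 ?invr_gt0.
move=> l h; set y := `|complex.Im l|; set x := complex.Re l in h *.
pose u := (y / al) `^ beta^-1; have u0 : 0 <= u by exact: powR_ge0.
have uE : 0 <= u / E by rewrite divr_ge0// ltW.
have [n n1 n2] : exists2 n : nat, n%:R * E <= u & u / E < n.+1%:R.
  exists (Num.truncn (u / E)); last exact: truncnS_gt.
  by rewrite -ler_pdivlMr// truncn_le.
have fn : 0 < n`!%:R :> R by rewrite ltr0n fact_gt0.
have y0 : 0 <= y / al by rewrite divr_ge0 ?(ltW al0)// normr_ge0.
have uX : (u ^+ n) `^ beta = (y / al) ^+ n.
  by rewrite powR_X// /u -powRrM mulVf ?gt_eqF// powRr1.
have h1 : (n`!%:R * E ^+ n) `^ beta <= (u ^+ n) `^ beta.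
  apply: ge0_ler_powR; rewrite ?nnegrE ?exprn_ge0 ?mulr_ge0 ?exprn_ge0 ?(ltW beta0) ?(ltW E0)//.
  apply: (@le_trans _ _ ((n%:R * E) ^+ n)).
    by rewrite exprMn ler_wpM2r ?exprn_ge0 ?(ltW E0)// -natrX ler_nat fact_leX.
  by rewrite lerXn2r ?nnegrE ?mulr_ge0 ?(ltW E0).
have h2 : (y / al) ^+ n * expR x <= K * n`!%:R `^ beta.
  rewrite expr_div_n mulrAC ler_pdivrMr ?exprn_gt0//.
  have := h n; rewrite [K * _ * _]mulrAC; apply: le_trans.
  rewrite ler_wpM2r ?expR_ge0// lerXn2r ?nnegrE ?normc_ge0// ?normr_ge0//.
  by have [] := ReIm_le_normc l.
have h3 : (E ^+ n) `^ beta * expR x <= K.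
  have p : 0 < n`!%:R `^ beta by exact: powR_gt0.
  rewrite -(ler_pM2l p) mulrA -powRM ?exprn_ge0 ?(ltW E0)// [leRHS]mulrC.
  by apply: le_trans h2; rewrite ler_wpM2r ?expR_ge0// -uX.
have h4 : n%:R * beta + x <= ln K.
  rewrite -ler_expR lnK ?posrE// expRD expRM; apply: le_trans h3.
  by rewrite ler_wpM2r ?expR_ge0// /E -expRM_natl mulr1.
(* Rounding costs at most one unit of [n], hence the summand [beta] in the constant
   [ln K + beta]. *)
have h5 : u / E - 1 <= n%:R by rewrite lerBlDr natr1 ltW.
have h6 : beta * (u / E) <= ln K + beta - x.
  by have := ler_wpM2l (ltW beta0) h5; lra.
have -> : beta / E * al^-1 `^ beta^-1 * y `^ beta^-1 = beta * (u / E).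
  by rewrite /u powRM ?invr_ge0 ?(ltW al0)//; [ring | exact: normr_ge0].
lra.
Qed.

(** * Generation of the semigroup *)

Section LimitsAtZero.
Variables (R : realType) (X : normedModType R[i]).

Lemma cvg_dnbhs0 (f : R -> X) (l : X) :
  (forall e : R, 0 < e -> exists d : R, 0 < d /\
     forall h, h != 0 -> `|h| < d -> nr (f h - l) < e) ->
  f h @[h --> 0^'] --> l.
Proof.
move=> H; apply/cvgrPdist_lt => e; rewrite ltcE => /andP[/eqP /= ie re].
have [d [d0 hd]] := H _ re.
apply/nbhs_ballP; exists d => //= h; rewrite /ball /= sub0r normrN => hd' h0.
by rewrite nrE nrBC ltcE /= ie eqxx hd.
Qed.

Lemma cvg_at_right0 (f : R -> X) (l : X) :
  (forall e : R, 0 < e -> exists d : R, 0 < d /\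
     forall h, 0 < h -> h < d -> nr (f h - l) < e) <->
  f h @[h --> 0^'+] --> l.
Proof.
split=> [H|/cvgrPdist_lt H e e0].
  apply/cvgrPdist_lt => e; rewrite ltcE => /andP[/eqP /= ie re].
  have [d [d0 hd]] := H _ re.
  apply/nbhs_ballP; exists d => //= h; rewrite /ball /= sub0r normrN => hd' h0.
  by rewrite nrE nrBC ltcE /= ie eqxx hd// (le_lt_trans (ler_norm h)).
have : 0 < e%:C :> R[i] by rewrite ltcR.
move=> /H/nbhs_ballP[d /= d0 hd]; exists d; split=> // h h0 hd'.
have := hd h; rewrite /ball /= sub0r normrN gtr0_norm// => /(_ hd' h0).
by rewrite nrE ltcR nrBC.
Qed.

End LimitsAtZero.

(** * From the functional calculus to the semigroup *)

Section Generation.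
Variables (R : realType) (X : completeNormedModType R[i]).
Variables (dot : {dot X for @Num.conj R[i]}) (hdot : induces_norm dot).
Variables (A : operator X) (hA : normal_op dot A).
Variables (a b beta : R).
Hypotheses (a0 : 0 <= a) (b0 : 0 < b) (beta1 : 1 <= beta).
Hypothesis hres : forall l, ~ region a b beta l -> resolvent_set A l.
Local Notation D := (op_dom A).

(** At distance at least [1] to the right of the region, so that [K] lies in the unit disc. *)
Let mu : R[i] := (a + 1)%:C.

Let mu_res : resolvent_set A mu.
Proof.
apply: hres; rewrite /region /= normr0 => h; have := a0; have := b0.
have : 0 <= b * 0 `^ beta^-1 by rewrite mulr_ge0 ?powR_ge0// ltW.
by move: h; lra.
Qed.

Let S0 : {linear X -> X} := projT1 (cid mu_res).
Let S : X -> X := S0.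

Let SP : [/\ bop S, forall y, D (S y) /\ mu *: S y - A (S y) = y &
  forall x, D x -> S (mu *: x - A x) = x].
Proof. by rewrite /S /S0; case: cid => T [cT h1 h2]; split=> //; exact/bop_cont. Qed.

Let bS : bop S. Proof. by have [] := SP. Qed.
Let S1 y : D (S y) /\ mu *: S y - A (S y) = y. Proof. by have [_ + _] := SP; apply. Qed.
Let S2 x : D x -> S (mu *: x - A x) = x. Proof. by have [_ _] := SP; apply. Qed.

Let adjS := adj_exists hdot bS.
Let S' := projT1 (cid adjS).
Let bS' : bop S'. Proof. by rewrite /S'; case: cid => T []. Qed.
Let aS : is_adj dot S S'. Proof. by rewrite /S'; case: cid => T []. Qed.
Let nS x : S (S' x) = S' (S x).
Proof. exact: (resolvent_normal hdot hA bS.1 S1 S2 aS). Qed.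

(** The region in the coordinate [z = 1 / (mu - l)], that is [l = mu - z^-1]; the point [0] is the
    image of infinity. *)
Let K : set R[i] := [set z | z = 0 \/ (z != 0 /\ region a b beta (mu - z^-1))].
Let K0 : K 0. Proof. by left. Qed.

Let K_le1 z : K z -> normc z <= 1.
Proof.
case=> [->|[z0 /(region_Re b0) h]]; first by rewrite normc0.
have h1 : 1 <= normc z^-1.
  have [h2 _] := ReIm_le_normc z^-1; apply: le_trans h2.
  apply: (le_trans _ (ler_norm _)); move: h; case: (z^-1) => x y /=; lra.
rewrite -[normc z]invrK -normcV invf_le1//; exact: lt_le_trans h1.
Qed.

(** For [z != 0], [mu z - 1] is [l z], the symbol of the bounded operator [A S]. *)
Let K_lam z : K z -> normc (mu * z - 1) <= a + 2.
Proof.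
move=> /K_le1 h; apply: (le_trans (le_normcD _ _)); rewrite normcN normc1 normcM normcR.
have a0' := a0; rewrite ger0_norm; last lra.
have : (a + 1) * normc z <= a + 1 by rewrite ler_piMr//; lra.
lra.
Qed.

(** If [T] is the resolvent at [l = mu - z^-1], the resolvent identity gives the inverse
    [z^-1 (1 + z^-1 T)] of [z - S]. *)
Let resS z : ~ K z -> exists V, [/\ bop V,
  cancel (fun x => z *: x - S x) V & cancel V (fun x => z *: x - S x)].
Proof.
move=> nK; have z0 : z != 0 by apply/eqP => z0; apply: nK; left.
have [T [cT T1 T2]] : resolvent_set A (mu - z^-1).
  by apply: hres => h; apply: nK; right.
have bT : bop T by exact/bop_cont.
have ST y : S (T y) = z *: (T y - S y).
  have [Dy Ey] := T1 y; have := S2 Dy.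
  have -> : mu *: T y - A (T y) = y + z^-1 *: T y.
    by move: Ey; rewrite scalerBl addrAC => /eqP; rewrite subr_eq => /eqP.
  rewrite (linD bS.1) (linZ bS.1) => h.
  have -> : T y - S y = z^-1 *: S (T y) by rewrite -[X in X - _]h addrAC subrr add0r.
  by rewrite scalerA mulfV// scale1r.
have TS y : T (S y) = z *: (T y - S y).
  have [Dy Ey] := S1 y; have := T2 _ Dy.
  have -> : (mu - z^-1) *: S y - A (S y) = y - z^-1 *: S y.
    by rewrite scalerBl addrAC Ey.
  rewrite (linB bT.1) (linZ bT.1) => h.
  have -> : T y - S y = z^-1 *: T (S y) by rewrite -[X in _ - X]h opprB addrCA subrr addr0.
  by rewrite scalerA mulfV// scale1r.
exists (fun y => z^-1 *: (id y + z^-1 *: T y)); split.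
- exact/bop_scale/bop_add/bop_scale/bT/bop_id.
- move=> x /=; rewrite (linB bT.1) (linZ bT.1) TS -scalerBr opprB addrCA subrr addr0.
  by rewrite [z^-1 *: (z *: S x)]scalerA mulVf// scale1r subrK scalerA mulVf// scale1r.
- move=> y /=; rewrite scalerA mulfV// scale1r (linZ bS.1) (linD bS.1) (linZ bS.1).
  rewrite ST [z^-1 *: (z *: (_ - _))]scalerA mulVf// scale1r [S y + _]addrC subrK.
  by rewrite addrK.
Qed.

Local Notation fcalc := (fcalc S S' K).

(** The symbol [l^n exp (t l)]; for [t > 0] its value at [z = 0] is its limit at infinity in the
    region. *)
Let fex (n : nat) (t : R) (z : R[i]) : R[i] :=
  if z == 0 then 0 else (mu - z^-1) ^+ n * cexp (t%:C * (mu - z^-1)).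

Let Ret (t : R) (l : R[i]) : complex.Re (t%:C * l) = t * complex.Re l.
Proof. by case: l => x y /=; rewrite mul0r subr0. Qed.

Let nX (z : R[i]) k : normc (z ^+ k) = normc z ^+ k.
Proof. by elim: k => [|k IH]; rewrite ?expr0 ?normc1// !exprS normcM IH. Qed.

Let fex_bound (c d : R) : 0 < c -> c <= d -> exists al M : R,
  [/\ 0 < al, 0 < M & forall n s z, c <= s <= d -> K z ->
    normc (fex n s z) <= M * al ^+ n * n`!%:R `^ beta].
Proof.
move=> c0 cd; have [al [M [al0 M0 h]]] := region_gevrey a0 b0 beta1 c0 cd.
exists al, M; split=> // n s z cs; rewrite /fex => -[->|[z0 rz]].
  by rewrite eqxx normc0 mulr_ge0 ?powR_ge0// mulr_ge0 ?exprn_ge0 ?(ltW M0) ?(ltW al0).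
by rewrite (negPf z0) normcM nX normc_cexp Ret h.
Qed.

(** The Taylor remainder contributes a factor [l^2], absorbed by the Gevrey bound of order [n + 2].
    The estimate serves twice: to obtain [fex n.+1 t] as a uniform limit and to differentiate the
    orbits. *)
Let fex_deriv n (t : R) : 0 < t -> exists C : R, 0 < C /\
  forall h z, h != 0 -> `|h| <= t / 2 -> K z ->
  normc ((h^-1)%:C * (fex n (t + h) z - fex n t z) - fex n.+1 t z) <= C * `|h|.
Proof.
move=> t0; have c0 : 0 < t / 2 by rewrite divr_gt0.
have cd : t / 2 <= 2 * t by lra.
have [al [M [al0 M0 hM]]] := region_gevrey a0 b0 beta1 c0 cd.
(* [B] bounds [|l|^(n+2) exp (s Re l)] at both [s = t] and [s = t + h], which lie in [[t / 2, 2 t]];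
   hence the constant [16 B = 8 (B + B)]. *)
pose B := M * al ^+ n.+2 * n.+2`!%:R `^ beta.
have B0 : 0 < B.
  by rewrite /B mulr_gt0 ?powR_gt0 ?ltr0n ?fact_gt0// mulr_gt0 ?exprn_gt0.
exists (16 * B); split=> [|h z h0 ht Kz]; first by rewrite mulr_gt0.
rewrite /fex; case: Kz => [->|[z0 rz]].
  rewrite eqxx subrr mulr0 subrr normc0 mulr_ge0// ltW//; lra.
rewrite (negPf z0); set l := mu - z^-1 in rz *.
have th1 : t / 2 <= t <= 2 * t by lra.
have th2 : t / 2 <= t + h <= 2 * t.
  by move: ht; rewrite ler_norml => /andP[]; lra.
have hC : (h^-1)%:C * h%:C = 1 :> R[i] by rewrite -rmorphM /= mulVf.
have -> : (h^-1)%:C * (l ^+ n * cexp ((t + h)%:C * l) - l ^+ n * cexp (t%:C * l)) -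
   l ^+ n.+1 * cexp (t%:C * l) =
   (h^-1)%:C * (l ^+ n * cexp (t%:C * l) * (cexp (h%:C * l) - 1 - h%:C * l)).
  have -> : (t + h)%:C * l = t%:C * l + h%:C * l by rewrite rmorphD mulrDl.
  have -> : l ^+ n.+1 = (h^-1)%:C * h%:C * (l ^+ n * l) by rewrite hC mul1r exprSr.
  rewrite cexpD; ring.
rewrite normcM normcM normcM normcR nX normc_cexp Ret.
have := cexp_taylor (h%:C * l); rewrite normcM normcR Ret => ht'.
have E1 := expR_ge0 (t * complex.Re l).
have h1 := hM n.+2 _ l th1 rz; have := hM n.+2 _ l th2 rz.
rewrite mulrDl expRD -/B in h1 *; move=> h2.
have hn0 : 0 < `|h| by rewrite normr_gt0.
have P0 : 0 <= normc l ^+ n * expR (t * complex.Re l).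
  by rewrite mulr_ge0 ?exprn_ge0 ?normc_ge0.
rewrite normfV mulrC ler_pdivrMr//.
apply: (le_trans (ler_wpM2l P0 ht')).
rewrite !exprS in h1 h2.
move: (normc l) (expR (t * _)) (expR (h * _)) `|h| h1 h2 => q u v k h1 h2.
have -> : q ^+ n * u * (8 * (k * q) ^+ 2 * (1 + v)) =
  8 * k ^+ 2 * (q * (q * q ^+ n) * u + q * (q * q ^+ n) * (u * v)) by ring.
have -> : 16 * B * k * k = 8 * k ^+ 2 * (B + B) by ring.
by rewrite ler_wpM2l// ?lerD// mulr_ge0 ?sqr_ge0.
Qed.

Let fcalc_fex0 t : 0 < t -> exists N, fcalc (fex 0 t) N.
Proof.
move=> t0; apply: (fcalc_lim hdot bS bS' aS nS K0 resS) => e e0.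
have [n [ca happ]] := region_approx a0 b0 beta1 t0 e0.
set c := t / n.+1%:R in ca happ; have c0 : 0 < c by rewrite divr_gt0.
(* Since [(1 - c mu) z + c = z (1 - c l)], the fraction [p / q] is [(1 - c l)^-(n+1)], and it
   vanishes at [z = 0]. *)
pose p : {poly R[i]} := 'X ^+ n.+1.
pose q : {poly R[i]} := ((1 - c%:C * mu)%:P * 'X + (c%:C)%:P) ^+ n.+1.
have pE z : p.[z] = z ^+ n.+1 by rewrite /p hornerXn.
have qE0 : q.[0] = c%:C ^+ n.+1.
  by rewrite /q horner_exp !hornerE.
have qE z : z != 0 -> q.[z] = (z * (1 - c%:C * (mu - z^-1))) ^+ n.+1.
  move=> z0; rewrite /q horner_exp !hornerE; congr (_ ^+ _).
  by rewrite !mulrBr mulr1 mulrCA [z * (_ * z^-1)]mulrCA mulfV//; ring.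
have cz0 z : z != 0 -> K z -> 2^-1 <= normc (1 - c%:C * (mu - z^-1)).
  move=> z0 [/eqP|[_ rz]]; first by rewrite (negPf z0).
  by have [] := norm_one_sub (ltW c0) (region_Re b0 rz) ca.
have c00 : c%:C != 0 :> R[i] by rewrite -(rmorph0 (real_complex R)) (inj_eq (@complexI R)) gt_eqF.
have nz z : z != 0 -> K z -> 1 - c%:C * (mu - z^-1) != 0.
  move=> z0 Kz; apply/eqP => E; have := cz0 z z0 Kz; rewrite E normc0; lra.
have hq : noroot K q.
  move=> z Kz; have [->|z0] := eqVneq z 0; first by rewrite qE0 expf_neq0.
  by rewrite qE// expf_neq0// mulf_neq0// nz.
have pq z : z != 0 -> K z -> p.[z] / q.[z] = (1 - c%:C * (mu - z^-1))^-1 ^+ n.+1.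
  move=> z0 Kz; rewrite pE qE// exprMn invfM mulrA mulfV ?expf_neq0// mul1r exprVn//.
have pq0 : p.[0] / q.[0] = 0 by rewrite pE expr0n mul0r.
have [|N hN] := fcalc_rat S' bS K0 resS (p := p) (M := 2 ^+ n.+1) hq.
  move=> z Kz; have [->|z0] := eqVneq z 0.
    by rewrite pq0 normc0 exprn_ge0.
  rewrite pq// nX lerXn2r ?nnegrE ?normc_ge0// normcV -[2]invrK lef_pV2 ?posrE ?invr_gt0// ?cz0//.
  by have := cz0 z z0 Kz; lra.
exists (fun z => p.[z] / q.[z]), N; split=> // z Kz; rewrite /fex.
have [->|z0] := eqVneq z 0; first by rewrite pq0 subrr normc0 ltW.
rewrite pq// expr0 mul1r; apply: happ.
by case: Kz => [/eqP|[]//]; rewrite (negPf z0).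
Qed.

Let fcalc_fex n t : 0 < t -> exists N, fcalc (fex n t) N.
Proof.
elim: n t => [|n IH] t t0; first exact: fcalc_fex0.
apply: (fcalc_lim hdot bS bS' aS nS K0 resS) => e e0.
have [C [C0 hC]] := fex_deriv n t0.
pose h := Num.min (t / 2) (e / C).
have h0 : 0 < h by rewrite lt_min !divr_gt0.
have [L hL] := IH t t0; have [L' hL'] := IH (t + h) (addr_gt0 t0 h0).
exists (fun z => (h^-1)%:C * (fex n (t + h) z - fex n t z)),
  (fun x => (h^-1)%:C *: (L' x - L x)); split.
  exact: (fcalc_scale bS (h^-1)%:C (fcalc_sub bS hL' hL)).
move=> z Kz; rewrite -normcN opprB; apply: (le_trans (hC h z _ _ Kz)).
- by rewrite gt_eqF.
- by rewrite gtr0_norm// /h ge_min lexx.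
- by rewrite gtr0_norm// mulrC -ler_pdivlMr// /h ge_min lexx orbT.
Qed.

(** [A^n exp (t A)] for [t > 0]. The default [id] gives [T 0] its correct value. *)
Let E n t : X -> X :=
  if pselect (0 < t) is left t0 then projT1 (cid (fcalc_fex n t0)) else id.

Let EP n t : 0 < t -> fcalc (fex n t) (E n t).
Proof. by move=> t0; rewrite /E; case: pselect => // t0'; case: cid. Qed.

Let bE n t : bop (E n t).
Proof.
rewrite /E; case: pselect => [t0|_]; last exact: bop_id.
by case: cid => N [[]].
Qed.

Let T (t : R) : {linear X -> X} := mklin (bE 0 t).1.

Let T_pos t : 0 < t -> fcalc (fex 0 t) (T t).
Proof. exact: EP. Qed.

Let T_0 t : t <= 0 -> forall x, T t x = x.
Proof.
move=> t0 x; rewrite /T /= /E; case: pselect => // t1.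
by exfalso; move: t1; rewrite ltNge t0.
Qed.

Let T_add s t : 0 <= s -> 0 <= t -> forall x, T (s + t) x = T s (T t x).
Proof.
rewrite [0 <= s]le_eqVlt => /orP[/eqP <- _ x|s0].
  by rewrite add0r [RHS]T_0.
rewrite le_eqVlt => /orP[/eqP <- x|t0 x]; first by rewrite addr0 [T 0 x]T_0.
have h := fcalc_mul hdot bS bS' aS nS K0 resS (T_pos s0) (T_pos t0).
have {}h : fcalc (fex 0 (s + t)) (T s \o T t).
  apply: fcalc_ext h => z _; rewrite /fex; case: eqP => _; first by rewrite mul0r.
  by rewrite !expr0 !mul1r -cexpD -mulrDl -rmorphD.
exact: (fcalc_uniq hdot bS bS' aS nS K0 resS (T_pos (addr_gt0 s0 t0)) h x).
Qed.

Let T_commS t x : T t (S x) = S (T t x).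
Proof.
have [t0|t0] := ltP 0 t; last by rewrite !T_0.
have [cT _ _] := T_pos t0.
exact: (bicomm_comm bS bS' nS cT (bicomm_S S' bS)).
Qed.

Let T_bound t x : 0 < t -> t <= 1 -> nr (T t x) <= expR a * nr x.
Proof.
move=> t0 t1; apply: (fcalc_le hdot bS bS' aS nS K0 resS (T_pos t0)).
  exact: expR_ge0.
move=> z Kz; rewrite /fex; case: Kz => [->|[z0 rz]].
  by rewrite eqxx normc0 expR_ge0.
rewrite (negPf z0) expr0 mul1r normc_cexp Ret ler_expR.
have := region_Re b0 rz; have a0' := a0; nra.
Qed.

(** Difference quotients on the range of [S]: their symbol [(exp (h l) - 1) / h * z] is bounded
    uniformly in [h], because [l z] is bounded. *)
Let G (h : R) (x : X) := (h^-1)%:C *: (T h (S x) - S x).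

Let fcalc_G h : 0 < h -> fcalc (fun z => (h^-1)%:C * (fex 0 h z - 1) * z) (G h).
Proof.
move=> h0.
have h1 := fcalc_scale bS (h^-1)%:C (fcalc_sub bS (T_pos h0) (fcalc_one S S' K)).
exact: (fcalc_mul hdot bS bS' aS nS K0 resS h1 (fcalc_S S' bS K_le1)).
Qed.

Let G_bound h x : 0 < h -> h <= 1 -> nr (G h x) <= 5 * (a + 2) * (1 + expR a) * nr x.
Proof.
have a0' := a0.
have p0 : 0 <= 5 * (a + 2) * (1 + expR a) by rewrite !mulr_ge0 ?addr_ge0 ?expR_ge0//; lra.
move=> h0 h1; apply: (fcalc_le hdot bS bS' aS nS K0 resS (fcalc_G h0)) => // z Kz.
rewrite /fex; have [->|z0] := eqVneq z 0; first by rewrite mulr0 normc0.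
have rz : region a b beta (mu - z^-1) by case: Kz => [/eqP|[]//]; rewrite (negPf z0).
have lz : (mu - z^-1) * z = mu * z - 1 by rewrite mulrBl mulVf.
rewrite expr0 mul1r; have := K_lam Kz; rewrite -lz.
have xa := region_Re b0 rz; set l := mu - z^-1 in lz xa *.
rewrite !normcM normcR normfV (gtr0_norm h0) => h2.
have := cexp_lip (h%:C * l); rewrite normcM normcR (gtr0_norm h0) Ret => h3.
have h4 : expR (h * complex.Re l) <= expR a by rewrite ler_expR; nra.
have z1 := normc_ge0 z; have l1 := normc_ge0 l; have e1 := expR_ge0 (h * complex.Re l).
rewrite -mulrA ler_pdivrMl//.
apply: (le_trans (ler_wpM2r z1 h3)).
have -> : 5 * (h * normc l) * (1 + expR (h * complex.Re l)) * normc z =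
  h * (5 * (normc l * normc z) * (1 + expR (h * complex.Re l))) by ring.
rewrite ler_wpM2l ?(ltW h0)// ler_pM ?mulr_ge0 ?addr_ge0//.
  by rewrite ler_wpM2l.
by rewrite lerD2l.
Qed.

(** A second factor [S] absorbs the [l^2] of the Taylor remainder and leaves a rate of order [h]. *)
Let G_limS h x : 0 < h -> h <= 1 ->
  nr (G h (S x) - (mu *: S (S x) - S x)) <= 8 * (a + 2) ^+ 2 * (1 + expR a) * h * nr x.
Proof.
have a0' := a0 => h0 h1.
have p0 : 0 <= 8 * (a + 2) ^+ 2 * (1 + expR a) * h.
  by rewrite !mulr_ge0 ?sqr_ge0 ?addr_ge0 ?expR_ge0 ?(ltW h0).
have fS := fcalc_S S' bS K_le1.
have f1 := fcalc_sub bS (fcalc_scale bS mu fS) (fcalc_one S S' K).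
have f2 := fcalc_mul hdot bS bS' aS nS K0 resS (fcalc_sub bS (fcalc_G h0) f1) fS.
apply: (fcalc_le hdot bS bS' aS nS K0 resS f2) => // z Kz.
rewrite /fex; have [->|z0] := eqVneq z 0; first by rewrite mulr0 normc0.
have rz : region a b beta (mu - z^-1) by case: Kz => [/eqP|[]//]; rewrite (negPf z0).
have lz : (mu - z^-1) * z = mu * z - 1 by rewrite mulrBl mulVf.
rewrite expr0 mul1r; have := K_lam Kz; rewrite -lz.
have xa := region_Re b0 rz; set l := mu - z^-1 in lz xa *.
have hC : (h^-1)%:C * h%:C = 1 :> R[i] by rewrite -rmorphM /= mulVf ?gt_eqF.
have -> : ((h^-1)%:C * (cexp (h%:C * l) - 1) * z - l * z) * z =
  (h^-1)%:C * ((cexp (h%:C * l) - 1 - h%:C * l) * z ^+ 2).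
  have -> : l * z = (h^-1)%:C * h%:C * (l * z) by rewrite hC mul1r.
  ring.
move=> h2; rewrite normcM in h2.
rewrite normcM normcM nX normcR normfV (gtr0_norm h0).
have := cexp_taylor (h%:C * l); rewrite normcM normcR (gtr0_norm h0) Ret => h3.
have h4 : expR (h * complex.Re l) <= expR a by rewrite ler_expR; nra.
have z1 := normc_ge0 z; have l1 := normc_ge0 l; have e1 := expR_ge0 (h * complex.Re l).
rewrite ler_pdivrMl//.
apply: (le_trans (ler_wpM2r (sqr_ge0 _) h3)).
have -> : 8 * (h * normc l) ^+ 2 * (1 + expR (h * complex.Re l)) * normc z ^+ 2 =
  h ^+ 2 * (8 * (normc l * normc z) ^+ 2 * (1 + expR (h * complex.Re l))) by ring.
have -> : h * (8 * (a + 2) ^+ 2 * (1 + expR a) * h) =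
  h ^+ 2 * (8 * (a + 2) ^+ 2 * (1 + expR a)) by ring.
rewrite ler_wpM2l ?sqr_ge0// ler_pM ?mulr_ge0 ?sqr_ge0 ?addr_ge0//.
  by rewrite ler_wpM2l// lerXn2r ?nnegrE ?mulr_ge0//; lra.
by rewrite lerD2l.
Qed.

Let G_bound_ex : exists C : R, 0 < C /\ forall h x, 0 < h -> h <= 1 ->
  nr (G h x) <= C * nr x.
Proof.
exists (5 * (a + 2) * (1 + expR a)); split; last exact: G_bound.
have a0' := a0; have a2 : 0 < a + 2 by lra.
have ea : 0 < 1 + expR a by rewrite addr_gt0 ?expR_gt0.
by rewrite !mulr_gt0.
Qed.

Let G_limS_ex : exists C : R, 0 < C /\ forall h x, 0 < h -> h <= 1 ->
  nr (G h (S x) - (mu *: S (S x) - S x)) <= C * h * nr x.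
Proof.
exists (8 * (a + 2) ^+ 2 * (1 + expR a)); split; last exact: G_limS.
have a0' := a0; have a2 : 0 < a + 2 by lra.
have ea : 0 < 1 + expR a by rewrite addr_gt0 ?expR_gt0.
by rewrite mulr_gt0// mulr_gt0 ?exprn_gt0.
Qed.

Let dA : dense D. Proof. by case: hA. Qed.

Let dS x (e : R) : 0 < e -> exists y, nr (S y - x) < e.
Proof.
move=> e0; have [v [Dv vx]] := dense_nr dA x e0.
by exists (mu *: v - A v); rewrite S2.
Qed.

(** The limit is [A (S x)]. [G_limS] gives convergence on the dense range of [S], and the uniform
    bound on [G h] extends it. *)
Let G_lim x : G h x @[h --> 0^'+] --> mu *: S x - x.
Proof.
apply/cvg_at_right0 => e e0.
have [M [M0 hM]] := bop_pos (bop_add (bop_scale mu bS) (bop_scale (-1) (bop_id X))).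
have [C1 [C1p hC1]] := G_bound_ex; have [C2 [C2p hC2]] := G_limS_ex.
have d0 : 0 < e / (3 * (C1 + M)) by rewrite divr_gt0// mulr_gt0// addr_gt0.
have [y hy] := dS x d0.
have ny : 0 < nr y + 1 by rewrite ltr_wpDl ?nr_ge0.
exists (Num.min 1 (e / (3 * (C2 * (nr y + 1))))); split.
  by rewrite lt_min ltr01 divr_gt0// !mulr_gt0.
move=> h h0; rewrite lt_min => /andP[/ltW h1 h2].
have p1 : 0 < 3 * (C1 + M) by rewrite mulr_gt0// addr_gt0.
have p2 : 0 < 3 * (C2 * (nr y + 1)) by rewrite mulr_gt0// mulr_gt0.
move: hy h2; rewrite (ltr_pdivlMr _ _ p1) (ltr_pdivlMr _ _ p2) => hy h2.
have g1 := hC1 h (S y - x) h0 h1; have g2 := hC2 h y h0 h1.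
have g3 := hM (S y - x).
have GB u v : G h (u - v) = G h u - G h v.
  rewrite /G (linB bS.1) [T h (_ - _)]linearB -scalerBr; congr (_ *: _).
  by rewrite !opprB addrACA [RHS]addrACA; congr (_ + _); rewrite addrC.
rewrite GB in g1; rewrite /= (linB bS.1) in g3.
have t1 := nr_tri (G h (S y)) (G h x) (mu *: S x - x).
have t2 := nr_tri (mu *: S (S y) - S y) (G h (S y)) (mu *: S x - x).
have E3 : mu *: S (S y) - S y - (mu *: S x - x) = mu *: (S (S y) - S x) + -1 *: (S y - x).
  by rewrite scaleN1r scalerBr !opprB addrACA [RHS]addrACA; congr (_ + _); rewrite addrC.
rewrite E3 in t2; rewrite (nrBC (G h x) (G h (S y))) in t1.
have hny : C2 * h * nr y <= C2 * h * (nr y + 1) by rewrite ler_wpM2l ?lerDl// mulr_ge0 ?(ltW C2p) ?(ltW h0).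
move: (nr_ge0 (S y - x)) C1p C2p => n0 c1 c2; nra.
Qed.

Let T_cont0 x : T t x @[t --> 0^'+] --> x.
Proof.
apply/cvg_at_right0 => e e0.
have [C1 [C1p hC1]] := G_bound_ex.
have ep : 0 < expR a + 1 by rewrite ltr_wpDl ?expR_ge0.
have d0 : 0 < e / (2 * (expR a + 1)) by rewrite divr_gt0// mulr_gt0.
have [y hy] := dS x d0.
have ny : 0 < nr y + 1 by rewrite ltr_wpDl ?nr_ge0.
exists (Num.min 1 (e / (2 * (C1 * (nr y + 1))))); split.
  by rewrite lt_min ltr01 divr_gt0// !mulr_gt0.
move=> h h0; rewrite lt_min => /andP[/ltW h1 h2].
have p1 : 0 < 2 * (expR a + 1) by rewrite mulr_gt0.
have p2 : 0 < 2 * (C1 * (nr y + 1)) by rewrite mulr_gt0// mulr_gt0.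
move: hy h2; rewrite (ltr_pdivlMr _ _ p1) (ltr_pdivlMr _ _ p2) => hy h2.
have g1 := hC1 h y h0 h1.
have g2 := T_bound (S y - x) h0 h1; rewrite [T h (_ - _)]linearB in g2.
have g3 : nr (T h (S y) - S y) = h * nr (G h y).
  rewrite /G nrZR gtr0_norm ?invr_gt0// mulrA mulfV ?gt_eqF// mul1r //.
have t1 := nr_tri (T h (S y)) (T h x) x.
have t2 := nr_tri (S y) (T h (S y)) x.
rewrite (nrBC (T h x) (T h (S y))) in t1.
have hny : C1 * nr y <= C1 * (nr y + 1) by rewrite ler_wpM2l ?lerDl// ltW.
have g4 : h * nr (G h y) <= h * (C1 * (nr y + 1)) by rewrite ler_wpM2l ?(ltW h0)// (le_trans g1).
move: (nr_ge0 (S y - x)) => n0; nra.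
Qed.

(** [G_lim] at [mu x - A x] shows that the generator extends [A]. Conversely, applying [S] to
    quotients converging to [l] gives [S l = mu S x - x], so that [x = S (mu x - l)] lies in [D]. *)
Let T_gen : op_eq A (semigroup_generator T).
Proof.
have AG x : D x -> (h^-1)%:C *: (T h x - x) @[h --> 0^'+] --> A x.
  move=> Dx; have := @G_lim (mu *: x - A x); rewrite /G (S2 Dx).
  by rewrite opprB addrC subrK.
split; last by move=> x /AG /(cvg_lim (@norm_hausdorff _ X)) /= ->.
apply/seteqP; split=> [x /AG h|x]; first by apply/cvg_ex; exists (A x).
move=> /cvg_ex[l hl].
have : S l = mu *: S x - x.
  have h1 : S ((h^-1)%:C *: (T h x - x)) @[h --> 0^'+] --> S l.
    apply: continuous_cvg => //; have : bop S0 by [].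
    by move=> /bop_cont; exact.
  have h2 := @G_lim x.
  apply: (cvg_unique (@norm_hausdorff _ X) _ h2).
  have : (fun h => S ((h^-1)%:C *: (T h x - x))) = G^~ x.
    by apply/funext => h; rewrite /G (linZ bS.1) (linB bS.1) T_commS.
  by move=> <-.
move=> h; have -> : x = S (mu *: x - l).
  by rewrite (linB bS.1) (linZ bS.1) h opprB addrC subrK.
by have [] := S1 (mu *: x - l).
Qed.

Let T_normal t : 0 <= t -> normal_op dot (Operator setT (T t)).
Proof.
move=> t0; set B := Operator _ _.
have bT : bop (T t) by exact: bE.
have [T' [bT' aT cT]] : exists T', [/\ bop T', is_adj dot (T t) T' & commutes (T t) T'].
  have [t1|t1] := ltP 0 t.
    by have [cT _ _] := T_pos t1; exact: (bicomm_normal hdot bS bS' aS nS cT).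
  by exists id; split=> [|x y|x]; [exact: bop_id|rewrite T_0|].
have lB : linear_op B by split=> // c x y _ _; split=> //; exact: bT.1.
have dB : dense (op_dom B).
  by move=> O [x Ox] _; exists x.
split=> //.
  rewrite /closed_op; have -> : [set p : X * X | op_dom B p.1 /\ p.2 = B p.1] =
      (fun p : X * X => p.2 - T t p.1) @^-1` [set 0].
    apply/seteqP; split=> [p [_ /= ->]|p /= /eqP]; first by rewrite subrr.
    by rewrite subr_eq0 => /eqP.
  apply: closed_comp => [p _|]; last first.
    by apply: accessible_closed_set1; exact/hausdorff_accessible/norm_hausdorff.
  have cTt : continuous (T t) by exact/bop_cont.
  apply: cvgB; first exact: cvg_snd.
  by apply: (continuous_comp (f := fst) (g := T t)); [exact: cvg_fst|exact: cTt].
have adjB y : op_dom (adjoint dot B) y /\ adjoint dot B y = T' y.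
  by apply: (adjoint_in hdot lB dB) => x _; exact: aT.
split=> [|x _].
  apply/seteqP; split=> x _.
    by split=> //; exact: (adjB x).1.
  by split=> //; exact: (adjB _).1.
rewrite -[LHS]/(adjoint dot B (T t x)) -[RHS]/(T t (adjoint dot B x)).
by rewrite !(adjB _).2 cT.
Qed.

Let E_diff n t x (h C : R) : 0 < t -> h != 0 -> `|h| <= t / 2 -> 0 <= C ->
  (forall z, K z ->
    normc ((h^-1)%:C * (fex n (t + h) z - fex n t z) - fex n.+1 t z) <= C * `|h|) ->
  nr (rdiffq (fun s => E n s x) t h - E n.+1 t x) <= C * `|h| * nr x.
Proof.
move=> t0 h0 ht C0 hC; have th : 0 < t + h.
  by move: ht; rewrite ler_norml => /andP[]; lra.
have f1 := fcalc_sub bS (fcalc_scale bS (h^-1)%:C (fcalc_sub bS (EP n th) (EP n t0))) (EP n.+1 t0).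
by apply: (fcalc_le hdot bS bS' aS nS K0 resS f1) => //; rewrite mulr_ge0.
Qed.

(** Both claims go through one induction: identifying a derivative on the whole half-line allows its
    difference quotients at [t] to be rewritten in terms of [E]. *)
Let T_deriv n x t : 0 < t ->
  rdiffq (rderiven n (fun t => T t x)) t h @[h --> 0^'] --> E n.+1 t x /\
  rderiven n (fun t => T t x) t = E n t x.
Proof.
elim: n t => [|n IH] t t0.
  split=> //; have [C [C0 hC]] := fex_deriv 0 t0.
  apply: cvg_dnbhs0 => e e0.
  have nx : 0 < C * (nr x + 1) by rewrite mulr_gt0// ltr_wpDl ?nr_ge0.
  exists (Num.min (t / 2) (e / (C * (nr x + 1)))); split.
    by rewrite lt_min !divr_gt0.
  move=> h h0; rewrite lt_min => /andP[/ltW h1 h2].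
  have := E_diff (n := 0) x t0 h0 h1 (ltW C0) (fun z => hC h z h0 h1).
  rewrite ltr_pdivlMr// in h2; move=> /le_lt_trans; apply.
  apply: le_lt_trans h2; rewrite mulrAC mulrC ler_wpM2l// ler_wpM2l ?(ltW C0)//; lra.
have der s : 0 < s -> rderiven n.+1 (fun t => T t x) s = E n.+1 s x.
  move=> s0; rewrite /rderiven iterS /rderive.
  by have [h _] := IH s s0; exact: (cvg_lim (@norm_hausdorff _ X) h).
split; last exact: der.
have [C [C0 hC]] := fex_deriv n.+1 t0.
apply: cvg_dnbhs0 => e e0.
have nx : 0 < C * (nr x + 1) by rewrite mulr_gt0// ltr_wpDl ?nr_ge0.
exists (Num.min (t / 2) (e / (C * (nr x + 1)))); split.
  by rewrite lt_min !divr_gt0.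
move=> h h0; rewrite lt_min => /andP[/ltW h1 h2].
have th : 0 < t + h by move: h1; rewrite ler_norml => /andP[]; lra.
have := E_diff (n := n.+1) x t0 h0 h1 (ltW C0) (fun z => hC h z h0 h1).
have -> : rdiffq (fun s => E n.+1 s x) t h = rdiffq (rderiven n.+1 (fun t => T t x)) t h.
  by rewrite /rdiffq !der.
rewrite ltr_pdivlMr// in h2; move=> /le_lt_trans; apply.
apply: le_lt_trans h2; rewrite mulrAC mulrC ler_wpM2l// ler_wpM2l ?(ltW C0)//; lra.
Qed.

Let T_gevrey : roumieu_gevrey beta T.
Proof.
move=> f g; split=> [n t t0|c d c0 cd].
  by apply/cvg_ex; exists (E n.+1 t f); have [] := T_deriv n f t0.
have [al [M [al0 M0 hM]]] := fex_bound c0 cd.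
have nf : 0 < nr f + 1 by rewrite ltr_wpDl ?nr_ge0.
(* The summand [1] keeps the constant positive when [f = 0]. *)
exists al, (M * (nr f + 1)); split=> //; first by rewrite mulr_gt0.
move=> n t ct; have t0 : 0 < t by case/andP: ct => /(lt_le_trans c0).
have [_ ->] := T_deriv n f t0.
rewrite nrE lecR; have B0 : 0 <= M * al ^+ n * n`!%:R `^ beta.
  by rewrite mulr_ge0 ?powR_ge0// mulr_ge0 ?exprn_ge0 ?(ltW M0) ?(ltW al0).
apply: (le_trans (fcalc_le hdot bS bS' aS nS K0 resS (EP n t0) B0 _ f)).
  by move=> z Kz; exact: hM.
have -> : M * (nr f + 1) * al ^+ n * n`!%:R `^ beta = (M * al ^+ n * n`!%:R `^ beta) * (nr f + 1).
  by ring.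
by rewrite ler_wpM2l// lerDl.
Qed.

Lemma region_generates : exists T : R -> {linear X -> X},
  [/\ generates A T,
      forall t : R, 0 <= t -> normal_op dot (Operator setT (T t)) &
      roumieu_gevrey beta T].
Proof.
exists T; split; [split; last exact: T_gen|exact: T_normal|exact: T_gevrey].
split.
- by move=> t _; apply/bop_cont; exact: bE.
- by move=> x; rewrite T_0.
- exact: T_add.
- exact: T_cont0.
Qed.

End Generation.

(** * Necessity of the spectral condition *)

Section UniformBoundedness.
Variables (R : realType) (X : completeNormedModType R[i]).

(** The sets [P m] are closed. If none contained a ball, one could choose nested closed balls, the
    [m]-th step avoiding [P m]; the limit of their centres would belong to no [P m]. *)
Lemma baire_nr (P : nat -> X -> Prop) :
  (forall m x, ~ P m x -> exists r : R, 0 < r /\ forall y, nr (y - x) < r -> ~ P m y) ->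
  (forall x, exists m, P m x) ->
  exists m x0 (r : R), 0 < r /\ forall y, nr (y - x0) < r -> P m y.
Proof.
move=> Pcl Pall; apply: contrapT => H.
(* Positivity of the radius is a premise, so that a total choice function exists; it is maintained
   along the sequence afterwards. *)
have step (p : nat * (X * R)) : exists q : X * R, 0 < p.2.2 ->
    [/\ 0 < q.2, q.2 <= p.1.+1%:R^-1, forall z, nr (z - q.1) <= q.2 -> nr (z - p.2.1) <= p.2.2 &
      forall z, nr (z - q.1) <= q.2 -> ~ P p.1 z].
  case: p => m [x r] /=; have [r0|] := boolP (0 < r); last by exists (x, r).
  have [y [yx nPy]] : exists y, nr (y - x) < r /\ ~ P m y.
    apply: contrapT => H'; apply: H; exists m, x, r; split=> // y yx.
    by apply: contrapT => nP; apply: H'; exists y.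
  have [s [s0 hs]] := Pcl m y nPy.
  have rd : 0 < r - nr (y - x) by rewrite subr_gt0.
  exists (y, Num.min (s / 2) (Num.min (r - nr (y - x)) m.+1%:R^-1)) => _ /=; split.
  - by rewrite !lt_min rd invr_gt0 ltr0n divr_gt0.
  - by rewrite !ge_min lexx !orbT.
  - move=> z; rewrite !le_min => /and3P[_ h _].
    by have := nr_tri y z x; lra.
  - by move=> z; rewrite !le_min => /and3P[h _ _]; apply: hs; lra.
have /choice[f hf] := step.
pose fix s n := if n is p.+1 then f (p, s p) else ((0 : X), (1 : R)).
have s_gt0 n : 0 < (s n).2 by elim: n => [|n IH] //=; have [] := hf (n, s n) IH.
have sS n : [/\ (s n.+1).2 <= n.+1%:R^-1,
    forall z, nr (z - (s n.+1).1) <= (s n.+1).2 -> nr (z - (s n).1) <= (s n).2 &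
    forall z, nr (z - (s n.+1).1) <= (s n.+1).2 -> ~ P n z].
  by have [] := hf (n, s n) (s_gt0 n).
have nest n k z : nr (z - (s (k + n)%N).1) <= (s (k + n)%N).2 -> nr (z - (s n).1) <= (s n).2.
  by elim: k => // k IH h; apply: IH; have [_ + _] := sS (k + n)%N; apply.
have nest' n m : (n <= m)%N -> nr ((s m).1 - (s n).1) <= (s n).2.
  by move=> nm; apply: (nest n (m - n)%N); rewrite subnK// subrr nr0 ltW.
have [|l hl] := @cvs_complete _ _ (fun n => (s n).1).
  move=> e e0; have e2 : 0 < e / 2 by rewrite divr_gt0.
  have [N HN] := inv_small e2; exists N.+1 => m n Nm Nn.
  have h1 := nest' _ _ Nm; have h2 := nest' _ _ Nn; have [h3 _ _] := sS N.
  have h4 := HN N (leqnn N); have := nr_tri (s N.+1).1 (s m).1 (s n).1.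
  rewrite (nrBC (s N.+1).1); move: h1 h2 h3 h4; move: (N.+1%:R^-1) => i; lra.
have lin n : nr (l - (s n).1) <= (s n).2.
  apply: (@le_eps _ _ _ 1) => e e0; have [N HN] := hl e e0.
  have /HN h1 : (N <= maxn N n)%N by rewrite leq_maxl.
  have h2 := nest' n (maxn N n) (leq_maxr _ _).
  have := nr_tri (s (maxn N n)).1 l (s n).1; rewrite (nrBC l (s (maxn N n)).1); lra.
have [m Pm] := Pall l; have [_ _ h] := sS m.
exact: h (lin m.+1) Pm.
Qed.

(** Banach-Steinhaus with bounds that depend on the index [i]: it makes both Gevrey constants
    uniform at once, as [m] can encode the pair. *)
Lemma uniform_weights (I : Type) (Q : I -> Prop) (F : I -> X -> X) (W : nat -> I -> R) :
  (forall i, Q i -> bop (F i)) ->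
  (forall x, exists m, forall i, Q i -> nr (F i x) <= W m i) ->
  exists m (M : R), 0 < M /\ forall i x, Q i -> nr (F i x) <= M * W m i * nr x.
Proof.
move=> bF hW.
have [|//|m [x0 [r [r0 hP]]]] :=
    @baire_nr (fun m x => forall i, Q i -> nr (F i x) <= W m i).
  move=> m x /existsNP[i /not_implyP[Qi /negP]]; rewrite -ltNge => h.
  have [M [M0 hM]] := bop_pos (bF i Qi).
  exists ((nr (F i x) - W m i) / M); split; first by rewrite divr_gt0// subr_gt0.
  move=> y; rewrite ltr_pdivlMr// => hy /(_ i Qi).
  have := hM (y - x); rewrite (linB (bF i Qi).1).
  by have := nr_subl (F i x) (F i y); rewrite (nrBC (F i x)); lra.
exists m, (4 / r); split; first by rewrite divr_gt0.
move=> i y Qi; have [->|y0] := eqVneq y 0.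
  by rewrite (lin0 (bF i Qi).1) nr0 mulr0.
(* [x0 + t y] stays in the ball, so [t |F i y|] is at most twice the weight. *)
have ny := nr_gt0 y0; pose t := r / (2 * nr y).
have t0 : 0 < t by rewrite divr_gt0// mulr_gt0.
have h1 : nr (F i x0) <= W m i by apply: hP => //; rewrite subrr nr0.
have h2 : nr (F i (t%:C *: y + x0)) <= W m i.
  apply: hP => //; rewrite addrK nrZR gtr0_norm// /t.
  have -> : r / (2 * nr y) * nr y = r / 2 by field; rewrite gt_eqF.
  lra.
have h3 : t * nr (F i y) <= 2 * W m i.
  have := nr_subl (F i (t%:C *: y)) (- F i x0); rewrite opprK -(linD (bF i Qi).1) nrN.
  rewrite {1}(linZ (bF i Qi).1) nrZR gtr0_norm//; lra.
rewrite -(ler_pM2l t0) (le_trans h3)//.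
have -> : t * (4 / r * W m i * nr y) = 2 * W m i.
  by rewrite /t; field; rewrite !gt_eqF.
exact: lexx.
Qed.

Lemma uniform_bound (I : Type) (Q : I -> Prop) (F : I -> X -> X) :
  (forall i, Q i -> bop (F i)) ->
  (forall x, exists M : R, forall i, Q i -> nr (F i x) <= M) ->
  exists M : R, 0 < M /\ forall i x, Q i -> nr (F i x) <= M * nr x.
Proof.
move=> bF hF.
have [//|x|m [M [M0 hM]]] := @uniform_weights I Q F (fun m _ => m%:R).
  have [M hM] := hF x; exists (Num.truncn M).+1 => i Qi.
  by rewrite (le_trans (hM i Qi))// ltW// truncnS_gt.
exists (M * m%:R + 1); split=> [|i x Qi]; first by rewrite ltr_wpDl// mulr_ge0// ltW.
by rewrite (le_trans (hM i x Qi))// ler_wpM2r ?nr_ge0// lerDl.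
Qed.

(** Convergent sequences are bounded, so [uniform_bound] applies to the family [F]. *)
Lemma bop_lim (F : nat -> X -> X) (N : X -> X) : (forall k, bop (F k)) ->
  (forall x, cvs (fun k => F k x) (N x)) -> bop N.
Proof.
move=> bF FN; split=> [a x y|].
  apply: (cvs_uniq (FN _)).
  have := cvsD (cvsZ a (FN x)) (FN y); congr (cvs _ _); apply/funext => n.
  by rewrite (bF n).1.
have [|x|M [M0 hM]] := @uniform_bound nat (fun=> True) F; first by move=> k _.
  have [N0 hN] := FN x 1 ltr01.
  exists (\sum_(k < N0) nr (F k x) + (nr (N x) + 1)) => k _.
  have [kN|Nk] := ltnP k N0.
    rewrite (bigD1 (Ordinal kN))//= -addrA lerDl addr_ge0//.
      by rewrite sumr_ge0// => j _; exact: nr_ge0.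
    by rewrite addr_ge0 ?nr_ge0.
  have s0 : 0 <= \sum_(k < N0) nr (F k x) by rewrite sumr_ge0// => j _; exact: nr_ge0.
  by have := hN k Nk; have := nr_subl (F k x) (N x); lra.
exists (M + 1) => x; have [->|x0] := eqVneq x 0.
  have h0 : N 0 = 0.
    apply: (cvs_uniq (FN 0)) => e e0; exists 0%N => k _.
    by rewrite (lin0 (bF k).1) subrr nr0.
  by rewrite h0 nr0 mulr0.
have nx := nr_gt0 x0; have [N0 hN] := FN x _ nx.
have := hN N0 (leqnn _); have := hM N0 x Logic.I.
have := nr_subl (N x) (F N0 x); rewrite (nrBC (N x)); lra.
Qed.

End UniformBoundedness.

(** * Derivatives on the open half-line *)

Section Derivatives.
Variables (R : realType) (X : completeNormedModType R[i]).

Lemma dnbhs0_cvg (f : R -> X) (l : X) : f h @[h --> 0^'] --> l ->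
  forall e : R, 0 < e -> exists d : R, 0 < d /\
     forall h, h != 0 -> `|h| < d -> nr (f h - l) < e.
Proof.
move=> /cvgrPdist_lt H e e0; have : 0 < e%:C :> R[i] by rewrite ltcR.
move=> /H/nbhs_ballP[d /= d0 hd]; exists d; split=> // h h0 hd'.
have := hd h; rewrite /ball /= sub0r normrN => /(_ hd' h0).
by rewrite nrE ltcR nrBC.
Qed.

Lemma cvg_dnbhs_right (f : R -> X) (l : X) :
  f h @[h --> 0^'] --> l -> f h @[h --> 0^'+] --> l.
Proof.
move=> /dnbhs0_cvg H; apply/cvg_at_right0 => e /H[d [d0 hd]].
exists d; split=> // h h0 hh; apply: hd; first by rewrite gt_eqF.
by rewrite gtr0_norm.
Qed.

Lemma rderive_cvg (g : R -> X) t : rderivable g t ->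
  rdiffq g t h @[h --> 0^'] --> rderive g t.
Proof. by []. Qed.

Lemma rderive_unique (g : R -> X) t l :
  rdiffq g t h @[h --> 0^'] --> l -> rderive g t = l.
Proof. exact: (cvg_lim (@norm_hausdorff _ X)). Qed.

Lemma rderiven_local (g g' : R -> X) : smooth_on_pos g' ->
  (forall s, 0 < s -> g s = g' s) ->
  forall n t, 0 < t -> rderiven n g t = rderiven n g' t.
Proof.
move=> sg' gg'; elim=> [|n IH] t t0; first exact: gg'.
rewrite /rderiven !iterS; apply: rderive_unique.
apply: cvg_dnbhs0 => e e0.
have [d [d0 hd]] := dnbhs0_cvg (rderive_cvg (sg' n t t0)) e0.
exists (Num.min d t); split=> [|h h0]; first by rewrite lt_min d0.
rewrite lt_min => /andP[hd' ht]; have th : 0 < t + h.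
  by move: ht; rewrite ltr_norml => /andP[]; lra.
have := hd h h0 hd'; rewrite /rdiffq.
have -> : iter n (@rderive R X) g (t + h) = rderiven n g' (t + h) by exact: IH.
by have -> : iter n (@rderive R X) g t = rderiven n g' t by exact: IH.
Qed.

End Derivatives.

(** * Derivatives on approximate eigenvectors *)

Section Necessity.
Variables (R : realType) (X : completeNormedModType R[i]).
Variables (dot : {dot X for @Num.conj R[i]}) (hdot : induces_norm dot).
Variables (A : operator X) (hA : normal_op dot A).
Variables (beta : R) (T : R -> {linear X -> X}).
Hypotheses (TA : generates A T) (TG : roumieu_gevrey beta T).
Local Notation D := (op_dom A).

Let bT t : 0 <= t -> bop (T t).
Proof. by have [[cT _ _ _] _] := TA; move=> t0; exact/bop_cont/cT. Qed.

Let T0 x : T 0 x = x. Proof. by have [[_ + _ _] _] := TA; apply. Qed.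

Let TD s t x : 0 <= s -> 0 <= t -> T (s + t) x = T s (T t x).
Proof. by have [[_ _ + _] _] := TA; move=> h s0 t0; exact: h. Qed.

Let Tc x : forall e : R, 0 < e -> exists d : R, 0 < d /\
  forall h, 0 < h -> h < d -> nr (T h x - x) < e.
Proof. by have [[_ _ _ cT] _] := TA; apply/cvg_at_right0/cT. Qed.

Let TAx x : D x -> (h^-1)%:C *: (T h x - x) @[h --> 0^'+] --> A x.
Proof.
have [_ [dE vE]] := TA; move=> Dx; rewrite (vE x Dx).
by move: Dx; rewrite dE.
Qed.

Let G n t f := rderiven n (fun s => T s f) t.

Let smooth f : smooth_on_pos (fun s => T s f).
Proof. by have [] := TG f. Qed.

(** By induction, [G n.+1 t] is a pointwise limit of difference quotients with steps [1 / (k + 1)],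
    which are bounded operators. *)
Let bG n t : 0 < t -> bop (G n t).
Proof.
elim: n t => [|n IH] t t0; first by apply: bT; exact: ltW.
pose F (k : nat) f := ((k.+1%:R^-1 : R)^-1)%:C *: (G n (t + k.+1%:R^-1) f - G n t f).
apply: (@bop_lim _ _ F) => [k|f].
  apply: bop_scale; have k0 : 0 < t + k.+1%:R^-1 by rewrite addr_gt0// invr_gt0.
  have := bop_add (IH _ k0) (bop_scale (-1) (IH _ t0)).
  by under [X in bop X]funext do rewrite scaleN1r.
move=> e e0; have [d [d0 hd]] := dnbhs0_cvg (rderive_cvg (@smooth f n t t0)) e0.
have [N HN] := inv_small d0; exists N => k /HN h.
have k0 : 0 < k.+1%:R^-1 :> R by rewrite invr_gt0.
by apply: hd; rewrite ?gt_eqF// gtr0_norm.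
Qed.

Let G_bound : exists al K : R, [/\ 0 < al, 0 < K &
  forall n f, nr (G n 1 f) <= K * al ^+ n * n`!%:R `^ beta * nr f].
Proof.
have [n _|f|m [M [M0 hM]]] := @uniform_weights R X nat (fun=> True) (fun n f => G n 1 f)
   (fun m n => m%:R * m%:R ^+ n * n`!%:R `^ beta).
- exact: bG.
- have [_ /(_ 1 1 ltr01 (lexx 1))[al [K [al0 K0 h]]]] := TG f.
  (* A single integer dominates both constants, as Baire's theorem needs a countable family. *)
  pose m := (maxn (Num.truncn al).+1 (Num.truncn K).+1); exists m => n _.
  have alm : al <= m%:R.
    by rewrite (le_trans (ltW (truncnS_gt al)))// ler_nat leq_maxl.
  have Km : K <= m%:R.
    by rewrite (le_trans (ltW (truncnS_gt K)))// ler_nat leq_maxr.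
  have := h n 1 (ltac:(by rewrite !lexx)); rewrite nrE lecR => /le_trans; apply.
  rewrite ler_wpM2r ?powR_ge0// ler_pM ?exprn_ge0 ?(ltW al0) ?(ltW K0)//.
  by rewrite lerXn2r ?nnegrE ?(ltW al0)// ler0n.
exists (m%:R + 1), (M * (m%:R + 1)); split=> [||n f].
- by rewrite ltr_wpDl.
- by rewrite mulr_gt0// ltr_wpDl.
rewrite (le_trans (hM n f Logic.I))// ler_wpM2r ?nr_ge0// -!mulrA ler_wpM2l ?(ltW M0)//.
rewrite !mulrA ler_wpM2r ?powR_ge0// ler_pM ?exprn_ge0//; first by rewrite lerDl.
by rewrite lerXn2r ?nnegrE ?addr_ge0// lerDl.
Qed.

(** Pointwise, strong continuity bounds the orbit near [0] and the Gevrey bound with [n = 0] bounds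
    it on the rest of [[0, 1]]. *)
Let T_bound : exists M : R, 0 < M /\ forall t x, 0 <= t <= 1 -> nr (T t x) <= M * nr x.
Proof.
have [t /andP[t0 _]|x|M [M0 hM]] :=
    @uniform_bound R X R (fun t => 0 <= t <= 1) (fun t x => T t x).
- exact: bT.
- have [d [d0 hd]] := Tc x ltr01.
  pose c := Num.min (d / 2) 1; have c0 : 0 < c by rewrite lt_min divr_gt0//=.
  have c1 : c <= 1 by rewrite ge_min lexx orbT.
  have cd : c < d.
    by rewrite (@le_lt_trans _ _ (d / 2)) ?ge_min ?lexx//; lra.
  have [_ /(_ c 1 c0 c1)[al [K [al0 K0 h]]]] := TG x.
  exists (nr x + 1 + K * 1 `^ beta) => t /andP[t0 t1].
  have p0 : 0 <= K * 1 `^ beta by rewrite mulr_ge0 ?powR_ge0// ltW.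
  have nx := nr_ge0 x.
  have [ct|tc] := leP c t.
    have := h 0%N t (ltac:(by rewrite ct)); rewrite nrE lecR expr0 fact0 mulr1.
    rewrite /rderiven /=; lra.
  move: t0; rewrite le_eqVlt => /orP[/eqP <-|t0]; first by rewrite T0; lra.
  have := hd t t0 (lt_trans tc cd); have := nr_subl (T t x) x; lra.
by exists M; split.
Qed.

(** The semigroup law identifies the right derivative of the orbit at [s] with [T s (A x)]; the
    two-sided derivative exists by smoothness and must agree with it. *)
Let G_succ n t x : 0 < t -> D x -> G n.+1 t x = G n t (A x).
Proof.
move=> t0 Dx; rewrite /G /rderiven iterSr; apply: rderiven_local => // s s0.
have h1 := cvg_dnbhs_right (rderive_cvg (@smooth x 0%N s s0)).
apply: (cvg_unique (@norm_hausdorff _ X) h1).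
have cTs : continuous (T s) by apply/bop_cont/bT/ltW.
have h2 : T s ((h^-1)%:C *: (T h x - x)) @[h --> 0^'+] --> T s (A x).
  by apply: continuous_cvg; [exact: cTs | exact: TAx].
apply/cvg_at_right0 => e e0; have /cvg_at_right0/(_ e e0)[d [d0 hd]] := h2.
exists d; split=> // h h0 /(hd h h0).
by rewrite /rdiffq /= (TD x) ?(ltW s0) ?(ltW h0)// linearZ linearB.
Qed.

(* Telescoping [T 1 - exp l] along the grid of mesh [1 / n] plays the role of the
   variation of constants formula. *)
Let T_eigen (l : R[i]) : exists C : R, 0 <= C /\ forall x, D x ->
  nr (T 1 x - cexp l *: x) <= C * nr (A x - l *: x).
Proof.
have [M [M0 hM]] := T_bound.
(* The absolute value makes [exp (s q)] increasing in [s], so one bound covers the whole grid. *)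
pose q := `|complex.Re l|; exists (M * expR q); split.
  by rewrite mulr_ge0 ?expR_ge0// ltW.
move=> x Dx.
have tel (h : R) k : 0 <= h -> k%:R * h <= 1 ->
    nr (T (k%:R * h) x - cexp ((k%:R * h)%:C * l) *: x) <=
    k%:R * M * expR (k%:R * h * q) * nr (T h x - cexp (h%:C * l) *: x).
  move=> h0; elim: k => [|k IH] kh.
    by rewrite !mul0r T0 cexp0 scale1r subrr nr0.
  have kh0 : 0 <= k%:R * h by rewrite mulr_ge0.
  have kE : k.+1%:R * h = k%:R * h + h by rewrite -natr1 mulrDl mul1r.
  have kh1 : k%:R * h <= 1 by move: kh; rewrite kE; lra.
  have -> : T (k.+1%:R * h) x - cexp ((k.+1%:R * h)%:C * l) *: x =
      T (k%:R * h) (T h x - cexp (h%:C * l) *: x) +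
      cexp (h%:C * l) *: (T (k%:R * h) x - cexp ((k%:R * h)%:C * l) *: x).
    rewrite kE (TD x kh0 h0) rmorphD mulrDl cexpD [T (_ * _) (_ - _)]linearB.
    rewrite [T _ (cexp _ *: _)]linearZ scalerBr scalerA.
    by rewrite addrA subrK [cexp _ * cexp _]mulrC.
  apply: (le_trans (nrD _ _)).
  have h1 := hM (k%:R * h) (T h x - cexp (h%:C * l) *: x) (ltac:(by rewrite kh0)).
  rewrite nrZ normc_cexp; have {}IH := IH kh1.
  have -> : complex.Re (h%:C * l) = h * complex.Re l by case: (l) => u v /=; rewrite mul0r subr0.
  set d := nr (T h x - _) in h1 IH *; have d0 : 0 <= d by exact: nr_ge0.
  have e1 : expR (h * complex.Re l) <= expR (h * q) by rewrite ler_expR ler_wpM2l// ler_norm.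
  have e2 : expR (k.+1%:R * h * q) = expR (h * q) * expR (k%:R * h * q).
    by rewrite kE mulrDl addrC expRD.
  have e3 : 1 <= expR (k.+1%:R * h * q).
    by rewrite -expR0 ler_expR mulr_ge0 ?normr_ge0// mulr_ge0.
  have h2 : expR (h * complex.Re l) * nr (T (k%:R * h) x - cexp ((k%:R * h)%:C * l) *: x) <=
      expR (h * q) * (k%:R * M * expR (k%:R * h * q) * d).
    by rewrite ler_pM ?expR_ge0 ?nr_ge0.
  have h3 : M * d <= M * expR (k.+1%:R * h * q) * d.
    by rewrite -mulrA ler_wpM2l ?(ltW M0)// ler_peMl.
  apply: (le_trans (lerD h1 h2)); apply: (le_trans (lerD h3 (lexx _))).
  by rewrite e2 -natr1 le_eqVlt; apply/orP; left; apply/eqP; ring.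
apply: (@le_eps _ _ _ (M * expR q * (1 + nr x))) => e e0.
have /cvg_at_right0/(_ e e0)[d [d0 hd]] := TAx Dx.
pose B := 8 * normc l ^+ 2 * (1 + expR q); have B0 : 0 <= B.
  by rewrite mulr_ge0 ?addr_ge0 ?expR_ge0// mulr_ge0 ?sqr_ge0.
have dB : 0 < Num.min d (e / (B + 1)) by rewrite lt_min d0 divr_gt0// ltr_wpDl.
have [N HN] := inv_small dB; have {HN} := HN N (leqnn N).
set h := N.+1%:R^-1; have h0 : 0 < h by rewrite invr_gt0.
have nh : N.+1%:R * h = 1 by rewrite mulfV.
have h1 : h <= 1 by rewrite invf_le1 ?ler1n.
rewrite lt_min => /andP[hd1 hd2].
have := tel h N.+1 (ltW h0); rewrite nh mul1r => /(_ (lexx 1)).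
rewrite mul1r => tl.
have {}hd := hd h h0 hd1.
(* Divided by [h], the one-step defect is [A x - l x] plus two errors: that of the difference
   quotient, below [e], and the Taylor remainder of [exp (h l)], at most [h B |x| <= e |x|]. *)
have key : N.+1%:R * nr (T h x - cexp (h%:C * l) *: x) <= nr (A x - l *: x) + e * (1 + nr x).
  have -> : N.+1%:R * nr (T h x - cexp (h%:C * l) *: x) =
      nr ((h^-1)%:C *: (T h x - cexp (h%:C * l) *: x)).
    by rewrite nrZR gtr0_norm ?invr_gt0// /h invrK.
  have hC : (h^-1)%:C * h%:C = 1 :> R[i] by rewrite -rmorphM /= mulVf ?gt_eqF.
  have -> : (h^-1)%:C *: (T h x - cexp (h%:C * l) *: x) =
      ((h^-1)%:C *: (T h x - x) - A x) + (A x - l *: x) -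
      ((h^-1)%:C * (cexp (h%:C * l) - 1 - h%:C * l)) *: x.
    have eC : (h^-1)%:C * (cexp (h%:C * l) - 1 - h%:C * l) =
        (h^-1)%:C * cexp (h%:C * l) - (h^-1)%:C - l.
      transitivity ((h^-1)%:C * cexp (h%:C * l) - (h^-1)%:C - (h^-1)%:C * h%:C * l).
        by ring.
      by rewrite hC mul1r.
    have gen (p r s t : X) : p - r = p - s - t - (r - s - t).
      by rewrite -[p - s - t]addrA -[r - s - t]addrA -!opprD opprB addrA subrK.
    rewrite addrA subrK eC !scalerBl !scalerBr scalerA; exact: gen.
  apply: (le_trans (nrB _ _)); apply: (le_trans (lerD (nrD _ _) (lexx _))).
  have h4 : nr (((h^-1)%:C * (cexp (h%:C * l) - 1 - h%:C * l)) *: x) <= e * nr x.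
    rewrite nrZ ler_wpM2r ?nr_ge0// normcM normcR gtr0_norm ?invr_gt0//.
    rewrite ler_pdivrMl//; apply: (le_trans (cexp_taylor _)).
    rewrite normcM normcR gtr0_norm//.
    have -> : complex.Re (h%:C * l) = h * complex.Re l by case: (l) => u v /=; rewrite mul0r subr0.
    have e1 : expR (h * complex.Re l) <= expR q.
      rewrite ler_expR (le_trans (ler_norm _))// normrM gtr0_norm// ler_piMl//.
    have : 8 * (h * normc l) ^+ 2 * (1 + expR (h * complex.Re l)) <= h * (h * B).
      have -> : h * (h * B) = 8 * (h * normc l) ^+ 2 * (1 + expR q) by rewrite /B; ring.
      by rewrite ler_wpM2l ?lerD2l// mulr_ge0 ?sqr_ge0.
    move=> /le_trans; apply; rewrite ler_wpM2l ?(ltW h0)//.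
    by move: hd2; rewrite ltr_pdivlMr ?ltr_wpDl//; lra.
  lra.
apply: (le_trans tl).
have -> : N.+1%:R * M * expR q * nr (T h x - cexp (h%:C * l) *: x) =
  M * expR q * (N.+1%:R * nr (T h x - cexp (h%:C * l) *: x)) by ring.
have -> : M * expR q * nr (A x - l *: x) + e * (M * expR q * (1 + nr x)) =
  M * expR q * (nr (A x - l *: x) + e * (1 + nr x)) by ring.
by rewrite ler_wpM2l// mulr_ge0 ?expR_ge0// ltW.
Qed.

(** By [G_succ], the defect of order [n + 1] is [G n 1 (A x - l x)] plus [l] times the defect of
    order [n]. *)
Let G_eigen (l : R[i]) n : exists C : R, 0 <= C /\ forall x, D x ->
  nr (G n 1 x - l ^+ n *: T 1 x) <= C * nr (A x - l *: x).
Proof.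
elim: n => [|n [C [C0 IH]]].
  by exists 0; split=> // x Dx; rewrite expr0 scale1r /G /= subrr nr0 mul0r.
have bGn := bG n ltr01; have [B [B0 hB]] := bop_pos bGn.
exists (B + normc l * C); split=> [|x Dx].
  by rewrite addr_ge0 ?(ltW B0)// mulr_ge0 ?normc_ge0.
have -> : G n.+1 1 x - l ^+ n.+1 *: T 1 x =
    G n 1 (A x - l *: x) + l *: (G n 1 x - l ^+ n *: T 1 x).
  rewrite G_succ// (linB bGn.1) (linZ bGn.1) scalerBr scalerA exprS.
  by rewrite addrA subrK.
apply: (le_trans (nrD _ _)); rewrite mulrDl lerD// nrZ -mulrA.
by rewrite ler_wpM2l ?normc_ge0 ?IH.
Qed.

Lemma gevrey_spectrum : 1 <= beta -> exists b a : R, 0 < b /\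
  spectrum A `<=` [set l : R[i] | complex.Re l <= a - b * `|complex.Im l| `^ beta^-1].
Proof.
move=> beta1; have [al [K [al0 K0 hG]]] := G_bound.
have [b [a [b0 hab]]] := gevrey_region beta1 al0 K0.
exists b, a; split=> // l hl; apply: hab => n.
have [C1 [C10 hC1]] := T_eigen l; have [C2 [C20 hC2]] := G_eigen l n.
have nX (z : R[i]) k : normc (z ^+ k) = normc z ^+ k.
  by elim: k => [|k IH]; rewrite ?expr0 ?normc1// !exprS normcM IH.
apply: (@le_eps _ _ _ (C2 + normc l ^+ n * C1)) => e e0.
(* Otherwise [l - A] would be bounded below by [e] and [l] would lie in the resolvent set. The
   strict inequality also forces [x] to be nonzero. *)
have [x [Dx hx]] : exists x, D x /\ nr (l *: x - A x) < e * nr x.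
  apply: contrapT => H; apply: hl; apply: (bounded_below_resolvent hdot hA e0).
  move=> x Dx; rewrite leNgt; apply/negP => hx; apply: H; exists x; split=> //.
have nx : 0 < nr x.
  by have := nr_ge0 (l *: x - A x); rewrite -(pmulr_rgt0 _ e0); lra.
rewrite -(ler_pM2r nx); rewrite nrBC in hx.
have h1 := hC1 x Dx; have h2 := hC2 x Dx; have h3 := hG n x.
have -> : normc l ^+ n * expR (complex.Re l) * nr x = nr (l ^+ n *: (cexp l *: x)).
  by rewrite !nrZ nX normc_cexp mulrA.
have h4 := nr_tri (l ^+ n *: T 1 x) (l ^+ n *: (cexp l *: x)) (G n 1 x).
have h5 : nr (l ^+ n *: (cexp l *: x) - l ^+ n *: T 1 x) <= normc l ^+ n * (C1 * nr (A x - l *: x)).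
  by rewrite -scalerBr nrZ nX nrBC ler_wpM2l ?exprn_ge0 ?normc_ge0.
rewrite (nrBC (l ^+ n *: T 1 x)) in h4.
have h6 := nr_subl (l ^+ n *: (cexp l *: x)) (G n 1 x).
have h7 : (C2 + normc l ^+ n * C1) * nr (A x - l *: x) <= (C2 + normc l ^+ n * C1) * (e * nr x).
  by rewrite ler_wpM2l ?(ltW hx)// addr_ge0// mulr_ge0// exprn_ge0// normc_ge0.
lra.
Qed.

End Necessity.

Theorem corollary6p4 (R : realType) (X : completeNormedModType R[i])
    (dot : {dot X for @Num.conj R[i]}) (hdot : induces_norm dot)
    (beta : R) (hbeta : 1 <= beta)
    (A : operator X) (hA : normal_op dot A) :
  (exists T : R -> {linear X -> X},
     [/\ generates A T,
         forall t : R, 0 <= t -> normal_op dot (Operator setT (T t)) &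
         roumieu_gevrey beta T])
  <->
  (exists b a : R, 0 < b /\
     spectrum A `<=`
       [set l : R[i] | complex.Re l <= a - b * `|complex.Im l| `^ (beta^-1)]).
Proof.
split=> [[T [TA _ TG]]|[b [a [b0 hs]]]].
  exact: (gevrey_spectrum hdot hA TA TG hbeta).
(* Replacing [a] by its absolute value only enlarges the region and provides the sign used in the
   estimates. *)
apply: (@region_generates _ _ _ hdot A hA `|a| b beta) => // l hl.
apply: contrapT => /hs /= h; apply: hl; apply: (le_trans h).
by rewrite lerD2r ler_norm.
Qed.
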